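(* Let $K$ be a field, $S=K[x_1,\ldots,x_n]$, let $d$ be a positive integer, let $\mathbf a=(a_1,\ldots,a_n)$ be an integer vector with $a_1\ge a_2\ge\cdots\ge a_n\ge 0$, and let $I=I_{\mathbf a,n,d}\subset S$ be the Veronese type ideal, i.e. the monomial ideal with minimal generating set $$G(I)=\Big\{x_1^{b_1}x_2^{b_2}\cdots x_n^{b_n} \;:\; \sum_{i=1}^n b_i=d\ \text{and } b_i\le a_i \text{ for } i=1,\ldots,n\Big\}=\{u_1,\ldots,u_q\}.$$ Write the fiber cone of $I$ as $F(I)=K[t_{u_1},\ldots,t_{u_q}]/J$, where $J$ is its defining (toric) ideal, and let $T_I$ be the matrix associated to $I$. Then: (a) The ideal $J$ is generated by the set of binomial $2$-minors of $T_I$; that is, $$J=\Big(t_ut_v-t_{u'}t_{v'} \;:\; u,v,u',v'\in G(I),\ \begin{pmatrix} t_u & t_{u'}\\ t_{v'} & t_v\end{pmatrix}\text{ is a submatrix of } T_I\Big).$$ (b) $F(I)$ is a reduced Koszul algebra. (c) $F(I)$ is a Cohen--Macaulay normal domain.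
   Context: Fiber cone: let $\mathfrak m=(x_1,\ldots,x_n)$. For a monomial ideal $I\subset S$, $F(I)=\bigoplus_{k\ge 0} I^k/\mathfrak m I^k$, a standard graded $K$-algebra. With $G(I)=\{u_1,\ldots,u_q\}$ the minimal set of monomial generators, the defining ideal $J$ of $F(I)$ is the kernel of the $K$-algebra homomorphism $K[t_{u_1},\ldots,t_{u_q}]\to F(I)$, $t_{u_i}\mapsto u_i+\mathfrak m I\in I/\mathfrak m I$ (the $t_{u_i}$ are independent variables). The matrix $T_I$: let $I$ be minimally generated by monomials of degree $d$. Let $M$ be the matrix with $n$ rows and $\binom{n+d-2}{d-1}$ columns whose $i$-th row consists of the degree-$d$ monomials divisible by $x_i$, ordered lexicographically (with $x_1>\cdots>x_n$), decreasing from left to right. (Equivalently, the columns are indexed by the monomials $w$ of degree $d-1$ in decreasing lexicographic order, and the entry in row $i$ and column $w$ is $x_iw$.) Replace every entry of $M$ not belonging to $G(I)$ by $0$, remove the zero columns, and replace each remaining nonzero entry $u$ by the variable $t_u$. The result is $T_I$. Binomial $2$-minors: a binomial has exactly two nonzero monomials. The binomial $2$-minors of a matrix with entries that are variables or $0$ are the determinants of its $2\times 2$ submatrices having no zero entries. *)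

(* Defs.v *)
From HB Require Import structures.
From mathcomp Require Import all_boot all_order all_algebra.
From mathcomp Require Import boolp classical_sets.
From mathcomp Require Import mpoly.

Set Implicit Arguments.
Unset Strict Implicit.
Unset Printing Implicit Defensive.

Import Order.TTheory GRing.Theory.

Local Open Scope classical_set_scope.
Local Open Scope ring_scope.

Section Ideals.
Variable R : comNzRingType.
Implicit Types (X Y : set R).

Definition ideal_gen X : set R :=
  [set f | exists m (c g : 'I_m -> R),
     (forall i, X (g i)) /\ f = \sum_(i < m) c i * g i].

Definition ideal_mul X Y : set R :=
  ideal_gen [set x * y | x in X & y in Y].

Fixpoint ideal_exp X k : set R :=
  if k is k'.+1 then ideal_mul X (ideal_exp X k') else [set: R].

Lemma ideal_gen0 X : ideal_gen X 0.
Proof.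
exists 0%N, (fun=> 0), (fun=> 0); split; first by case.
by rewrite big_ord0.
Qed.

Lemma ideal_genD X f g : ideal_gen X f -> ideal_gen X g -> ideal_gen X (f + g).
Proof.
move=> [m [c [u [Xu ->]]]] [m' [c' [u' [Xu' ->]]]].
exists (m + m')%N, (fun i => match split i with inl j => c j | inr j => c' j end),
  (fun i => match split i with inl j => u j | inr j => u' j end).
split; first by move=> i; case: (split i).
rewrite big_split_ord /=; congr (_ + _); apply: eq_bigr => i _.
  by rewrite (unsplitK (inl i)).
by rewrite (unsplitK (inr i)).
Qed.

Lemma ideal_genMl X a f : ideal_gen X f -> ideal_gen X (a * f).
Proof.
move=> [m [c [u [Xu ->]]]]; exists m, (fun i => a * c i), u; split=> //.
by rewrite mulr_sumr; apply: eq_bigr => i _; rewrite mulrA.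
Qed.

Lemma ideal_gen_sub X x : X x -> ideal_gen X x.
Proof.
move=> Xx; exists 1%N, (fun=> 1), (fun=> x); split=> //.
by rewrite big_ord1 mul1r.
Qed.

Lemma ideal_gen_sum X (T : Type) (r : seq T) (P : pred T) (F : T -> R) :
  (forall i, P i -> ideal_gen X (F i)) -> ideal_gen X (\sum_(i <- r | P i) F i).
Proof. by move=> XF; apply: big_ind => //; [exact: ideal_gen0|exact: ideal_genD]. Qed.

Lemma ideal_genN X f : ideal_gen X f -> ideal_gen X (- f).
Proof. by rewrite -mulN1r; exact: ideal_genMl. Qed.

Lemma ideal_exp0 X k : ideal_exp X k 0.
Proof. by case: k => // k; exact: ideal_gen0. Qed.

Lemma ideal_expD X k f g :
  ideal_exp X k f -> ideal_exp X k g -> ideal_exp X k (f + g).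
Proof. by case: k => // k; exact: ideal_genD. Qed.

Lemma ideal_expMl X k a f : ideal_exp X k f -> ideal_exp X k (a * f).
Proof. by case: k => // k; exact: ideal_genMl. Qed.

Lemma ideal_expN X k f : ideal_exp X k f -> ideal_exp X k (- f).
Proof. by case: k => // k; exact: ideal_genN. Qed.

Lemma ideal_exp_mul X i j f g :
  ideal_exp X i f -> ideal_exp X j g -> ideal_exp X (i + j) (f * g).
Proof.
elim: i f => [|i IH] f; first by rewrite add0n => _; exact: ideal_expMl.
rewrite addSn => -[m [c [u [Xu ->]]]] Xg; rewrite mulr_suml.
apply: ideal_gen_sum => k _; have [x Xx [y Xy <-]] := Xu k.
rewrite -!mulrA; apply: ideal_genMl; apply: ideal_gen_sub.
by exists x => //; exists (y * g); first exact: IH.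
Qed.

Lemma ideal_exp_sum X k (T : Type) (r : seq T) (P : pred T) (F : T -> R) :
  (forall i, P i -> ideal_exp X k (F i)) -> ideal_exp X k (\sum_(i <- r | P i) F i).
Proof. by move=> XF; apply: big_ind => //; [exact: ideal_exp0|exact: ideal_expD]. Qed.

End Ideals.

Section FiberCone.
Variables (K : fieldType) (n : nat).
Local Notation S := {mpoly K[n]}.

Definition irrel_ideal : set S := ideal_gen (range (fun i : 'I_n => ('X_i : S))).

Lemma irrel_ideal_coef0 f : irrel_ideal f -> f@_0%MM = 0.
Proof.
move=> [m [c [g [Xg ->]]]]; rewrite raddf_sum /= big1 // => i _.
by have [j _ <-] := Xg i; rewrite rmorphM /= mcoeffX mnm1_eq0 mulr0.
Qed.

Variable I : set S.

(* The Rees algebra, with the polynomial variable marking the degree k of I^k. *)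
Definition rees_pred : {pred {poly S}} :=
  [pred p : {poly S} | `[< forall k, ideal_exp I k p`_k >]].

Lemma rees_predP (p : {poly S}) :
  reflect (forall k, ideal_exp I k p`_k) (p \in rees_pred).
Proof. exact: asboolP. Qed.

Lemma rees_subring : subring_closed rees_pred.
Proof.
split; first by apply/rees_predP => -[|k] //; rewrite coef1; exact: ideal_gen0.
  move=> p q /rees_predP pI /rees_predP qI; apply/rees_predP => k.
  by rewrite coefB; apply: ideal_expD => //; exact: ideal_expN.
move=> p q /rees_predP pI /rees_predP qI; apply/rees_predP => k.
rewrite coefM; apply: ideal_exp_sum => i _.
by have := ideal_exp_mul (pI i) (qI (k - i)%N); rewrite subnKC // -ltnS.
Qed.

HB.instance Definition _ :=
  GRing.isSubringClosed.Build {poly S} rees_pred rees_subring.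

Record rees := Rees { rees_val : {poly S}; _ : rees_val \in rees_pred }.
HB.instance Definition _ := [isSub for rees_val].
HB.instance Definition _ := [Choice of rees by <:].
HB.instance Definition _ := [SubChoice_isSubComNzRing of rees by <:].

Definition fiber_rel : {pred rees} :=
  [pred p : rees |
    `[< forall k, ideal_mul irrel_ideal (ideal_exp I k) (val p)`_k >]].

Lemma fiber_rel_idealr : idealr_closed fiber_rel.
Proof.
split.
- by apply/asboolP => k; rewrite raddf0 coef0; exact: ideal_gen0.
- apply/negP => /asboolP/(_ 0%N); rewrite rmorph1 coef1 /=.
  move=> [m [c [g [Xg]]]] /(congr1 (mcoeff 0%MM)).
  rewrite mcoeff1 eqxx raddf_sum /= big1 => [/eqP|i _]; first by rewrite oner_eq0.
  have [x /irrel_ideal_coef0 x0 [y _ <-]] := Xg i.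
  by rewrite rmorphM /= rmorphM /= x0 mul0r mulr0.
- move=> a p q /asboolP pI /asboolP qI; apply/asboolP => k.
  have -> : val (a * p + q) = val a * val p + val q by [].
  rewrite coefD; apply: ideal_genD; last exact: qI.
  rewrite coefM; apply: ideal_gen_sum => i _.
  have /rees_predP aI := valP a.
  have [m [c [g [Xg ->]]]] := pI (k - i)%N.
  rewrite mulr_sumr; apply: ideal_gen_sum => j _.
  have [x xm [y yI <-]] := Xg j.
  rewrite mulrCA; apply: ideal_genMl; rewrite mulrCA.
  apply: ideal_gen_sub; exists x => //; exists ((val a)`_i * y) => //.
  by have := ideal_exp_mul (aI i) yI; rewrite subnKC // -ltnS.
Qed.

HB.instance Definition _ := isIdealr.Build rees fiber_rel fiber_rel_idealr.

(* Numerator and denominator are both formed degree by degree, so this is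
   the direct sum of the I^k / m I^k. *)
Definition fiber_cone := {ideal_quot fiber_rel}.

HB.instance Definition _ := GRing.ComNzRing.on fiber_cone.
HB.instance Definition _ := EqQuotient.on fiber_cone.

Fact rees_const_subproof (c : K) : (c%:MP)%:P \in rees_pred.
Proof.
by apply/rees_predP => -[|k] //; rewrite coefC; exact: ideal_gen0.
Qed.

Definition fiber_const (c : K) : fiber_cone :=
  \pi_{ideal_quot fiber_rel}%qT (Rees (rees_const_subproof c)).

Fact fiber_constD : {morph fiber_const : a b / a + b}.
Proof.
move=> a b; rewrite /fiber_const -rmorphD; congr (\pi_(_)%qT _).
by apply: val_inj; rewrite /= !rmorphD.
Qed.

Fact fiber_constM : {morph fiber_const : a b / a * b}.
Proof.
move=> a b; rewrite /fiber_const -rmorphM; congr (\pi_(_)%qT _).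
by apply: val_inj; rewrite /= !rmorphM.
Qed.

Fact fiber_const1 : fiber_const 1 = 1.
Proof.
rewrite /fiber_const -[RHS](rmorph1 (\pi_{ideal_quot fiber_rel}%qT)).
by congr (\pi_(_)%qT _); apply: val_inj; rewrite /= !rmorph1.
Qed.

Definition fiber_scale (c : K) (x : fiber_cone) : fiber_cone :=
  fiber_const c * x.

Fact fiber_scaleA a b v : fiber_scale a (fiber_scale b v) = fiber_scale (a * b) v.
Proof. by rewrite /fiber_scale fiber_constM mulrA. Qed.
Fact fiber_scale1 : left_id 1 fiber_scale.
Proof. by move=> x; rewrite /fiber_scale fiber_const1 mul1r. Qed.
Fact fiber_scaleDr : right_distributive fiber_scale +%R.
Proof. by move=> a x y; rewrite /fiber_scale mulrDr. Qed.
Fact fiber_scaleDl v : {morph fiber_scale^~ v : a b / a + b}.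
Proof. by move=> a b; rewrite /fiber_scale fiber_constD mulrDl. Qed.
HB.instance Definition _ := GRing.Zmodule_isLmodule.Build K fiber_cone
  fiber_scaleA fiber_scale1 fiber_scaleDr fiber_scaleDl.
Fact fiber_scaleAl (a : K) (x y : fiber_cone) : a *: (x * y) = a *: x * y.
Proof. by rewrite /GRing.scale /= /fiber_scale mulrA. Qed.
HB.instance Definition _ :=
  GRing.Lmodule_isLalgebra.Build K fiber_cone fiber_scaleAl.
HB.instance Definition _ := GRing.Lalgebra_isComAlgebra.Build K fiber_cone.

(* I^k / m I^k inside F(I) *)
Definition fiber_comp (k : nat) : set fiber_cone :=
  [set x | exists2 p : rees, forall j, j != k -> (val p)`_j = 0
                           & x = \pi_{ideal_quot fiber_rel}%qT p].

Fact rees_deg1_subproof f : I f -> f *: 'X \in rees_pred.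
Proof.
move=> If; apply/rees_predP => k; rewrite coefZ coefX.
case: eqP => [->|_]; last by rewrite mulr0; exact: ideal_exp0.
by rewrite mulr1 -[f]mulr1; apply: ideal_gen_sub; exists f => //; exists 1.
Qed.

(* f + m I in I / m I *)
Definition fiber_deg1 f (If : I f) : fiber_cone :=
  \pi_{ideal_quot fiber_rel}%qT (Rees (rees_deg1_subproof If)).

End FiberCone.

Arguments rees_pred {K n} I _.
Arguments fiber_rel {K n} I _.
Arguments fiber_comp {K n} I k _.

Section GradedAlgebras.
Variables (K : fieldType) (A : comAlgType K).
Variable A_ : nat -> set A.

(* The last two conditions express generation in degree 1 and
   finite-dimensionality of A_1. *)
Definition standard_graded : Prop :=
  [/\ (forall k, A_ k 0 /\
         forall (c : K) x y, A_ k x -> A_ k y -> A_ k (c *: x + y)),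
      (forall x : A, exists m (y : 'I_m -> A),
         (forall i : 'I_m, A_ i (y i)) /\ x = \sum_(i < m) y i) /\
      (forall m (y : 'I_m -> A), (forall i : 'I_m, A_ i (y i)) ->
         \sum_(i < m) y i = 0 -> forall i, y i = 0),
      A_ 0%N = range (in_alg A) /\
      (forall i j x y, A_ i x -> A_ j y -> A_ (i + j)%N (x * y)),
      (forall k z, A_ k.+1 z -> exists m (x y : 'I_m -> A),
         (forall i, A_ 1%N (x i) /\ A_ k (y i)) /\
         z = \sum_(i < m) x i * y i) &
      exists m (e : 'I_m -> A), forall x, A_ 1%N x ->
         exists c : 'I_m -> K, x = \sum_(i < m) c i *: e i].

Definition graded_irrelevant : set A := ideal_gen (\bigcup_k A_ k.+1).

(* K = A / A_+ has a linear free resolution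
     ... -> A(-2)^(b 2) -> A(-1)^(b 1) -> A^(b 0) = A -> K -> 0
   over A; the differentials act on row vectors, and being homogeneous of
   degree 0 between these shifts means having entries in A_1. *)
Definition koszul : Prop :=
  standard_graded /\
  exists (b : nat -> nat) (phi : forall i, 'M[A]_(b i.+1, b i)),
    [/\ b 0%N = 1%N,
        forall i r c, A_ 1%N (phi i r c),
        forall v : 'rV[A]_(b 0%N),
          (forall j, graded_irrelevant (v 0 j)) <->
          exists w : 'rV_(b 1%N), v = w *m phi 0%N &
        forall i (v : 'rV[A]_(b i.+1)),
          v *m phi i = 0 <-> exists w : 'rV_(b i.+2), v = w *m phi i.+1].

End GradedAlgebras.

Section CommutativeAlgebra.
Variable A : comNzRingType.
Implicit Types P Q : set A.

Definition reduced_ring : Prop := forall (x : A) k, x ^+ k = 0 -> x = 0.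

(* idealr_closed already requires the ideal to be proper. *)
Definition is_proper_ideal P : Prop := idealr_closed [pred x | x \in P].

Definition is_prime_ideal P : Prop :=
  is_proper_ideal P /\ prime_idealr_closed [pred x | x \in P].

Definition is_maximal_ideal P : Prop :=
  is_proper_ideal P /\ forall Q, is_proper_ideal Q -> P `<=` Q -> P = Q.

Definition noetherian : Prop :=
  forall P, is_proper_ideal P -> exists s : seq A, P = ideal_gen [set` s].

Definition regular_seq (s : seq A) : Prop :=
  (forall i, (i < size s)%N -> forall x,
     ideal_gen [set` take i s] (s`_i * x) -> ideal_gen [set` take i s] x) /\
  ~ ideal_gen [set` s] 1.

Definition is_depth P (h : nat) : Prop :=
  (exists s, [/\ regular_seq s, [set` s] `<=` P & size s = h]) /\
  (forall s, regular_seq s -> [set` s] `<=` P -> (size s <= h)%N).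

Definition prime_chain P (h : nat) : Prop :=
  exists p : nat -> set A,
    [/\ forall i, (i <= h)%N -> is_prime_ideal (p i),
        forall i, (i < h)%N -> p i `<` p i.+1 &
        p h = P].

Definition is_height P (h : nat) : Prop :=
  prime_chain P h /\ forall h', prime_chain P h' -> (h' <= h)%N.

(* depth(P, A) = codim P for every maximal ideal P, as in Eisenbud,
   Commutative Algebra, Chapter 18; is_depth and is_height are the length of
   the longest regular sequence in P and of the longest chain of primes
   below P. *)
Definition cohen_macaulay : Prop :=
  noetherian /\ forall P, is_maximal_ideal P ->
    exists h, is_depth P h /\ is_height P h.

(* idomainType carries a choice of units and inverses, hence the transport
   along an isomorphism. *)
Definition normal_domain : Prop :=
  exists (R : idomainType) (f : {rmorphism A -> R}), bijective f /\
    forall x : {fraction R}, integralOver (@tofrac R) x -> exists r, x = tofrac r.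

End CommutativeAlgebra.

Section TwoMinors.
Variables (R : comNzRingType) (m p : nat).

Definition mx22 (a b c d : R) : 'M[R]_2 :=
  \matrix_(i, j) if i == 0 then (if j == 0 then a else b)
                 else (if j == 0 then c else d).

Definition is_submatrix2 (B : 'M[R]_2) (T : 'M[R]_(m, p)) : Prop :=
  exists (f : 'I_2 -> 'I_m) (g : 'I_2 -> 'I_p),
    [/\ {homo f : i j / (i < j)%N}, {homo g : i j / (i < j)%N} &
        B = mxsub f g T].

Definition binomial_2minors (T : 'M[R]_(m, p)) : set R :=
  [set \det B | B in [set B | is_submatrix2 B T /\ forall i j, B i j != 0]].

End TwoMinors.

Section MonomialIdeals.
Variables (K : fieldType) (n : nat).

Definition monomials (k : nat) : seq 'X_{1..n} :=
  [seq u <- [seq bmnm w | w : 'X_{1..n < k.+1}] | mdeg u == k].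

Definition veronese_gens (a : 'I_n -> nat) (d : nat) : seq 'X_{1..n} :=
  [seq u : 'X_{1..n} <- monomials d | [forall i, u i <= a i]%N].

Variable G : seq 'X_{1..n}.

Definition monomial_ideal : set {mpoly K[n]} :=
  ideal_gen [set 'X_[u] | u in [set` G]].

Fact monomial_ideal_gen (i : 'I_(size G)) :
  monomial_ideal 'X_[tnth (in_tuple G) i].
Proof.
apply: ideal_gen_sub; exists (tnth (in_tuple G) i) => //=.
exact: mem_tnth.
Qed.

(* kernel of K[t_u | u in G] -> F(I); t_u is the variable whose number is
   the position of u in G. *)
Definition defining_ideal : set {mpoly K[size G]} :=
  [set f | mmap (in_alg (fiber_cone monomial_ideal))
                (fun i => fiber_deg1 (monomial_ideal_gen i)) f = 0].

(* t_u if u is in G, and 0 otherwise *)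
Definition tvar (u : 'X_{1..n}) : {mpoly K[size G]} :=
  if insub (index u G) is Some i then 'X_i else 0.

(* Labels of the nonzero columns. The order of 'X_{1..n} compares total
   degrees first and then exponents lexicographically with x_1 > ... > x_n. *)
Definition gen_columns (d : nat) : seq 'X_{1..n} :=
  [seq w <- sort (fun w w' => w' <= w)%O (monomials d.-1)
          | [exists i, (U_(i) + w)%MM \in G]].

Definition gen_matrix (d : nat) : 'M[{mpoly K[size G]}]_(n, size (gen_columns d)) :=
  \matrix_(i, j) tvar (U_(i) + tnth (in_tuple (gen_columns d)) j)%MM.

End MonomialIdeals.

Arguments monomial_ideal K {n} G _.
Arguments defining_ideal K {n} G _.
Arguments tvar K {n} G u.
Arguments gen_matrix K {n} G d.

(* Main.v *)
Require Import Defs.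
From HB Require Import structures.
From mathcomp Require Import all_boot all_order all_algebra.
From mathcomp Require Import boolp classical_sets.
From mathcomp Require Import realalg mpoly.
From mathcomp Require Import zify ring lra.

(* Let C be the set of pairs (k, b) with |b| = k d and b_i <= k a_i. Rounding
   b / k shows that C is generated by its elements of degree 1, so F(I) is the
   semigroup ring K[C], embedded in K[x_1, ..., x_n] by t_u |-> u.

   (a) Two products of k generators with the same value in K[x] are joined by
   exchanges (u, v) -> (u x_i / x_j, v x_j / x_i); each is a 2-minor of T_I.

   (b) The ideals generated by the w in G(I) admitting an exchange from a pair
   (i, j) in E x D with rho i < rho j form a Koszul filtration: ordered
   suitably, the colon ideals of consecutive generators are again of this form.

   (c) If (f / g) is integral over K[C], then h f^N lies in g^N K[C] for all N,
   so the leading exponent of f minus that of g lies in C; long division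
   by g then terminates. This gives normality.
   For the Cohen-Macaulay property, fix a point u_T in the relative interior of
   each face T of the cone spanned by C, all of the same degree, and let theta_s
   be the sum of the u_T over the s-dimensional faces. A generic small
   translate c + delta of c in C is a positive combination of the u_T along a
   unique flag of faces: subtract u_T as often as possible, pass to the face
   reached, and continue. Writing c = e + sum_s J_s u_s with J_s the integral
   parts of the coefficients, the products of x^e and the theta_s^(J_s) are
   unitriangular with respect to the monomials, since any other choice of faces
   yields lexicographically larger coefficients. Hence theta_1, ..., theta_r may
   be replaced by monic polynomials g_s(theta_s) in a maximal ideal P, which
   exist by Zariski's lemma, and these form a regular sequence of length r in P.
   Both the depth and the height of P are at most r because r + 1 elements of
   K[C] are algebraically dependent. *)

Set Implicit Arguments.
Unset Strict Implicit.
Unset Printing Implicit Defensive.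

Import Order.TTheory GRing.Theory.
Local Open Scope classical_set_scope.
Local Open Scope ring_scope.

(** * The fiber cone as a ring of polynomials *)

(** The field may be finite, so parameters cannot be taken as generic linear combinations of
    generators; sums over all faces of one dimension work over every field. Depth and height are
    tested at every maximal ideal, also at those not containing the [theta], which is what brings in
    the polynomials in [theta]. The cones spanned by the u_T along flags form a barycentric
    subdivision of the cone of C, and a lattice point may lie on several of them; the translate by
    delta decides to which one it belongs. The coordinates of delta are rationally independent, so
    no coefficient of c + delta is an integer: the fractional parts stay positive along a full flag
    of length r, and any number of copies of the u_s can be added to e without changing the flag or
    the remainder. On the other hand every facet form is below 1 on delta. These forms are integral
    on exponent vectors, so e, on which they exceed -1, lies in C again. *)

Lemma mcoeff_pihomog (K : fieldType) n k (p : {mpoly K[n]}) m :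
  (pihomog mdeg k p)@_m = if mdeg m == k then p@_m else 0.
Proof.
rewrite pihomogE raddf_sum /=.
case: ifP => mk; last first.
  rewrite big1 // => i /eqP ik; rewrite mcoeffZ mcoeffX.
  by case: eqP => [eim|]; rewrite ?mulr0 // -eim ik eqxx in mk *.
have [mp|mp] := boolP (m \in msupp p).
  rewrite -big_filter (bigD1_seq m) /=; first last.
  - by rewrite filter_uniq.
  - by rewrite mem_filter mk.
  rewrite mcoeffZ mcoeffX eqxx mulr1 big1 ?addr0 // => i im.
  by rewrite mcoeffZ mcoeffX (negbTE im) mulr0.
rewrite (memN_msupp_eq0 mp) big_seq_cond big1 // => i /andP[ip _].
rewrite mcoeffZ mcoeffX; case: eqP => [eim|]; rewrite ?mulr0 //.
by rewrite -eim ip in mp.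
Qed.

Section MonomialSums.
Variables (n : nat) (G : seq 'X_{1..n}).

Definition gsum (k : nat) (m : 'X_{1..n}) : Prop :=
  exists s : seq 'X_{1..n},
    [/\ size s = k, {subset s <= G} & m = (\sum_(u <- s) u)%MM].

Lemma gsum0 : gsum 0 0%MM.
Proof. by exists [::]; split=> //; rewrite big_nil. Qed.

Lemma gsum0P m : gsum 0 m -> m = 0%MM.
Proof. by move=> [s [/size0nil -> _ ->]]; rewrite big_nil. Qed.

Lemma gsum1 u : u \in G -> gsum 1 u.
Proof.
move=> uG; exists [:: u]; split=> //; last by rewrite big_seq1.
by move=> v; rewrite inE => /eqP ->.
Qed.

Lemma gsumD j k m m' : gsum j m -> gsum k m' -> gsum (j + k) (m + m')%MM.
Proof.
move=> [s [<- sG ->]] [s' [<- sG' ->]]; exists (s ++ s').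
split; [by rewrite size_cat| |by rewrite big_cat].
by move=> u; rewrite mem_cat => /orP[/sG|/sG'].
Qed.

Lemma gsumS k m : gsum k.+1 m -> exists u m',
  [/\ u \in G, gsum k m' & m = (u + m')%MM].
Proof.
move=> [[|u s] [//= [sk] sG ->]]; exists u, (\sum_(v <- s) v)%MM.
split; [by apply: sG; rewrite mem_head| |by rewrite big_cons].
by exists s; split=> // v vs; apply: sG; rewrite inE vs orbT.
Qed.

Variable d : nat.
Hypothesis Gd : {in G, forall u, mdeg u = d}.

Lemma gsum_mdeg k m : gsum k m -> mdeg m = (k * d)%N.
Proof.
elim: k m => [|k IH] m; first by move/gsum0P ->; rewrite mdeg0.
by move=> /gsumS[u [m' [uG /IH m'k ->]]]; rewrite mdegD m'k Gd // mulSn.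
Qed.

End MonomialSums.

Section IdealPowers.
Variables (K : fieldType) (n : nat) (G : seq 'X_{1..n}).
Local Notation S := {mpoly K[n]}.
Local Notation I := (monomial_ideal K G).

(** Such a [U] is the exponent set of a monomial ideal, so the polynomials supported in it form an
    ideal; containing [X], it contains [f]. *)
Lemma ideal_gen_supp (U : 'X_{1..n} -> Prop) (X : set S) (f : S) :
  (forall m m', U m -> U (m + m')%MM) ->
  (forall g, X g -> {in msupp g, forall m, U m}) ->
  ideal_gen X f -> {in msupp f, forall m, U m}.
Proof.
move=> Uup XU [k [c [g [Xg ->]]]] m /msupp_sum_le.
move=> /flattenP[s /mapP[i _ ->]] /msuppM_le /allpairsP[[m1 m2] /= [_ m2g ->]].
by rewrite addmC; apply: Uup; apply: XU m2g.
Qed.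

Definition gmult k (m : 'X_{1..n}) : Prop := exists2 m', gsum G k m' & (m' <= m)%MM.

Lemma gmultD k m m' : gmult k m -> gmult k (m + m')%MM.
Proof. by move=> [v vG vm]; exists v => //; apply: lepm_trans vm (lem_addr _ _). Qed.

Lemma ideal_exp_monom k m : gsum G k m -> ideal_exp I k 'X_[m].
Proof.
elim: k m => [|k IH] m //= /gsumS[u [m' [uG m'G ->]]].
rewrite mpolyXD; apply: ideal_gen_sub; exists 'X_[u].
  by apply: ideal_gen_sub; exists u.
by exists 'X_[m'] => //; apply: IH.
Qed.

Lemma ideal_expP k (f : S) :
  ideal_exp I k f <-> {in msupp f, forall m, gmult k m}.
Proof.
split.
  elim: k f => [|k IH] f /=.
    by move=> _ m _; exists 0%MM; [exact: gsum0|apply/mnm_lepP => i; rewrite mnm0E].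
  apply: ideal_gen_supp; first exact: gmultD.
  move=> _ [x Ix [y /IH Iy <-]] m /msuppM_le /allpairsP[[m1 m2] /= [m1x m2y ->]].
  have [u uG um1] : exists2 u, u \in G & (u <= m1)%MM.
    move: m1 m1x; apply: ideal_gen_supp Ix.
      by move=> m1 m' [u uG um]; exists u => //; apply: lepm_trans um (lem_addr _ _).
    move=> _ [u /= uG <-] m1; rewrite msuppX inE => /eqP ->.
    by exists u => //; exact: lepm_refl.
  have [m' m'G m'm2] := Iy _ m2y.
  exists (u + m')%MM; first by rewrite -add1n; apply: gsumD => //; apply: gsum1.
  apply/mnm_lepP => i; rewrite !mnmDE; apply: leq_add; [exact: (mnm_lepP um1)|].
  exact: (mnm_lepP m'm2).
move=> fk; rewrite [f]mpolyE big_seq_cond; apply: ideal_exp_sum => m /andP[mf _].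
have [m' m'G m'm] := fk _ mf.
rewrite -mul_mpolyC -(submK m'm) mpolyXD mulrA; apply: ideal_expMl.
exact: ideal_exp_monom.
Qed.

End IdealPowers.

(** * The fiber cone as a subring of the polynomial ring *)

Section Embedding.
Variables (K : fieldType) (n : nat) (G : seq 'X_{1..n}) (d : nat).
Local Notation S := {mpoly K[n]}.
Local Notation I := (monomial_ideal K G).
Hypothesis d_gt0 : (0 < d)%N.
Hypothesis Gd : {in G, forall u, mdeg u = d}.

Lemma gmult_mdeg k m : gmult G k m -> (k * d <= mdeg m)%N.
Proof.
move=> [v /(gsum_mdeg Gd) <- /mnm_lepP vm]; rewrite !mdegE.
by apply: leq_sum => i _; exact: vm.
Qed.

Lemma mdeg_pos_split (m : 'X_{1..n}) : (0 < mdeg m)%N -> exists i m', m = (U_(i) + m')%MM.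
Proof.
rewrite lt0n mdeg_eq0 => m0.
have [i mi] : exists i, m i != 0%N.
  apply/existsP; apply: contraNT m0; rewrite negb_exists => /forallP m0.
  by apply/eqP/mnmP => i; rewrite mnm0E; apply/eqP; have := m0 i; rewrite negbK.
by exists i, (m - U_(i))%MM; rewrite addmC submK // lep1mP.
Qed.

(** The monomials of I^k have degree at least kd and those of m I^k have larger degree, so the
    component of degree kd determines the class in I^k / m I^k. As d > 0, different k give different
    degrees and the sum loses nothing. *)
Definition rees_lead (p : rees I) : S :=
  \sum_(k < size (val p)) pihomog mdeg (k * d) (val p)`_k.

Lemma mcoeff_rees_lead p m : (rees_lead p)@_m =
  if (d %| mdeg m)%N then ((val p)`_(mdeg m %/ d)%N)@_m else 0.
Proof.
rewrite raddf_sum /=.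
under eq_bigr => k _ do rewrite mcoeff_pihomog.
case: ifP => [/dvdnP[j mj]|dm]; last first.
  rewrite big1 // => k _; case: eqP => // mk.
  by rewrite mk dvdn_mull in dm.
rewrite mj mulnK //.
have [jp|pj] := ltnP j (size (val p)).
  rewrite (bigD1 (Ordinal jp)) //= eqxx big1 ?addr0 // => i ij.
  rewrite eqn_pmul2r //; case: eqP => // ji.
  by case/eqP: ij; apply: val_inj.
rewrite (nth_default _ pj) mcoeff0 big1 // => i _; rewrite eqn_pmul2r //.
by case: eqP => // ji; have := ltn_ord i; rewrite -ji ltnNge pj.
Qed.

Lemma rees_coef_gmult (p : rees I) k : {in msupp (val p)`_k, forall m, gmult G k m}.
Proof. by apply/ideal_expP; exact: (rees_predP _ _ (valP p)). Qed.

Lemma rees_leadB : {morph rees_lead : p q / p - q}.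
Proof.
move=> p q; apply/mpolyP => m; rewrite mcoeffB !mcoeff_rees_lead.
case: ifP => _; last by rewrite subr0.
by rewrite rmorphB coefB mcoeffB.
Qed.

Lemma rees_leadM : {morph rees_lead : p q / p * q}.
Proof.
move=> p q; apply/mpolyP => m; rewrite mcoeffM mcoeff_rees_lead.
have gt0 k (r : rees I) (m' : 'X_{1..n}) : (mdeg m' < k * d)%N -> ((val r)`_k)@_m' = 0.
  move=> m'k; apply: memN_msupp_eq0; apply/negP => /rees_coef_gmult /gmult_mdeg.
  by rewrite leqNgt m'k.
case: ifP => [/dvdnP[j mj]|dm]; last first.
  rewrite big1 // => -[m1 m2] /= /eqP m12; rewrite !mcoeff_rees_lead.
  case: ifP; rewrite ?mul0r // => d1; case: ifP; rewrite ?mulr0 // => d2.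
  by rewrite m12 mdegD dvdn_addr // d2 in dm.
have -> : (mdeg m %/ d)%N = j by rewrite mj mulnK.
rewrite rmorphM /= coefM raddf_sum /=.
under eq_bigr => i _ do rewrite mcoeffM.
rewrite exchange_big /=.
apply: eq_bigr => -[m1 m2] /= /eqP m12.
have mdeg12 : (mdeg m1 + mdeg m2 = j * d)%N by rewrite -mdegD -m12 mj.
(* The two degrees add up to [j * d]; unless they are [i * d] and [(j - i) * d], one of them is
   below the least degree of its power of I and that coefficient vanishes. *)
have eq0 (i : 'I_j.+1) : mdeg m1 != (i * d)%N ->
    ((val p)`_i)@_m1 * ((val q)`_(j - i))@_m2 = 0.
  rewrite neq_ltn => /orP[lt1|gt1]; first by rewrite gt0 // mul0r.
  rewrite [X in _ * X]gt0 ?mulr0 //; have := ltn_ord i; rewrite ltnS => ij.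
  by rewrite mulnBl; have : (i * d <= j * d)%N by [rewrite leq_pmul2r]; lia.
rewrite !mcoeff_rees_lead; case: ifP => [/dvdnP[i1 mi1]|d1]; last first.
  rewrite mul0r big1 // => i _; apply: eq0; apply: contraFneq d1 => ->.
  exact: dvdn_mull.
have i1j : (i1 < j.+1)%N by rewrite ltnS -(leq_pmul2r d_gt0) -mi1 -mdeg12 leq_addr.
have m2d : mdeg m2 = ((j - i1) * d)%N by rewrite mulnBl; lia.
rewrite m2d dvdn_mull // mi1 !mulnK //.
rewrite (bigD1 (Ordinal i1j)) //= big1 ?addr0 // => i ii1.
apply: eq0; rewrite mi1 eqn_pmul2r //.
by apply: contraNneq ii1 => e; apply/eqP/val_inj.
Qed.

Lemma rees_lead1 : rees_lead 1 = 1.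
Proof.
apply/mpolyP => m; rewrite mcoeff_rees_lead rmorph1 coef1 mcoeff1 -mdeg_eq0.
case: ifP => [/dvdnP[j mj]|dm]; last first.
  by case: eqP => // m0; rewrite m0 dvdn0 in dm.
rewrite {1}mj mulnK //; case: eqP => [j0|j0].
  by rewrite mcoeff1 -mdeg_eq0.
by rewrite mcoeff0 mj muln_eq0 (gtn_eqF d_gt0) orbF; case: eqP.
Qed.

(** If the component of degree kd vanishes, every monomial of the k-th coefficient properly exceeds
    a product of k generators, hence has a variable to spare and lies in m I^k. Conversely m I^k
    lives in degrees above kd. *)
Lemma rees_lead_eq0 p : rees_lead p = 0 <-> p \in fiber_rel I.
Proof.
split=> [p0|/asboolP pm].
  apply/asboolP => k; rewrite [(val p)`_k]mpolyE big_seq_cond.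
  apply: ideal_gen_sum => m /andP[mp _].
  rewrite -mul_mpolyC; apply: ideal_genMl.
  have [v vG vm] := rees_coef_gmult mp.
  have mk : mdeg m != (k * d)%N.
    apply: contraTneq mp => mk; rewrite -mcoeff_eq0; apply/eqP.
    have := mcoeff_rees_lead p m; rewrite p0 mcoeff0 mk dvdn_mull // mulnK //.
  have : (0 < mdeg (m - v)%MM)%N.
    rewrite lt0n; apply: contra mk => /eqP mv0.
    by rewrite -(submK vm) mdegD mv0 add0n (gsum_mdeg Gd vG).
  move=> /mdeg_pos_split[i [m' mv]]; apply: ideal_gen_sub; exists 'X_i.
    by apply: ideal_gen_sub; exists i.
  exists 'X_[m' + v]; last by rewrite -mpolyXD addmA -mv submK.
  rewrite mpolyXD; apply: ideal_expMl; exact: ideal_exp_monom.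
apply/mpolyP => m; rewrite mcoeff_rees_lead mcoeff0; case: ifP => // /dvdnP[k mk].
rewrite mk mulnK //; apply: memN_msupp_eq0; apply/negP => mp.
have : (k * d < mdeg m)%N; last by rewrite mk ltnn.
move: m {mk} mp; apply: ideal_gen_supp (pm k).
  by move=> m m' km; rewrite mdegD; exact: leq_trans km (leq_addr _ _).
move=> _ [x xm [y yI <-]] m /msuppM_le /allpairsP[[m1 m2] /= [m1x m2y ->]].
rewrite mdegD -add1n leq_add //; last first.
  by apply: gmult_mdeg; move: m2y; apply: (iffLR (ideal_expP _ _ _) yI).
move: m1 m1x; apply: ideal_gen_supp xm.
  by move=> m1 m' m0; rewrite mdegD (leq_trans m0) // leq_addr.
by move=> _ [i _ <-] m1; rewrite msuppX inE => /eqP ->; rewrite mdeg1.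
Qed.

Definition fiber_emb (x : fiber_cone I) : S := rees_lead (repr x)%qT.

Lemma fiber_embE p : fiber_emb (\pi_{ideal_quot fiber_rel I}%qT p) = rees_lead p.
Proof.
apply/eqP; rewrite -subr_eq0 -rees_leadB; apply/eqP/rees_lead_eq0.
have -> : forall x y : rees I, (x - y \in fiber_rel I)
    = (x == y %[mod {ideal_quot fiber_rel I}])%qT.
  by move=> x y; rewrite Quotient.idealrBE.
by apply/eqP; exact: reprK.
Qed.

Lemma fiber_piP (x : fiber_cone I) : exists p, x = \pi_{ideal_quot fiber_rel I}%qT p.
Proof. by exists (repr x); rewrite reprK. Qed.

Lemma fiber_emb_additive : additive fiber_emb.
Proof.
move=> x y; have [p ->] := fiber_piP x; have [q ->] := fiber_piP y.
by rewrite -rmorphB !fiber_embE rees_leadB.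
Qed.

Lemma fiber_emb_multiplicative : multiplicative fiber_emb.
Proof.
split; last by rewrite -(rmorph1 (\pi_{ideal_quot fiber_rel I}%qT)) fiber_embE rees_lead1.
move=> x y; have [p ->] := fiber_piP x; have [q ->] := fiber_piP y.
by rewrite -rmorphM !fiber_embE rees_leadM.
Qed.

Lemma fiber_emb_inj : injective fiber_emb.
Proof.
move=> x y exy; apply/eqP; rewrite -subr_eq0; apply/eqP.
have : fiber_emb (x - y) = 0 by rewrite fiber_emb_additive exy subrr.
have [p ->] := fiber_piP (x - y); rewrite fiber_embE => /rees_lead_eq0.
rewrite -[X in X \in _]subr0 Quotient.idealrBE => /eqP ->.
by rewrite rmorph0.
Qed.

Lemma fiber_embZ c x : fiber_emb (c *: x) = c *: fiber_emb x.
Proof.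
rewrite -mul_mpolyC.
have -> : c *: x = fiber_const I c * x by [].
rewrite (fiber_emb_multiplicative).1 fiber_embE; congr (_ * _).
apply/mpolyP => m; rewrite mcoeff_rees_lead mcoeffC /= coefC -mdeg_eq0.
case: ifP => [/dvdnP[j mj]|dm]; last first.
  by case: eqP => [m0|_]; [rewrite m0 dvdn0 in dm|rewrite mulr0].
rewrite {1}mj mulnK // mj muln_eq0 (gtn_eqF d_gt0) orbF.
case: eqP => j0; last by rewrite mcoeff0 mulr0.
by rewrite mcoeffC -mdeg_eq0 mj j0 mul0n.
Qed.

Lemma fiber_emb_deg1 u (Iu : I 'X_[u]) : u \in G -> fiber_emb (fiber_deg1 Iu) = 'X_[u].
Proof.
move=> uG; rewrite fiber_embE; apply/mpolyP => m.
rewrite mcoeff_rees_lead /= coefZ coefX mcoeffX.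
case: ifP => [/dvdnP[j mj]|dm]; last first.
  by case: eqP => // um; rewrite -um Gd // dvdnn in dm.
rewrite mj mulnK //; case: eqP => [j1|j1].
  by rewrite mulr1 mcoeffX.
rewrite mulr0 mcoeff0; case: eqP => // um.
by case: j1; apply/eqP; rewrite -(eqn_pmul2r d_gt0) mul1n -mj -um Gd.
Qed.

Fact rees_comp_subproof k (f : S) : {in msupp f, forall m, gsum G k m} ->
  (f *: 'X^k : {poly S}) \in rees_pred I.
Proof.
move=> fk; apply/rees_predP => j; rewrite coefZ coefXn.
case: eqP => [->|_]; last by rewrite mulr0; exact: ideal_exp0.
rewrite mulr1; apply/ideal_expP => m /fk mk; exists m => //; exact: lepm_refl.
Qed.

Lemma rees_lead_comp k (f : S) (fk : {in msupp f, forall m, gsum G k m}) :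
  rees_lead (Rees (rees_comp_subproof fk)) = f.
Proof.
apply/mpolyP => m; rewrite mcoeff_rees_lead /= coefZ coefXn.
have fdeg : m \in msupp f -> mdeg m = (k * d)%N by move=> /fk /(gsum_mdeg Gd).
case: ifP => [/dvdnP[j mj]|dm]; last first.
  rewrite memN_msupp_eq0 //; apply: contraFN dm => /fdeg ->; exact: dvdn_mull.
rewrite mj mulnK //; case: eqP => [j1|j1]; first by rewrite mulr1.
rewrite mulr0 mcoeff0 memN_msupp_eq0 //; apply/negP => /fdeg.
by rewrite mj => /eqP; rewrite eqn_pmul2r // => /eqP.
Qed.

Lemma fiber_compP k x : fiber_comp I k x <-> {in msupp (fiber_emb x), forall m, gsum G k m}.
Proof.
split.
  move=> [p pk ->]; rewrite fiber_embE => m; rewrite mcoeff_msupp mcoeff_rees_lead.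
  case: ifP => [/dvdnP[j mj]|]; last by rewrite eqxx.
  have -> : (mdeg m %/ d = j)%N by rewrite mj mulnK.
  have [jk|jk] := eqVneq j k; last first.
    by rewrite pk ?mcoeff0 ?eqxx.
  rewrite -mcoeff_msupp => /rees_coef_gmult[v vG vm].
  (* [v] divides [m] and both have degree [j * d]. *)
  suff -> : m = v by rewrite -jk.
  have := mdegD (m - v) v; rewrite submK // mj (gsum_mdeg Gd vG) => /eqP.
  rewrite -{1}[(j * d)%N]add0n eqn_add2r eq_sym mdeg_eq0 => /eqP mv.
  by rewrite -(submK vm) mv add0m.
move=> xk; exists (Rees (rees_comp_subproof xk)).
  by move=> j /negbTE jk; rewrite /= coefZ coefXn jk mulr0.
by apply: fiber_emb_inj; rewrite fiber_embE rees_lead_comp.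
Qed.

Lemma fiber_emb_supp x : {in msupp (fiber_emb x), forall m, exists k, gsum G k m}.
Proof.
have [p ->] := fiber_piP x; rewrite fiber_embE => m; rewrite mcoeff_msupp mcoeff_rees_lead.
case: ifP => [/dvdnP[j mj]|]; last by rewrite eqxx.
have -> : (mdeg m %/ d = j)%N by rewrite mj mulnK.
rewrite -mcoeff_msupp => /rees_coef_gmult[v vG vm].
exists j; suff -> : m = v by [].
have := mdegD (m - v) v; rewrite submK // mj (gsum_mdeg Gd vG) => /eqP.
rewrite -{1}[(j * d)%N]add0n eqn_add2r eq_sym mdeg_eq0 => /eqP mv.
by rewrite -(submK vm) mv add0m.
Qed.

Lemma fiber_emb_surj (f : S) : {in msupp f, forall m, exists k, gsum G k m} ->
  exists x, fiber_emb x = f.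
Proof.
move=> fC; rewrite [f]mpolyE big_seq.
apply: (big_ind (fun g : S => exists x, fiber_emb x = g)) => [|g h [x <-] [y <-]|m /fC[k mk]].
- by exists 0; rewrite -(subrr 0) fiber_emb_additive subrr.
- exists (x - (0 - y)); rewrite !fiber_emb_additive.
  have -> : fiber_emb 0 = 0 by rewrite -(subrr 0) fiber_emb_additive subrr.
  by rewrite sub0r opprK.
- have Xk : {in msupp ('X_[m] : S), forall m, gsum G k m}.
    by move=> m'; rewrite msuppX inE => /eqP ->.
  exists (f@_m *: (\pi_{ideal_quot fiber_rel I}%qT (Rees (rees_comp_subproof Xk)) : fiber_cone I)).
  by rewrite fiber_embZ fiber_embE rees_lead_comp.
Qed.

(** All later arguments see the fiber cone only through these properties of [Psi]. *)
Lemma fiber_cone_embedding : exists Psi : {rmorphism fiber_cone I -> S},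
  [/\ injective Psi,
      forall c x, Psi (c *: x) = c *: Psi x,
      forall u (Iu : I 'X_[u]), u \in G -> Psi (fiber_deg1 Iu) = 'X_[u],
      forall k x, fiber_comp I k x <-> {in msupp (Psi x), forall m, gsum G k m} &
      forall f : S, {in msupp f, forall m, exists k, gsum G k m} <-> exists x, Psi x = f].
Proof.
pose mA := GRing.isZmodMorphism.Build _ _ fiber_emb fiber_emb_additive.
pose mM := GRing.isMonoidMorphism.Build _ _ fiber_emb
  (fiber_emb_multiplicative.2, fiber_emb_multiplicative.1).
pose Psi : {rmorphism fiber_cone I -> S} := HB.pack fiber_emb mA mM.
exists Psi; split; [exact: fiber_emb_inj|exact: fiber_embZ|exact: fiber_emb_deg1| |].
- exact: fiber_compP.
- by move=> f; split=> [|[x <-]]; [exact: fiber_emb_surj|exact: fiber_emb_supp].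
Qed.

End Embedding.

(** * The semigroup of a Veronese type ideal *)

Section Box.
Variable n : nat.

Lemma box_slice (lo hi : 'I_n -> nat) m :
  (forall i, lo i <= hi i)%N -> (\sum_i lo i <= m <= \sum_i hi i)%N ->
  exists w : 'X_{1..n}, (forall i, lo i <= w i <= hi i)%N /\ mdeg w = m.
Proof.
move=> lohi /andP[lom mhi].
have [k mk] : exists k, m = (\sum_i lo i + k)%N by exists (m - \sum_i lo i)%N; rewrite subnKC.
subst m; elim: k mhi {lom} => [|k IH] mhi.
  exists [multinom lo i | i < n]; split=> [i|]; first by rewrite mnmE leqnn lohi.
  by rewrite mdegE addn0; apply: eq_bigr => i _; rewrite mnmE.
have [w [wb wm]] := IH (leq_trans (leq_add (leqnn _) (leqnSn _)) mhi).
have [i wi] : exists i, (w i < hi i)%N.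
  apply/existsP; apply: contraLR mhi; rewrite negb_exists => /forallP wh.
  rewrite -ltnNge addnS -wm mdegE ltnS; apply: leq_sum => i _.
  by rewrite leqNgt wh.
exists (U_(i) + w)%MM; split; last by rewrite mdegD mdeg1 wm addnS add1n.
by move=> j; rewrite mnmDE mnm1E; have := wb j; case: eqP => [<-|_] /=; lia.
Qed.

(** The monomial m x_i / x_j; subtraction is truncated, so this reading is correct only for
    [0 < m j]. *)
Definition mexch i j (m : 'X_{1..n}) : 'X_{1..n} := (U_(i) + (m - U_(j)))%MM.

Lemma mexchE i j (m : 'X_{1..n}) x : (0 < m j)%N ->
  (mexch i j m x + (j == x) = m x + (i == x))%N.
Proof.
move=> mj; rewrite mnmDE mnmBE !mnm1E; case: (eqVneq j x) mj => [->|_] /= mj; clear -mj; lia.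
Qed.

Lemma mdeg_mexch i j (m : 'X_{1..n}) : (0 < m j)%N -> mdeg (mexch i j m) = mdeg m.
Proof.
move=> mj; have := mdegD (m - U_(j)) U_(j); rewrite submK ?lep1mP -?lt0n // => ->.
by rewrite mdegD !mdeg1 addnC.
Qed.

Lemma mexch_i i j (m : 'X_{1..n}) : i != j -> mexch i j m i = (m i).+1.
Proof. by move=> ij; rewrite mnmDE mnmBE !mnm1E eqxx eq_sym (negbTE ij) subn0. Qed.

Lemma mexch_j i j (m : 'X_{1..n}) : i != j -> mexch i j m j = (m j).-1.
Proof. by move=> ij; rewrite mnmDE mnmBE !mnm1E eqxx (negbTE ij) add0n subn1. Qed.

Lemma mexch_neq i j (m : 'X_{1..n}) x : x != i -> x != j -> mexch i j m x = m x.
Proof.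
by move=> xi xj; rewrite mnmDE mnmBE !mnm1E eq_sym (negbTE xi) eq_sym (negbTE xj) subn0.
Qed.

End Box.

Section VeroneseCone.
Variables (n d : nat) (a : 'I_n -> nat).
Hypothesis d_gt0 : (0 < d)%N.

Definition vcone k (b : 'X_{1..n}) : bool :=
  (mdeg b == k * d)%N && [forall i, b i <= k * a i]%N.

Lemma vconeP k b : reflect (mdeg b = (k * d)%N /\ forall i, (b i <= k * a i)%N) (vcone k b).
Proof.
by apply: (iffP andP) => -[/eqP bk /forallP bi].
Qed.

Lemma mem_monomials k (u : 'X_{1..n}) : (u \in monomials n k) = (mdeg u == k).
Proof.
rewrite mem_filter andb_idr // => /eqP uk.
have uk1 : (mdeg u < k.+1)%N by rewrite uk.
by apply/codomP; exists (BMultinom uk1).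
Qed.

Lemma mem_veronese u : (u \in veronese_gens a d) = vcone 1 u.
Proof.
rewrite mem_filter mem_monomials /vcone mul1n andbC.
by congr (_ && _); apply: eq_forallb => i; rewrite mul1n.
Qed.

Lemma vcone0 b : vcone 0 b -> b = 0%MM.
Proof. by case/vconeP=> b0 _; apply/eqP; rewrite -mdeg_eq0 b0. Qed.

Lemma vconeD k k' b b' : vcone k b -> vcone k' b' -> vcone (k + k') (b + b')%MM.
Proof.
move=> /vconeP[bk bi] /vconeP[bk' bi']; apply/vconeP; rewrite mdegD bk bk' mulnDl.
by split=> // i; rewrite mnmDE mulnDl leq_add.
Qed.

Lemma vcone_inj k k' b : vcone k b -> vcone k' b -> k = k'.
Proof.
move=> /vconeP[bk _] /vconeP[bk' _]; apply/eqP.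
by rewrite -(eqn_pmul2r d_gt0) -bk bk'.
Qed.

Lemma vcone1_mexch i j m : vcone 1 m -> i != j -> (m i < a i)%N -> (0 < m j)%N ->
  vcone 1 (mexch i j m).
Proof.
move=> /vconeP[md ma] ij mi mj; apply/vconeP; rewrite mdeg_mexch //; split=> // x.
have := ma x; rewrite mul1n; have [->|xi] := eqVneq x i; first by rewrite mexch_i.
have [->|xj] := eqVneq x j; last by rewrite mexch_neq.
by rewrite mexch_j //; exact: leq_trans (leq_pred _).
Qed.

(* Round c / k.+1 up or down in each coordinate. *)
Lemma vcone_split k (c : 'X_{1..n}) : vcone k.+1 c ->
  (exists w, [/\ vcone 1 w, (w <= c)%MM & vcone k (c - w)%MM]) /\
    forall i j, i != j -> (0 < c i)%N -> (c j < k.+1 * a j)%N ->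
    exists w', [/\ vcone 1 w', (w' <= c)%MM, vcone k (c - w')%MM,
                  (0 < w' i)%N & (w' j < a j)%N].
Proof.
move=> /vconeP[ck ci].
pose lo i := (c i %/ k.+1)%N.
pose hi i := (lo i + (c i %% k.+1 != 0))%N.
have ceq i : c i = (k.+1 * lo i + c i %% k.+1)%N by rewrite {1}(divn_eq (c i) k.+1) mulnC.
have ltk i : (c i %% k.+1 < k.+1)%N by rewrite ltn_mod.
have hia i : (hi i <= a i)%N.
  rewrite /hi; have := ci i; rewrite {1}ceq; case: eqP => [_|r0] cle.
    by rewrite addn0 -(leq_pmul2l (ltn0Sn k)); lia.
  by rewrite addn1 ltnNge; apply/negP => al; have : (k.+1 * a i <= k.+1 * lo i)%N
    by [rewrite leq_pmul2l]; lia.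
have sumr : (k.+1 * \sum_i lo i + \sum_i (c i %% k.+1) = k.+1 * d)%N.
  by rewrite -ck mdegE big_distrr -big_split /=; apply: eq_bigr => i _; rewrite -ceq.
(* Any rounding of total degree d will do: rounding c_i / (k + 1) in either direction leaves c_i -
   w_i between 0 and k a_i. *)
have good (w : 'X_{1..n}) : (forall i, lo i <= w i <= hi i)%N -> mdeg w = d ->
    [/\ vcone 1 w, (w <= c)%MM & vcone k (c - w)%MM].
  move=> wb wd.
  have wc : (w <= c)%MM.
    apply/mnm_lepP => i; have := ceq i; have := wb i; rewrite /hi.
    by case: eqP => r0 /=; nia.
  split=> //.
    apply/vconeP; rewrite mul1n; split=> // i; rewrite mul1n.
    by case/andP: (wb i) => _ /leq_trans; apply.
  apply/vconeP; split.
    by have := mdegD (c - w) w; rewrite submK // ck wd mulSn; lia.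
  move=> i; rewrite mnmBE; have := wb i; have := hia i; have := ceq i; have := ltk i.
  rewrite /hi; case: eqP => r0; nia.
have sumlo : (\sum_i lo i <= d)%N by rewrite -(leq_pmul2l (ltn0Sn k)) -sumr leq_addr.
have sumhi : (d <= \sum_i hi i)%N.
  rewrite -(leq_pmul2l (ltn0Sn k)) -sumr /hi big_split /= mulnDr leq_add2l big_distrr /=.
  by apply: leq_sum => i _; have := ltk i; case: eqP => [->|_] //=; lia.
have lohi i : (lo i <= hi i)%N by exact: leq_addr.
split.
  have sums : (\sum_i lo i <= d <= \sum_i hi i)%N by rewrite sumlo.
  have [w [wb wd]] := box_slice lohi sums.
  by exists w; apply: good.
move=> i j ij ci0 cja.
have sumd x b : (\sum_y (y == x :> 'I_n) * b = b)%N.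
  by rewrite (bigD1 x) //= eqxx mul1n big1 ?addn0 // => y /negbTE ->.
(* To force w_i > 0 the lower bound is raised where it is 0; to force w_j < a_j the upper bound is
   lowered where it equals a_j. *)
pose lo' x := (lo x + (x == i) * (lo i == 0%N))%N.
pose hi' x := (hi x - (x == j) * (hi j == a j))%N.
have lo0 : lo i = 0%N -> (c i %% k.+1 != 0)%N.
  by move=> li; rewrite -lt0n; move: ci0; rewrite {1}ceq li muln0.
have hj : hi j = a j -> (c j %% k.+1 != 0)%N.
  move=> hja; apply: contraTN cja => /eqP r0.
  by rewrite -leqNgt ceq r0 addn0 -hja /hi r0 eqxx addn0.
have hi'E x : hi x = (hi' x + (x == j) * (hi j == a j))%N.
  rewrite /hi' subnK //; case: eqP => // ->; rewrite mul1n; case: eqP => // /hj r0.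
  by rewrite /hi r0 addn1.
have sumr0 x : (c x %% k.+1 <= \sum_i (c i %% k.+1))%N by rewrite (bigD1 x) //= leq_addr.
have lohi' x : (lo' x <= hi' x)%N.
  rewrite /lo' /hi'; have [xi|xi] := eqVneq x i.
    rewrite xi (negbTE ij) subn0 mul1n; case: eqP => [l0|_]; last by rewrite addn0.
    by rewrite /hi l0 lo0.
  rewrite addn0; have [xj|xj] := eqVneq x j; last by rewrite subn0.
  rewrite xj mul1n; case: eqP => [/hj r0|_]; last by rewrite subn0.
  by rewrite /hi r0 addn1 subn1.
(* Each correction costs one unit and occurs only where c has a nonzero remainder modulo k + 1. Such
   a remainder makes the inequality between d and the uncorrected sum strict. *)
have sums : (\sum_x lo' x <= d <= \sum_x hi' x)%N.
  rewrite big_split /= sumd; apply/andP; split.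
    case: eqP => [l0|_]; last by rewrite addn0.
    rewrite addn1 -(ltn_pmul2l (ltn0Sn k)) -sumr -addn1 leq_add2l.
    by apply: leq_trans (sumr0 i); rewrite lt0n lo0.
  have sh : (\sum_x hi x = \sum_x hi' x + (hi j == a j))%N.
    by rewrite -[X in (_ + X)%N](sumd j) -big_split /=; apply: eq_bigr => x _; exact: hi'E.
  move: sumhi; rewrite sh; case: eqP => [hja|_]; last by rewrite addn0.
  rewrite addn1 leq_eqVlt ltnS => /orP[/eqP dh|//].
  suff : (k.+1 * d < k.+1 * \sum_i hi i)%N by rewrite ltn_pmul2l // sh hja eqxx addn1 dh ltnn.
  rewrite -sumr /hi big_split /= mulnDr ltn_add2l big_distrr /=.
  rewrite [X in (X < _)%N](bigD1 j) //= [X in (_ < X)%N](bigD1 j) //= hj // muln1 -addSn.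
  apply: leq_add => //; apply: leq_sum => x _.
  by have := ltk x; case: eqP => [->|_] //=; lia.
have [w [wb wd]] := box_slice lohi' sums.
have wb' x : (lo x <= w x <= hi x)%N.
  case/andP: (wb x) => wl wh; rewrite (leq_trans _ wl) ?leq_addr //=.
  exact: leq_trans wh (leq_subr _ _).
have [w1 wc wk] := good w wb' wd; exists w; split=> //.
  have := wb i; rewrite /lo' eqxx mul1n; case: eqP => [->|]; lia.
have := wb j; have := hia j; rewrite /hi' eqxx mul1n; case: eqP => /=; last lia.
by move=> hja; have := hj hja; rewrite /hi; move: hja; rewrite /hi; lia.
Qed.

Lemma gsum_vcone k b : gsum (veronese_gens a d) k b <-> vcone k b.
Proof.
split.
  elim: k b => [|k IH] b.
    by move/gsum0P ->; apply/vconeP; rewrite mdeg0; split=> // i; rewrite mnm0E.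
  move=> /gsumS[u [m [uG /IH mk ->]]]; rewrite -add1n; apply: vconeD => //.
  by rewrite -mem_veronese.
elim: k b => [|k IH] b; first by move/vcone0 ->; exact: gsum0.
move=> /vcone_split[[w [w1 wb wk]] _]; rewrite -(submK wb) addmC -add1n.
by apply: gsumD; [apply: gsum1; rewrite mem_veronese|exact: IH].
Qed.

Lemma veronese_mdeg : {in veronese_gens a d, forall u, mdeg u = d}.
Proof. by move=> u; rewrite mem_veronese => /vconeP[->]; rewrite mul1n. Qed.

End VeroneseCone.

(** * The defining ideal *)

Lemma ord2P (i : 'I_2) : i = 0 \/ i = 1.
Proof. by case: i => -[|[|i]] ?; [left|right|]; try apply: val_inj. Qed.

Lemma det_mx22 (R : comNzRingType) (B : 'M[R]_2) :
  \det B = B 0 0 * B 1 1 - B 0 1 * B 1 0.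
Proof.
rewrite (expand_det_row _ 0) !big_ord_recl big_ord0 addr0 /cofactor !det_mx11 !mxE /=.
have -> : lift 0 (0 : 'I_1) = 1 :> 'I_2 by apply: val_inj.
have -> : lift 1 (0 : 'I_1) = 0 :> 'I_2 by apply: val_inj.
by rewrite expr0 expr1 mul1r mulN1r mulrN.
Qed.

Lemma mx22P (R : comNzRingType) (B : 'M[R]_2) :
  B = mx22 (B 0 0) (B 0 1) (B 1 0) (B 1 1).
Proof.
by apply/matrixP => i j; rewrite mxE; case: (ord2P i) => ->; case: (ord2P j) => ->.
Qed.

Section ToricIdeal.
Variables (K : fieldType) (n d : nat) (a : 'I_n -> nat).
Hypothesis d_gt0 : (0 < d)%N.
Let G := veronese_gens a d.
Let T := gen_matrix K G d.
Let t := tvar K G.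
Let q := size G.
Local Notation S := {mpoly K[n]}.
Local Notation St := {mpoly K[q]}.

Lemma tvar_index u (uG : u \in G) : exists2 i : 'I_q, t u = 'X_i & tnth (in_tuple G) i = u.
Proof.
have uq : (index u G < q)%N by rewrite index_mem.
exists (Ordinal uq); first by rewrite /t /tvar insubT.
by rewrite (tnth_nth u) /= nth_index.
Qed.

Lemma tvar_tnth (i : 'I_q) : t (tnth (in_tuple G) i) = 'X_i.
Proof.
have Guniq : uniq G.
  rewrite filter_uniq // filter_uniq // map_inj_uniq ?enum_uniq //.
  by move=> w w' ww'; apply: val_inj.
have [j -> ji] := tvar_index (mem_tnth i (in_tuple G)); congr 'X_[U_(_)].
apply/val_inj/eqP; rewrite -(nth_uniq 0%MM (ltn_ord j) (ltn_ord i) Guniq); apply/eqP.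
by move: ji; rewrite !(tnth_nth 0%MM).
Qed.

Lemma tvar_neq0 u : (t u != 0) = (u \in G).
Proof.
apply/idP/idP => [|/tvar_index[i -> _]]; last first.
  by rewrite -msupp_eq0 msuppX.
apply: contraNT => uG; rewrite /t /tvar insubN // -leqNgt.
by rewrite leqNgt index_mem.
Qed.

Lemma gen_matrix_entry (i : 'I_n) (w : 'X_{1..n}) : (U_(i) + w)%MM \in G ->
  exists j, tnth (in_tuple (gen_columns G d)) j = w.
Proof.
move=> iwG; have wc : w \in gen_columns G d.
  rewrite mem_filter mem_sort mem_monomials; apply/andP; split.
    by apply/existsP; exists i.
  have := veronese_mdeg iwG; rewrite mdegD mdeg1 => <-.
  by rewrite add1n.
have wq : (index w (gen_columns G d) < size (gen_columns G d))%N by rewrite index_mem.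
by exists (Ordinal wq); rewrite (tnth_nth w) /= nth_index.
Qed.

Local Notation Min := (ideal_gen (binomial_2minors T)).

(** Submatrices are taken with increasing rows and columns; every other order changes the
    determinant by a sign at most. *)
Lemma minor_mem (i j : 'I_n) k l : i != j -> k != l ->
  T i k != 0 -> T j l != 0 -> T i l != 0 -> T j k != 0 ->
  Min (T i k * T j l - T i l * T j k).
Proof.
have base (i1 j1 : 'I_n) (k1 l1 : 'I_(size (gen_columns G d))) : (i1 < j1)%N -> (k1 < l1)%N ->
    T i1 k1 != 0 -> T j1 l1 != 0 -> T i1 l1 != 0 -> T j1 k1 != 0 ->
    Min (T i1 k1 * T j1 l1 - T i1 l1 * T j1 k1).
  move=> ij kl n1 n2 n3 n4; apply: ideal_gen_sub.
  pose f (x : 'I_2) := if x == 0 then i1 else j1.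
  pose g (x : 'I_2) := if x == 0 then k1 else l1.
  exists (mxsub f g T); last by rewrite det_mx22 !mxE.
  split; last by move=> x y; rewrite mxE /f /g; do 2 case: ifP.
  exists f, g; split=> // x y; rewrite /f /g; case: (ord2P x) => ->; case: (ord2P y) => -> //=.
rewrite !neq_ltn => /orP[ij|ji] /orP[kl|lk] n1 n2 n3 n4.
- exact: base.
- by rewrite -opprB; apply: ideal_genN; apply: base.
- by rewrite -opprB; apply: ideal_genN; rewrite mulrC [X in _ - X]mulrC; apply: base.
- by rewrite mulrC [X in _ - X]mulrC; apply: base.
Qed.

Definition cmod (f g : St) : Prop := Min (f - g).

Lemma cmod_refl f : cmod f f.
Proof. by rewrite /cmod subrr; exact: ideal_gen0. Qed.

Lemma cmod_trans g f h : cmod f g -> cmod g h -> cmod f h.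
Proof. by move=> fg gh; rewrite /cmod -(subrKA g); exact: ideal_genD. Qed.

Lemma cmodMl f g h : cmod f g -> cmod (h * f) (h * g).
Proof. by rewrite /cmod -mulrBr; exact: ideal_genMl. Qed.

(** The minor has rows i, j and the columns labelled u / x_i and v / x_j: its entries are u, v' in
    row i and u', v in row j. If the two columns coincide, the exchange merely swaps u and v. *)
Lemma exchange_cmod (u v : 'X_{1..n}) i j : u \in G -> v \in G -> i != j ->
  (0 < u i)%N -> (u j < a j)%N -> (0 < v j)%N -> (v i < a i)%N ->
  let u' := mexch j i u in let v' := mexch i j v in
  [/\ u' \in G, v' \in G, (u + v = u' + v')%MM & cmod (t u * t v) (t u' * t v')].
Proof.
move=> uG vG ij ui uj vj vi u' v'; have ji : j != i by rewrite eq_sym.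
have u'G : u' \in G by rewrite mem_veronese vcone1_mexch // -mem_veronese.
have v'G : v' \in G by rewrite mem_veronese vcone1_mexch // -mem_veronese.
have uE : u = (U_(i) + (u - U_(i)))%MM by rewrite addmC submK // lep1mP -lt0n.
have vE : v = (U_(j) + (v - U_(j)))%MM by rewrite addmC submK // lep1mP -lt0n.
split=> //.
  apply/mnmP => x; rewrite (mnmDE x u v) (mnmDE x u' v') /u' /v'.
  have := mexchE j x ui; have := mexchE i x vj; clear.
  by case: (i == x); case: (j == x) => /=; lia.
have [ww|ww] := eqVneq (u - U_(i))%MM (v - U_(j))%MM.
  have -> : u' = v by rewrite /u' /mexch ww -vE.
  have -> : v' = u by rewrite /v' /mexch -ww -uE.
  by rewrite mulrC; exact: cmod_refl.
have uG' := uG; have vG' := vG; rewrite uE in uG'; rewrite vE in vG'.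
have [k kw] := gen_matrix_entry uG'; have [l lw] := gen_matrix_entry vG'.
have kl : k != l by apply: contraNneq ww => kl; rewrite -kw -lw kl.
have tn0 w : w \in G -> t w != 0 by rewrite tvar_neq0.
have TE x y w : tnth (in_tuple (gen_columns G d)) y = w -> T x y = t (U_(x) + w)%MM.
  by move=> yw; rewrite mxE yw.
have := minor_mem ij kl; rewrite !(TE _ _ _ kw) !(TE _ _ _ lw) -uE -vE.
rewrite -/(mexch j i u) -/(mexch i j v) -/u' -/v' => /(_ (tn0 _ uG) (tn0 _ vG)).
by move=> /(_ (tn0 _ v'G) (tn0 _ u'G)); rewrite /cmod (mulrC (t v')).
Qed.

Definition tprod (s : seq 'X_{1..n}) : St := \prod_(u <- s) t u.

(** Induction on the number of factors, then on the distance from the first factor u of [s1] to the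
    first factor w of [s2]. If u_i > w_i and u_j < w_j, comparing the products shows that the
    remaining factors of [s1] have a product c with c_j > 0 and c_i < k a_i, so that c has a factor
    v with v_j > 0 and v_i < a_i. By induction on the length v may be moved to the front, and
    exchanging x_i and x_j between u and v brings u closer to w. *)
Lemma tprod_cmod s1 s2 : size s1 = size s2 -> {subset s1 <= G} -> {subset s2 <= G} ->
  (\sum_(u <- s1) u = \sum_(u <- s2) u)%MM -> cmod (tprod s1) (tprod s2).
Proof.
move: {2}(size s1) (erefl (size s1)) => k.
elim: k s1 s2 => [|k IH] s1 s2 sk s12.
  by move: s12; rewrite sk => /esym /size0nil -> _ _ _; rewrite (size0nil sk); exact: cmod_refl.
case: s2 s12 => [|w s2]; rewrite sk // => -[s2k].
case: s1 sk => // u s1 [s1k] s1G s2G.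
have wG : w \in G by apply: s2G; rewrite mem_head.
have {}s2G : {subset s2 <= G} by move=> x xs; apply: s2G; rewrite inE xs orbT.
have uG : u \in G by apply: s1G; rewrite mem_head.
have {}s1G : {subset s1 <= G} by move=> x xs; apply: s1G; rewrite inE xs orbT.
rewrite !big_cons /tprod !big_cons -/(tprod _) -/(tprod _).
move: {2}(mdeg (u - w)) (leqnn (mdeg (u - w))) => e.
elim: e u uG s1 s1k s1G => [|e IHe] u uG s1 s1k s1G ue sums.
  have uw : u = w.
    move: ue; rewrite leqn0 mdeg_eq0 => /eqP uw.
    have le_uw : (u <= w)%MM.
      apply/mnm_lepP => i; have := congr1 (fun m : 'X_{1..n} => m i) uw.
      by rewrite mnmBE mnm0E => /eqP.
    have : mdeg (w - u) == 0%N.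
      have := mdegD (w - u) u; rewrite submK // (veronese_mdeg uG) (veronese_mdeg wG).
      by move/eqP; rewrite -{1}[d]add0n eqn_add2r eq_sym.
    by rewrite mdeg_eq0 => /eqP wu; rewrite -(submK le_uw) wu add0m.
  rewrite uw; apply: cmodMl; apply: IH => //; first by rewrite s1k.
  by move: sums; rewrite uw; exact: addmI.
have [ue0|une] := leqP (mdeg (u - w)) e; first exact: IHe ue0 sums.
have [i ui] : exists i, (w i < u i)%N.
  apply/existsP; apply: contraTT une; rewrite negb_exists -leqNgt => /forallP uw.
  rewrite mdegE big1 // => i _; apply/eqP; rewrite mnmBE subn_eq0 leqNgt; exact: uw.
have [j uj] : exists j, (u j < w j)%N.
  apply/existsP; rewrite -[X in is_true X]negbK negb_exists; apply/negP => /forallP wu.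
  have : (mdeg w < mdeg u)%N; last by rewrite (veronese_mdeg uG) (veronese_mdeg wG) ltnn.
  rewrite !mdegE (bigD1 i) //= [X in (_ < X)%N](bigD1 i) //= -addSn leq_add // leq_sum // => x _.
  by rewrite leqNgt wu.
have ij : j != i by apply: contraTneq ui => <-; rewrite -leqNgt ltnW.
set c := (\sum_(u <- s1) u)%MM in sums.
have cG : vcone d a k c by apply/(gsum_vcone a d_gt0); exists s1.
have c2G : vcone d a k (\sum_(u <- s2) u)%MM by apply/(gsum_vcone a d_gt0); exists s2.
have cx x : (u x + c x = w x + (\sum_(u <- s2) u)%MM x)%N by rewrite -!mnmDE sums.
have cj : (0 < c j)%N by have := cx j; lia.
have ci : (c i < k * a i)%N by have := cx i; case/vconeP: c2G => _ /(_ i); lia.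
have [k' kE] : exists k', k = k'.+1 by case: k ci {IH IHe s1k s2k cG c2G} => // k' _; exists k'.
rewrite kE in cG ci.
have [_ /(_ j i ij cj ci)[v [v1 vc vk vj vi]]] := vcone_split d_gt0 cG.
have [s [sk sG sE]] := iffRL (gsum_vcone a d_gt0 _ _) vk.
have vG : v \in G by rewrite mem_veronese.
have uiG : (w i <= a i)%N /\ (w j <= a j)%N.
  by move: wG; rewrite mem_veronese => /vconeP[_ wa]; have := wa i; have := wa j; rewrite !mul1n.
have ui0 : (0 < u i)%N by exact: leq_ltn_trans ui.
have uja : (u j < a j)%N by exact: leq_trans uj uiG.2.
have ij' : i != j by rewrite eq_sym.
have [u'G v'G uv' uvc] := exchange_cmod uG vG ij' ui0 uja vj vi.
set u' := mexch j i u in u'G uv' uvc.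
set v' := mexch i j v in v'G uv' uvc.
have svk : size (v :: s) = k by rewrite /= sk kE.
have svG : {subset v :: s <= G} by move=> x; rewrite inE => /orP[/eqP ->|/sG].
have sv'G : {subset v' :: s <= G} by move=> x; rewrite inE => /orP[/eqP ->|/sG].
apply: (@cmod_trans (t u * tprod (v :: s))).
  apply: cmodMl; apply: IH => //; first by rewrite s1k.
  by rewrite big_cons -sE addmC submK.
apply: (@cmod_trans (t u' * tprod (v' :: s))).
  rewrite /tprod !big_cons; set P := \prod_(_ <- _) _.
  have PE (x y : St) : x * (y * P) = P * (x * y) by rewrite mulrA mulrC.
  by rewrite !PE; exact: cmodMl.
apply: IHe => //.
  rewrite -ltnS; apply: leq_trans ue.
  rewrite !mdegE (bigD1 i) //= [X in (_ < X)%N](bigD1 i) //= -addSn leq_add //.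
    by rewrite !mnmBE /u' mexch_j //; move: ui; clear; lia.
  apply: leq_sum => x xi; rewrite !mnmBE; have [->|xj] := eqVneq x j.
    by rewrite /u' mexch_i //; move: uj; clear; lia.
  by rewrite /u' mexch_neq.
rewrite big_cons addmA -uv' -addmA -sums; congr (u + _)%MM.
by rewrite -sE addmC submK.
Qed.

Definition tgen (i : 'I_q) : 'X_{1..n} := tnth (in_tuple G) i.

Definition texp (al : 'X_{1..q}) : 'X_{1..n} := (\sum_i tgen i *+ al i)%MM.

Definition tmap : {rmorphism St -> S} :=
  mmap (@mpolyC n K) (fun i => 'X_[tgen i] : S).

Lemma tmapX al : tmap 'X_[al] = 'X_[texp al].
Proof.
rewrite /tmap /= mmapX /mmap1 /texp -mprodXE.
by apply: eq_bigr => i _; rewrite mpolyXn.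
Qed.

Lemma tmapE f : tmap f = \sum_(al <- msupp f) f@_al *: 'X_[texp al].
Proof.
rewrite {1}[f]mpolyE rmorph_sum /=; apply: eq_bigr => al _.
by rewrite -mul_mpolyC rmorphM /= -/tmap tmapX /tmap /= mmapC mul_mpolyC.
Qed.

Lemma tmap_tvar u : u \in G -> tmap (t u) = 'X_[u].
Proof.
move=> uG; have [i -> iu] := tvar_index uG.
by rewrite tmapX /texp -iu (bigD1 i) //= mnm1E eqxx mulm1n big1 ?addm0 // => j /negbTE ji;
  rewrite mnm1E eq_sym ji mulm0n.
Qed.

Lemma monom_tprod al : exists s, [/\ {subset s <= G}, 'X_[al] = tprod s &
  texp al = (\sum_(u <- s) u)%MM].
Proof.
exists (flatten [seq nseq (al i) (tgen i) | i <- enum 'I_q]); split.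
- by move=> x /flattenP[_ /mapP[i _ ->]]; rewrite mem_nseq => /andP[_ /eqP ->]; exact: mem_tnth.
- rewrite /tprod big_flatten big_map big_enum /= mpolyXE_id; apply: eq_bigr => i _.
  by rewrite big_nseq tvar_tnth -Monoid.iteropE.
- rewrite big_flatten big_map big_enum /=; apply: eq_bigr => i _.
  rewrite big_nseq; elim: (al i) => [|k IH] /=; first by rewrite mulm0n.
  by rewrite mulmS IH.
Qed.

Lemma gsum_size s : {subset s <= G} -> (size s * d = mdeg (\sum_(u <- s) u)%MM)%N.
Proof. by move=> sG; rewrite (gsum_mdeg (@veronese_mdeg n d a) (k := size s)) //; exists s. Qed.

Lemma texp_cmod al be : texp al = texp be -> cmod 'X_[al] 'X_[be].
Proof.
have [s [sG -> ->]] := monom_tprod al; have [s' [sG' -> ->]] := monom_tprod be => ss.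
apply: tprod_cmod => //; apply/eqP; rewrite -(eqn_pmul2r d_gt0).
by rewrite !gsum_size // ss.
Qed.

Lemma cmod_sum (I : eqType) (r : seq I) (c : I -> K) (f g : I -> St) :
  (forall i, i \in r -> cmod (f i) (g i)) ->
  cmod (\sum_(i <- r) c i *: f i) (\sum_(i <- r) c i *: g i).
Proof.
move=> fg; rewrite /cmod -sumrB big_seq; apply: ideal_gen_sum => i /fg.
by rewrite -scalerBr -mul_mpolyC; exact: ideal_genMl.
Qed.

(** Modulo the minors each monomial may be replaced by a fixed representative [N] of its fiber under
    [texp]. After regrouping by fibers the coefficients are those of [tmap f], hence 0. *)
Lemma ker_tmap_minors f : tmap f = 0 -> Min f.
Proof.
move=> f0; have [N NE] : exists N : 'X_{1..n} -> 'X_{1..q}, forall al, texp (N (texp al)) = texp al.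
  exists (fun m => if pselect (exists al, texp al = m) is left e then xget 0%MM [set al | texp al = m]
                   else 0%MM).
  move=> al; case: pselect => [e|[]]; last by exists al.
  by case: xgetP => [be _ //|H]; case: (H al).
suff : cmod f 0 by rewrite /cmod subr0.
rewrite {1}[f]mpolyE; apply: (@cmod_trans (\sum_(al <- msupp f) f@_al *: 'X_[N (texp al)])).
  by apply: cmod_sum => al _; apply: texp_cmod; rewrite NE.
pose r := undup [seq texp al | al <- msupp f].
have -> : \sum_(al <- msupp f) f@_al *: 'X_[N (texp al)] =
    \sum_(m <- r) (tmap f)@_m *: 'X_[N m] :> St.
  transitivity (\sum_(al <- msupp f) \sum_(m <- r) (f@_al * (texp al == m)%:R) *: ('X_[N m] : St)).
    rewrite big_seq [RHS]big_seq; apply: eq_bigr => al alf.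
    rewrite (bigD1_seq (texp al)) ?undup_uniq //=; last first.
      by rewrite mem_undup map_f.
    rewrite eqxx mulr1 big1 ?addr0 // => m /negbTE ml.
    by rewrite eq_sym ml mulr0 scale0r.
  rewrite exchange_big /=; apply: eq_bigr => m _.
  rewrite -scaler_suml tmapE raddf_sum /=; congr (_ *: _); apply: eq_bigr => al _.
  by rewrite mcoeffZ mcoeffX.
by rewrite f0 big1 => [|m _]; [exact: cmod_refl|rewrite mcoeff0 scale0r].
Qed.

Lemma minors_ker_tmap f : binomial_2minors T f -> tmap f = 0.
Proof.
move=> [B [[g [h [_ _ ->]]] Bn0] <-].
have gh x y : (U_(g x) + tnth (in_tuple (gen_columns G d)) (h y))%MM \in G.
  by rewrite -tvar_neq0; have := Bn0 x y; rewrite !mxE.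
have eT x y : tmap (mxsub g h T x y) =
    'X_[(U_(g x) + tnth (in_tuple (gen_columns G d)) (h y))%MM].
  by rewrite !mxE tmap_tvar.
rewrite det_mx22 rmorphB 2!rmorphM !eT -!mpolyXD; apply/eqP; rewrite subr_eq0.
by apply/eqP; congr 'X_[_]; apply/mnmP => i; rewrite !mnmDE; lia.
Qed.

Lemma ideal_gen_ker (R R' : comNzRingType) (phi : {rmorphism R -> R'}) (X : set R) f :
  (forall g, X g -> phi g = 0) -> ideal_gen X f -> phi f = 0.
Proof.
move=> X0 [m [c [g [Xg ->]]]]; rewrite rmorph_sum big1 //= => i _.
by rewrite rmorphM /= (X0 _ (Xg i)) mulr0.
Qed.

Lemma defining_ideal_tmap : defining_ideal K G = [set f | tmap f = 0].
Proof.
have [Psi [Pinj PZ Pdeg1 _ _]] := fiber_cone_embedding K d_gt0 (@veronese_mdeg n d a).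
rewrite -/G in Psi Pinj PZ Pdeg1.
have PE f : Psi (mmap (in_alg (fiber_cone (monomial_ideal K G)))
    (fun i => fiber_deg1 (monomial_ideal_gen K i)) f) = tmap f.
  rewrite /tmap /= /mmap rmorph_sum /=; apply: eq_bigr => al _.
  rewrite rmorphM /= PZ rmorph1 alg_mpolyC; congr (_ * _).
  rewrite /mmap1 rmorph_prod /=; apply: eq_bigr => i _.
  by rewrite rmorphXn /= Pdeg1 // mem_tnth.
apply/seteqP; split=> f /=; first by move=> f0; rewrite -PE f0 rmorph0.
by rewrite -PE -(rmorph0 Psi) => /Pinj.
Qed.

Lemma veronese_defining_ideal :
  defining_ideal K G = ideal_gen (binomial_2minors T) /\
  defining_ideal K G = ideal_gen [set f | exists u v u' v',
            [/\ u \in G /\ v \in G, u' \in G /\ v' \in G,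
                is_submatrix2 (mx22 (t u) (t u') (t v') (t v)) T &
                f = t u * t v - t u' * t v']].
Proof.
have JM : defining_ideal K G = Min.
  rewrite defining_ideal_tmap; apply/seteqP; split=> f /=; first exact: ker_tmap_minors.
  by apply: ideal_gen_ker; exact: minors_ker_tmap.
split=> //; rewrite JM; congr ideal_gen; apply/seteqP; split=> f /=.
  move=> [B [Bsub Bn0] <-]; have [g [h [_ _ BE]]] := Bsub.
  pose e x y := (U_(g x) + tnth (in_tuple (gen_columns G d)) (h y))%MM.
  have BtE x y : B x y = t (e x y) by rewrite BE !mxE.
  have eG x y : e x y \in G by rewrite -tvar_neq0 -/t -BtE.
  exists (e 0 0), (e 1 1), (e 0 1), (e 1 0); split=> //; last by rewrite det_mx22 !BtE.
  by rewrite -!BtE -mx22P.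
move=> [u [v [u' [v' [[uG vG] [u'G v'G] Bsub ->]]]]].
exists (mx22 (t u) (t u') (t v') (t v)); last by rewrite det_mx22 !mxE /=.
split=> // i j; rewrite mxE.
by case: (ord2P i) => ->; case: (ord2P j) => -> /=; rewrite tvar_neq0.
Qed.

End ToricIdeal.

(** * Koszul filtrations *)

Section LSpan.
Variables (A : comNzRingType) (V : lmodType A).
Implicit Types (s : seq V) (v : V).

(** Coefficients are indexed by [nat] so that one family serves lists of any length; those beyond
    the size are ignored. *)
Definition lspan s v : Prop := exists c : nat -> A, v = \sum_(i < size s) c i *: s`_i.

Lemma lspan_nil v : lspan [::] v <-> v = 0.
Proof. by split=> [[c ->]|->]; [|exists (fun=> 0)]; rewrite big_ord0. Qed.

Lemma lspan0 s : lspan s 0.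
Proof. by exists (fun=> 0); rewrite big1 // => i _; rewrite scale0r. Qed.

Lemma lspanD s v w : lspan s v -> lspan s w -> lspan s (v + w).
Proof.
move=> [c ->] [c' ->]; exists (fun i => c i + c' i); rewrite -big_split /=.
by apply: eq_bigr => i _; rewrite scalerDl.
Qed.

Lemma lspanZ s x v : lspan s v -> lspan s (x *: v).
Proof.
move=> [c ->]; exists (fun i => x * c i); rewrite scaler_sumr.
by apply: eq_bigr => i _; rewrite scalerA.
Qed.

Lemma lspanN s v : lspan s v -> lspan s (- v).
Proof. by rewrite -scaleN1r; exact: lspanZ. Qed.

Lemma lspan_sum s (I : Type) (r : seq I) (P : pred I) (F : I -> V) :
  (forall i, P i -> lspan s (F i)) -> lspan s (\sum_(i <- r | P i) F i).
Proof. by move=> sF; apply: big_ind => //; [exact: lspan0|exact: lspanD]. Qed.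

Lemma lspan_nth s i : (i < size s)%N -> lspan s s`_i.
Proof.
move=> si; exists (fun j => (j == i)%:R); rewrite (bigD1 (Ordinal si)) //= eqxx scale1r.
rewrite big1 ?addr0 // => j ji; rewrite (_ : (j == i :> nat) = false) ?scale0r //.
by apply: contraNF ji => /eqP ji; apply/eqP/val_inj.
Qed.

Lemma lspan_cat s s' v :
  lspan (s ++ s') v <-> exists v1 v2, [/\ lspan s v1, lspan s' v2 & v = v1 + v2].
Proof.
split=> [[c ->]|[_ [_ [[c ->] [c' ->] ->]]]].
  exists (\sum_(i < size s) c i *: s`_i), (\sum_(i < size s') c (size s + i)%N *: s'`_i).
  split; [by exists c|by exists (fun i => c (size s + i)%N)|].
  rewrite size_cat big_split_ord /=; congr (_ + _); apply: eq_bigr => i _.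
    by rewrite nth_cat ltn_ord.
  by rewrite nth_cat ltnNge leq_addr /= addKn.
exists (fun i => if (i < size s)%N then c i else c' (i - size s)%N).
rewrite size_cat big_split_ord /=; congr (_ + _); apply: eq_bigr => i _.
  by rewrite nth_cat ltn_ord.
by rewrite nth_cat ltnNge leq_addr /= addKn.
Qed.

Lemma lspan_mem s v : v \in s -> lspan s v.
Proof. by move=> vs; rewrite -(nth_index 0 vs); apply: lspan_nth; rewrite index_mem. Qed.

Lemma lspan_ind s (P : V -> Prop) : P 0 -> (forall v w, P v -> P w -> P (v + w)) ->
  (forall c v, v \in s -> P (c *: v)) -> forall v, lspan s v -> P v.
Proof.
move=> P0 PD Ps v [c ->]; apply: big_ind => // i _; apply: Ps; exact: mem_nth.
Qed.

End LSpan.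

Section KoszulFiltration.
Variables (K : fieldType) (A : comAlgType K) (A_ : nat -> set A).
(** [p1] and [p2] stand for the projections to the components of degree 1 and 2. *)
Variables (p1 p2 : A -> A).
Hypothesis A1_p1 : forall x, A_ 1%N (p1 x).
Hypothesis A1_0 : A_ 1%N 0.
Hypothesis A1_N : forall x, A_ 1%N x -> A_ 1%N (- x).
Hypothesis p2D : forall x y, p2 (x + y) = p2 x + p2 y.
Hypothesis p2_0 : p2 0 = 0.
Hypothesis p2_id : forall x y, A_ 1%N x -> A_ 1%N y -> p2 (x * y) = x * y.
Hypothesis p2M : forall x y, A_ 1%N y -> p2 (x * y) = p1 x * y.

(* A list of linear forms stands for the chain of ideals generated by its
   prefixes; fam is closed under the colon ideals of consecutive members. *)
Variable fam : seq A -> Prop.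
Definition colon_in (V : lmodType A) (s : seq V) : Prop :=
  forall k, (k < size s)%N -> exists2 W, fam W &
    forall x, lspan (take k s) (x *: s`_k) <-> lspan (W : seq A^o) x.
Hypothesis fam_lin : forall U, fam U -> {in U, forall u, A_ 1%N u}.
Hypothesis fam_colon : forall U, fam U -> colon_in (U : seq A^o).

Definition linear_list m (R : seq 'rV[A]_m) : Prop :=
  forall v, v \in R -> forall j, A_ 1%N (v 0 j).

Definition syz m (R : seq 'rV[A]_m) (v : 'rV[A]_(size R)) : Prop :=
  \sum_(i < size R) v 0 i *: R`_i = 0.

(* The leading coefficients of a submodule M of A^m, for the order of the
   coordinates, form ideals of the family, and linear ones lift linearly. *)
Definition good m (M : 'rV[A]_m -> Prop) : Prop :=
  (forall v w x, M v -> M w -> M (v + x *: w)) /\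
  forall l : 'I_m, exists2 U, fam U &
    (forall v, M v -> (forall j : 'I_m, (l < j)%N -> v 0 j = 0) -> lspan (U : seq A^o) (v 0 l)) /\
    (forall u, u \in U -> exists v, [/\ M v, v 0 l = u, (forall j : 'I_m, (l < j)%N -> v 0 j = 0) &
                                      forall j, A_ 1%N (v 0 j)]).

(** Generators are built by increasing leading position [l], appending lifts of the generators [U]
    of the ideal of leading coefficients. The earlier list [R] generates everything in [M] that
    vanishes from position [l] on, so a multiple of a lift lies in the span of its predecessors
    exactly when its leading coefficient lies in the ideal of the preceding members of [U]: the new
    colon ideals are those of [U]. *)
Lemma good_gens m (M : 'rV[A]_m -> Prop) : M 0 -> good M -> exists R : seq 'rV[A]_m,
  [/\ linear_list R, forall v, M v <-> lspan R v & colon_in R].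
Proof.
move=> M0 [MD Ml].
have MDs (s : seq 'rV_m) : {in s, forall w, M w} -> forall v, lspan s v -> M v.
  move=> sM v; apply: (lspan_ind (P := M)) => // [x y Mx My|c x xs].
    by rewrite -[y]scale1r; apply: MD.
  by rewrite -[_ *: _]add0r; apply: MD => //; apply: sM.
suff H l : (l <= m)%N -> exists R : seq 'rV[A]_m,
  [/\ linear_list R, {in R, forall w, M w /\ forall j : 'I_m, (l <= j)%N -> w 0 j = 0},
     (forall v, M v -> (forall j : 'I_m, (l <= j)%N -> v 0 j = 0) -> lspan R v) & colon_in R].
  have [R [Rlin RM Rgen Rcol]] := H m (leqnn m); exists R; split=> // v; split.
    by move=> Mv; apply: Rgen => // j; rewrite leqNgt ltn_ord.
  by apply: MDs => w /RM[].
elim: l => [|l IH] lm.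
  exists [::]; split=> // v _ v0; apply/lspan_nil/rowP => j; rewrite mxE; exact: v0.
have [R [Rlin RM Rgen Rcol]] := IH (ltnW lm).
pose lo := Ordinal lm; have [U Ufam [Ulead Ulift]] := Ml lo.
have [g gP] : exists g : A -> 'rV[A]_m, forall u, u \in U ->
    [/\ M (g u), g u 0 lo = u, (forall j : 'I_m, (lo < j)%N -> g u 0 j = 0) & forall j, A_ 1%N (g u 0 j)].
  have : forall u, exists v, u \in U ->
    [/\ M v, v 0 lo = u, (forall j : 'I_m, (lo < j)%N -> v 0 j = 0) & forall j, A_ 1%N (v 0 j)].
    by move=> u; have [/Ulift[v vP]|uU] := boolP (u \in U); [exists v|exists 0].
  by move=> /choice[g gP]; exists g => u; exact: gP.
pose gU := [seq g u | u <- U].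
have gcoord (s : seq A) v : {subset s <= U} -> lspan [seq g u | u <- s] v ->
    lspan (s : seq A^o) (v 0 lo).
  move=> sU [c ->]; exists c; rewrite size_map summxE; apply: eq_bigr => i _.
  rewrite mxE (nth_map 0) //; have [_ -> _ _] := gP _ (sU _ (mem_nth 0 (ltn_ord i))).
  by [].
have Rlo : forall v, lspan R v -> v 0 lo = 0.
  apply: (@lspan_ind A 'rV[A]_m R (fun v => v 0 lo = 0)) => [|x y|c x xR]; rewrite ?mxE //.
    by move=> -> ->; rewrite addr0.
  by have [_ ->] := RM _ xR; rewrite ?mulr0 /=.
(* Combinations of U lift to combinations of g, up to lower coordinates. *)
have lift (s : seq A) v : {subset s <= U} -> M v -> (forall j : 'I_m, (l < j)%N -> v 0 j = 0) ->
    lspan (s : seq A^o) (v 0 lo) -> lspan (R ++ [seq g u | u <- s]) v.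
  move=> sU Mv v0 [c vc].
  pose w := \sum_(i < size s) c i *: g s`_i.
  have ws : lspan [seq g u | u <- s] w.
    exists c; rewrite size_map; apply: eq_bigr => i _; by rewrite (nth_map 0).
  have Mw : M w by apply: MDs ws => _ /mapP[u us ->]; have [] := gP _ (sU _ us).
  apply/lspan_cat; exists (v - w), w; split=> //; last by rewrite subrK.
  apply: Rgen => [|j]; first by rewrite -scaleN1r; apply: MD.
  rewrite leq_eqVlt => /orP[/eqP lj|lj].
    have -> : j = lo by apply: val_inj.
    rewrite !mxE vc summxE; apply/eqP; rewrite subr_eq0; apply/eqP/eq_bigr => i _.
    rewrite mxE; have [_ -> _ _] := gP _ (sU _ (mem_nth 0 (ltn_ord i))).
    by [].
  rewrite !mxE v0 // summxE big1 ?subrr // => i _; rewrite mxE.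
  by have [_ _ -> // _] := gP _ (sU _ (mem_nth 0 (ltn_ord i))); rewrite mulr0.
have subU k : {subset take k U <= U} by exact: mem_take.
exists (R ++ gU); split.
- move=> v; rewrite mem_cat => /orP[/Rlin //|/mapP[u /gP[_ _ _ ?] ->]] //.
- move=> v; rewrite mem_cat => /orP[/RM[Mv v0]|/mapP[u /gP[Mu _ u0 _] ->]]; split=> //.
  by move=> j lj; apply: v0; exact: ltnW.
- move=> v Mv v0; apply: lift => //; apply: Ulead => //.
- move=> k; rewrite size_cat size_map => kR.
  have [kR1|kR1] := ltnP k (size R).
    have [W Wfam WP] := Rcol k kR1; exists W => // x.
    by rewrite take_cat kR1 nth_cat kR1.
  have kU : (k - size R < size U)%N by rewrite ltn_subLR.
  have [W Wfam WP] := fam_colon Ufam kU; exists W => // x; rewrite -WP.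
  rewrite take_cat nth_cat ltnNge kR1 /= -map_take.
  set k' := (k - size R)%N in kU *.
  have [Mg glo g0 _] := gP _ (mem_nth 0 kU).
  rewrite (nth_map 0) //; split.
    move=> /lspan_cat[v1 [v2 [/Rlo v1R v2U /rowP/(_ lo)]]].
    rewrite !mxE glo v1R add0r => xE.
    have -> : x *: (U : seq A^o)`_k' = v2 0 lo by exact: xE.
    exact: gcoord v2U.
  move=> xU; apply: lift => //.
  - by rewrite -[_ *: _]add0r; apply: MD.
  - by move=> j lj; rewrite mxE g0 // mulr0.
  - by rewrite mxE glo.
Qed.

(** The last nonzero coefficients of the syzygies ending at position [l] form the colon ideal of R_l
    by its predecessors, which belongs to the family. A linear generator w of it gives w R_l = sum_j
    c_j R_j; both sides may be replaced by their quadratic components, which turns c_j into its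
    linear component. *)
Lemma syz_good m (R : seq 'rV[A]_m) : linear_list R -> colon_in R -> good (@syz m R).
Proof.
move=> Rlin Rcol; split.
  rewrite /syz => v w x v0 w0.
  under eq_bigr => i _ do rewrite !mxE scalerDl -scalerA.
  by rewrite big_split /= -scaler_sumr v0 w0 scaler0 addr0.
move=> l; have [W Wfam WP] := Rcol l (ltn_ord l); exists W => //.
have sumtake (c : nat -> A) : \sum_(i < size (take l R)) c i *: (take l R)`_i =
    \sum_(i < size R | (i < l)%N) c i *: R`_i.
  rewrite size_takel 1?ltnW // (big_ord_widen _ (fun i => c i *: (take l R)`_i) (ltnW (ltn_ord l))).
  by apply: eq_bigr => i il; rewrite nth_take.
have sumR (v : 'rV[A]_(size R)) : (forall j : 'I_(size R), (l < j)%N -> v 0 j = 0) ->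
    \sum_(i < size R) v 0 i *: R`_i = \sum_(i < size R | (i < l)%N) v 0 i *: R`_i + v 0 l *: R`_l.
  move=> v0; rewrite (bigID (fun i : 'I_(size R) => (i < l)%N)) /=; congr (_ + _).
  rewrite (bigD1 l) ?ltnn //= big1 ?addr0 // => i; rewrite -leqNgt => /andP[li il].
  by rewrite v0 ?scale0r // ltn_neqAle li andbT eq_sym.
split.
  move=> v vs v0; apply/WP; move: vs; rewrite /syz sumR // => /eqP.
  rewrite addrC addr_eq0 => /eqP ->; apply: lspanN.
  pose f (i : nat) := if insub i is Some j then v 0 j else 0.
  by exists f; rewrite sumtake; apply: eq_bigr => i _; rewrite /f valK.
move=> w wW; have [c wc] := iffRL (WP w) (lspan_mem (wW : (w : A^o) \in W)).
have A1w := fam_lin Wfam wW.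
pose v : 'rV[A]_(size R) := \row_j (if (j < l)%N then - p1 (c j) else if j == l then w else 0).
exists v; split.
- rewrite /syz sumR; last first.
    by move=> j lj; rewrite mxE ltnNge (ltnW lj) /= -val_eqE /= gtn_eqF.
  rewrite !mxE ltnn eqxx.
  apply/rowP => j; rewrite mxE [RHS]mxE.
  have := congr1 (fun x : 'rV[A]_m => p2 (x 0 j)) wc; rewrite /= sumtake mxE.
  rewrite p2_id //; last by apply: Rlin; exact: mem_nth.
  move=> wl; rewrite {}wl !summxE.
  rewrite (big_morph p2 p2D p2_0) -big_split big1 // => i il /=.
  rewrite !mxE il p2M; last by apply: Rlin; exact: mem_nth.
  by rewrite mulNr addNr.
- by rewrite mxE ltnn eqxx.
- by move=> j lj; rewrite mxE ltnNge (ltnW lj) /= -val_eqE /= gtn_eqF.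
- move=> j; rewrite mxE; case: (_ < _)%N; first exact: A1_N.
  by case: (_ == _).
Qed.

Lemma koszul_step m (R : seq 'rV[A]_m) : linear_list R -> colon_in R ->
  exists R' : seq 'rV[A]_(size R),
  [/\ linear_list R', colon_in R' & forall v, @syz _ R v <-> lspan R' v].
Proof.
move=> Rlin Rcol; have [|R' [R'lin R'gen R'col]] := good_gens _ (syz_good Rlin Rcol).
  by rewrite /syz big1 // => i _; rewrite mxE scale0r.
by exists R'.
Qed.

Lemma koszul_resolution (U0 : seq A) : fam U0 ->
  (forall x, graded_irrelevant A_ x <-> lspan (U0 : seq A^o) x) ->
  exists (b : nat -> nat) (phi : forall i, 'M[A]_(b i.+1, b i)),
    [/\ b 0%N = 1%N,
        forall i r c, A_ 1%N (phi i r c),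
        forall v : 'rV[A]_(b 0%N),
          (forall j, graded_irrelevant A_ (v 0 j)) <->
          exists w : 'rV_(b 1%N), v = w *m phi 0%N &
        forall i (v : 'rV[A]_(b i.+1)),
          v *m phi i = 0 <-> exists w : 'rV_(b i.+2), v = w *m phi i.+1].
Proof.
move=> U0fam U0irr.
have [f fP] : exists f : forall m (R : seq 'rV[A]_m), seq 'rV[A]_(size R), forall m R,
    linear_list R -> colon_in R -> [/\ linear_list (f m R), colon_in (f m R) &
      forall v, @syz _ R v <-> lspan (f m R) v].
  exists (fun m R => if pselect (linear_list R /\ colon_in R) is left e
                     then projT1 (cid (koszul_step e.1 e.2)) else [::]).
  move=> m R Rl Rc; case: pselect => [e|[]//].
  exact: projT2 (cid (koszul_step e.1 e.2)).
pose R0 : seq 'rV[A]_1 := [seq const_mx u | u <- U0].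
(* The length of one list of rows is the number of columns of the next matrix, so the state carries
   the rank along with the list. *)
pose st := fix st i : {m & seq 'rV[A]_m} := if i is j.+1
  then existT (fun m => seq 'rV[A]_m) (size (projT2 (st j))) (f _ (projT2 (st j)))
  else existT (fun m => seq 'rV[A]_m) 1%N R0.
pose b i := projT1 (st i).
pose R i : seq 'rV[A]_(b i) := projT2 (st i).
pose phi i : 'M[A]_(b i.+1, b i) := \matrix_(r < size (R i)) (R i)`_r.
have lspanR0 v : lspan R0 v <-> lspan (U0 : seq A^o) (v 0 0).
  split=> [[c ->]|[c vc]]; exists c.
    rewrite summxE size_map; apply: eq_bigr => i _.
    by rewrite mxE (nth_map 0) // mxE.
  apply/rowP => j; rewrite ord1 vc summxE size_map; apply: eq_bigr => i _.
  by rewrite mxE (nth_map 0) // mxE.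
have RP i : linear_list (R i) /\ colon_in (R i).
  elim: i => [|i [Rl Rc]]; last by have [] := fP _ _ Rl Rc.
  split; first by move=> _ /mapP[u uU ->] j; rewrite mxE; exact: (fam_lin U0fam).
  move=> k; rewrite size_map => kU; have [W Wfam WP] := fam_colon U0fam kU.
  exists W => // x; rewrite -WP -map_take.
  have aux (s : seq A) v : lspan [seq const_mx u : 'rV[A]_1 | u <- s] v <->
      lspan (s : seq A^o) (v 0 0).
    split=> [[c ->]|[c vc]]; exists c.
      rewrite summxE size_map; apply: eq_bigr => i _.
      by rewrite mxE (nth_map 0) // mxE.
    apply/rowP => j; rewrite ord1 vc summxE size_map; apply: eq_bigr => i _.
    by rewrite mxE (nth_map 0) // mxE.
  by rewrite aux (nth_map 0) // !mxE.
have mulphi i (w : 'rV[A]_(b i.+1)) : w *m phi i = \sum_(r < size (R i)) w 0 r *: (R i)`_r.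
  by rewrite mulmx_sum_row; apply: eq_bigr => r _; rewrite rowK.
have lspanphi i v : lspan (R i) v <-> exists w : 'rV[A]_(b i.+1), v = w *m phi i.
  split=> [[c ->]|[w ->]].
    exists (\row_r c r); rewrite mulphi; apply: eq_bigr => r _; by rewrite mxE.
  pose c (r : nat) := if insub r is Some j then w 0 j else 0.
  by exists c; rewrite mulphi; apply: eq_bigr => r _; rewrite /c valK.
exists b, phi; split=> //.
- move=> i r c; rewrite mxE; apply: (RP i).1; exact: mem_nth.
- move=> v; rewrite -(lspanphi 0%N) -[R 0%N]/R0 lspanR0 -U0irr.
  by split=> [|v0 j]; [exact|rewrite ord1].
- move=> i v; rewrite -(lspanphi i.+1) mulphi.
  by have [_ _] := fP _ _ (RP i).1 (RP i).2; exact.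
Qed.

End KoszulFiltration.

(** * Exchange orders *)

Section LexOrder.
Variables (X : eqType) (T : finType) (r : T -> nat) (key : X -> T -> nat).
Hypothesis r_inj : injective r.
Hypothesis key_inj : forall x y, key x =1 key y -> x = y.

Definition before (x y : X) : bool :=
  [exists t, (key y t < key x t)%N && [forall t', (r t' < r t)%N ==> (key x t' == key y t')]].

Lemma beforeP x y : reflect (exists2 t, (key y t < key x t)%N &
    forall t', (r t' < r t)%N -> key x t' = key y t') (before x y).
Proof.
apply: (iffP existsP) => -[t]; first move=> /andP[? /forallP H]; last move=> ? H.
  by exists t => // t' tt'; apply/eqP; move/implyP: (H t'); exact.
by exists t; apply/andP; split=> //; apply/forallP => t'; apply/implyP => /H ->.
Qed.

Lemma beforexx x : before x x = false.
Proof. by apply/negbTE/negP => /beforeP[t lt _]; rewrite ltnn in lt. Qed.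

Lemma before_trans : transitive before.
Proof.
move=> y x z /beforeP[t xt xeq] /beforeP[t' yt yeq]; apply/beforeP.
have [tt'|tt'|/r_inj tt'] := ltngtP (r t) (r t').
- exists t => [|s st]; first by rewrite -(yeq _ tt').
  by rewrite xeq // yeq // (ltn_trans st).
- exists t' => [|s st]; first by rewrite (xeq _ tt').
  by rewrite xeq ?yeq // (ltn_trans st).
- subst t'; exists t => [|s st]; first exact: ltn_trans xt.
  by rewrite xeq // yeq.
Qed.

Lemma before_total x y : x != y -> before x y || before y x.
Proof.
move=> xy; have /existsP[t0 t0P] : [exists t, key x t != key y t].
  apply: contraNT xy; rewrite negb_exists => /forallP H; apply/eqP/key_inj => t.
  by apply/eqP; have := H t; rewrite negbK.
have [t tP tmin] := @arg_minnP _ t0 (fun t => key x t != key y t) r t0P.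
have eqlt t' : (r t' < r t)%N -> key x t' = key y t'.
  by rewrite ltnNge => tt'; apply/eqP; apply: contraNT tt'; exact: tmin.
move: tP; rewrite neq_ltn => /orP[lt|lt]; apply/orP; [right|left]; apply/beforeP.
  by exists t => // t' /eqlt.
by exists t.
Qed.

Definition leb x y := (x == y) || before x y.

Lemma leb_total : total leb.
Proof.
move=> x y; rewrite /leb [y == x]eq_sym; have [//|xy] := eqVneq x y.
exact: before_total.
Qed.

Lemma leb_trans : transitive leb.
Proof.
move=> y x z /orP[/eqP -> //|xy] /orP[/eqP <-|yz]; rewrite /leb; first by rewrite xy orbT.
by rewrite (before_trans xy yz) orbT.
Qed.

Lemma mem_take_sort (s : seq X) k x0 x : uniq s -> (k < size s)%N ->
  (x \in take k (sort leb s)) = (x \in s) && before x (nth x0 (sort leb s) k).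
Proof.
move=> us ks; set s' := sort leb s.
have us' : uniq s' by rewrite sort_uniq.
have ss' : size s' = size s by rewrite size_sort.
have sorts : sorted leb s' by exact: sort_sorted leb_total _.
have -> : (x \in s) = (x \in s') by rewrite mem_sort.
apply/idP/andP => [xk|[xs xb]].
  have xs := mem_take xk; split=> //.
  have ik := index_ltn xk.
  have := sorted_ltn_nth leb_trans x0 sorts (index x s') k.
  rewrite !inE index_mem xs ss' ks nth_index // => /(_ isT isT ik) /orP[/eqP xk'|//].
  by move: ik; rewrite xk' index_uniq ?ss' ?ltnn.
rewrite in_take // ltnNge; apply/negP => ki.
have lebxx : reflexive leb by move=> y; rewrite /leb eqxx.
have := sorted_leq_nth leb_trans lebxx x0 sorts k (index x s').
rewrite !inE index_mem xs ss' ks nth_index // => /(_ isT isT ki) /orP[/eqP e|bx].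
  by move: xb; rewrite e beforexx.
by have := before_trans xb bx; rewrite beforexx.
Qed.

End LexOrder.

Section ExchangeOrder.
Variables (n d : nat) (a : 'I_n -> nat).
Hypothesis d_gt0 : (0 < d)%N.
Let L := veronese_gens a d.
Local Notation mon := 'X_{1..n}.

Variables (E D : pred 'I_n) (rho : 'I_n -> nat).
Hypothesis rho_inj : injective rho.

(** [uset] below asks for an element of [D] under its bound that is preceded, for [rho], by an
    element of [E] dividing [v]. Heads are the members of [E] up to the first one dividing [v];
    tails are the members of [D] so preceded. An exchange that raises a head or lowers a tail cannot
    leave [uset], which is why heads are to rank first and tails last. *)
Definition head_class (v : mon) x :=
  E x && [forall y, E y && (rho y < rho x)%N ==> (v y == 0%N)].
Definition tail_class (v : mon) x :=
  D x && [exists y, [&& E y, (rho y < rho x)%N & (0 < v y)%N]].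

Lemma head_classP (v : mon) x : reflect (E x /\ forall y, E y -> (rho y < rho x)%N -> v y = 0%N)
  (head_class v x).
Proof.
apply: (iffP andP) => -[Ex H]; split=> //.
  by move=> y Ey yx; apply/eqP; move/forallP/(_ y)/implyP: H; apply; rewrite Ey.
by apply/forallP => y; apply/implyP => /andP[Ey /(H _ Ey) ->].
Qed.

Lemma tail_classP (v : mon) x : reflect (D x /\ exists y, [/\ E y, (rho y < rho x)%N & (0 < v y)%N])
  (tail_class v x).
Proof.
apply: (iffP andP) => -[Dx H]; split=> //.
  by case/existsP: H => y /and3P[? ? ?]; exists y.
by case: H => y [? ? ?]; apply/existsP; exists y; apply/and3P.
Qed.

Lemma head_min (v : mon) y : E y -> (0 < v y)%N ->
  exists z, [/\ head_class v z, (rho z <= rho y)%N & (0 < v z)%N].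
Proof.
move=> Ey vy; have Py : (fun z => E z && (0 < v z)%N) y by rewrite Ey.
have [z /andP[Ez vz] zmin] := @arg_minnP _ y (fun z => E z && (0 < v z)%N) rho Py.
exists z; split=> //; last exact: zmin.
apply/head_classP; split=> // w Ew; rewrite ltnNge; apply: contraNeq.
by rewrite -lt0n => vw; apply: zmin; rewrite Ew.
Qed.

Lemma head_tailN v x : head_class v x -> tail_class v x -> False.
Proof. by move=> /head_classP[_ H] /tail_classP[_ [y [Ey yx]]]; rewrite (H y). Qed.

Definition rbound := (\max_x rho x).+1.
Lemma rho_lt x : (rho x < rbound)%N.
Proof. by rewrite ltnS; exact: leq_bigmax. Qed.

Definition pos := ('I_n + ('I_n + 'I_n))%type.
(** The offsets by [rbound] separate three blocks: heads by increasing [rho], tails by decreasing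
    [rho], and finally all variables, to break ties. *)
Definition prank (t : pos) : nat :=
  match t with
  | inl x => rho x
  | inr (inl x) => (2 * rbound - rho x)%N
  | inr (inr x) => (2 * rbound).+1 + rho x
  end.
(** Larger keys come first, so large exponents are preferred at heads and small ones at tails;
    [d - v x] loses nothing because exponents of generators are at most d. *)
Definition pkey (v : mon) (t : pos) : nat :=
  match t with
  | inl x => if head_class v x then v x else 0%N
  | inr (inl x) => if tail_class v x then (d - v x)%N else 0%N
  | inr (inr x) => v x
  end.

Lemma prank_inj : injective prank.
Proof.
move=> [x|[x|x]] [y|[y|y]] /=; have := rho_lt x; have := rho_lt y => ? ? e;
  try lia; by congr (_ _); try congr (_ _); apply: rho_inj; lia.
Qed.

Lemma pkey_inj u v : pkey u =1 pkey v -> u = v.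
Proof. by move=> uv; apply/mnmP => x; have := uv (inr (inr x)). Qed.

(** Heads, then the remaining variables, then tails, each block ordered by [rho]. *)
Definition erank (v : mon) x : nat :=
  ((~~ head_class v x + tail_class v x) * rbound + rho x)%N.

Variant erank_spec (v : mon) x : nat -> bool -> bool -> Type :=
| ERankHead of head_class v x : erank_spec v x (rho x) true false
| ERankTail of tail_class v x : erank_spec v x (2 * rbound + rho x) false true
| ERankMid : erank_spec v x (rbound + rho x) false false.

Lemma erankP v x : erank_spec v x (erank v x) (head_class v x) (tail_class v x).
Proof.
rewrite /erank; case hx: (head_class v x); case tx: (tail_class v x).
- by case: (head_tailN hx tx).
- by rewrite mul0n add0n; constructor.
- by constructor.
- by rewrite mul1n; constructor.
Qed.

Lemma erank_inj v : injective (erank v).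
Proof.
move=> x y e; apply: rho_inj; move: e; have := rho_lt x; have := rho_lt y.
by case: (erankP v x) => ?; case: (erankP v y) => ?; lia.
Qed.

Local Notation bef := (before prank pkey).

Variable top : bool.
Definition uset (v : mon) : bool :=
  top || [exists x, tail_class v x && (v x < a x)%N].

Lemma head_key_pos (v : mon) x : (0 < pkey v (inl x))%N -> head_class v x /\ (0 < v x)%N.
Proof. by rewrite /=; case: ifP. Qed.

(** The first element of [E] dividing a monomial is a head with positive key, so equal head keys put
    it at the same place in [u] and [v]; it determines the heads. *)
Lemma agree_head (u v : mon) : (forall x, pkey u (inl x) = pkey v (inl x)) ->
  forall x, head_class v x -> head_class u x.
Proof.
move=> uv x /head_classP[Ex vx]; apply/head_classP; split=> // y Ey yx.
apply/eqP; rewrite -leqn0 leqNgt; apply/negP => uy.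
have [z [hz zy uz]] := head_min Ey uy.
have /head_key_pos[/head_classP[Ez _] vz] : (0 < pkey v (inl z))%N by rewrite -uv /= hz.
by rewrite vx // in vz; exact: leq_ltn_trans yx.
Qed.

Lemma agree_tail (u v : mon) : (forall x, pkey u (inl x) = pkey v (inl x)) ->
  forall x, tail_class v x -> tail_class u x.
Proof.
move=> uv x /tail_classP[Dx [y [Ey yx vy]]]; apply/tail_classP; split=> //.
have [z [hz zy vz]] := head_min Ey vy.
have /head_key_pos[/head_classP[Ez _] uz] : (0 < pkey u (inl z))%N by rewrite uv /= hz.
by exists z; split=> //; exact: leq_ltn_trans yx.
Qed.

Lemma vcone1_diff (u v : mon) x : vcone d a 1 u -> vcone d a 1 v -> (u x < v x)%N ->
  exists y, (v y < u y)%N.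
Proof.
move=> /vconeP[ud _] /vconeP[vd _] ux; apply/existsP.
rewrite -[X in is_true X]negbK negb_exists; apply/negP => /forallP vu.
have : (mdeg u < mdeg v)%N; last by rewrite ud vd ltnn.
rewrite !mdegE (bigD1 x) //= [X in (_ < X)%N](bigD1 x) //= -addSn leq_add // leq_sum // => y _.
by rewrite leqNgt vu.
Qed.

Lemma vcone1_le (v : mon) x : vcone d a 1 v -> (v x <= d)%N /\ (v x <= a x)%N.
Proof.
move=> /vconeP[vd /(_ x)]; rewrite mul1n => va; split=> //.
by rewrite -[d]mul1n -vd mdegE (bigD1 x) //= leq_addr.
Qed.

(* The exchange pairs of v, in the form of a state of the same kind. *)
Lemma before_exchange (u v : mon) : vcone d a 1 u -> vcone d a 1 v -> bef u v ->
  exists i j, [/\ (v i < u i)%N, (u j < v j)%N & (erank v i < erank v j)%N].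
Proof.
move=> u1 v1 /beforeP[[x|[x|x]] lt eqk].
(* Decided at a head x of [u]. It is a head of [v] as well, since an earlier element of [E] dividing
   [v] would provide a positive key that [u] shares. All heads before x have exponent 0 in [v], so a
   variable losing exponent ranks after x. *)
- have eqh y : (rho y < rho x)%N -> pkey u (inl y) = pkey v (inl y) by exact: (eqk (inl y)).
  have [ux u0] := head_key_pos (leq_ltn_trans (leq0n _) lt).
  have /head_classP[Ex ux0] := ux.
  have vx : head_class v x.
    apply/head_classP; split=> // y Ey yx; apply/eqP; rewrite -leqn0 leqNgt; apply/negP => vy.
    have [z [hz zy vz]] := head_min Ey vy; have zx := leq_ltn_trans zy yx.
    have /head_key_pos[/head_classP[Ez _] uz] : (0 < pkey u (inl z))%N by rewrite eqh //= hz.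
    by rewrite ux0 in uz.
  move: lt; rewrite /= ux vx => lt.
  have [j uj] := vcone1_diff v1 u1 lt; exists x, j; split=> //.
  have rx := rho_lt x; case: (erankP v x) vx => // vx _.
  case: (erankP v j) => [vj|_|]; [|lia|lia]; have /head_classP[Ej _] := vj.
  have [//|jx|/rho_inj xj] := ltngtP (rho x) (rho j); last by rewrite -xj ltnNge ltnW in uj.
  by have /head_classP[_ /(_ j Ej jx) v0] := vx; rewrite v0 in uj.
(* Decided at a tail x. The head keys agree, so [u] and [v] have the same heads and tails, and u_x <
   v_x. Tails of larger [rho] were compared earlier and agree, so a variable gaining exponent ranks
   before x. *)
- have eqh y : pkey u (inl y) = pkey v (inl y).
    by apply: (eqk (inl y)); rewrite /=; have := rho_lt x; have := rho_lt y; lia.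
  have eqh' y : pkey v (inl y) = pkey u (inl y) by rewrite eqh.
  have ux : tail_class u x by move: lt; rewrite /=; case: (tail_class u x).
  have vx := agree_tail eqh' ux.
  move: lt; rewrite /= ux vx => lt.
  have ltx : (u x < v x)%N by lia.
  have [i ui] := vcone1_diff u1 v1 ltx; exists i, x; split=> //.
  have := rho_lt i; have := rho_lt x; case: (erankP v x) vx => // _ _.
  case: (erankP v i) => [_|vi|]; try lia; move=> _ _; rewrite ltn_add2l.
  have [//|xi|/rho_inj xi] := ltngtP (rho i) (rho x); last by rewrite xi ltnNge ltnW in ui.
  have ti := agree_tail eqh vi.
  have := eqk (inr (inl i)); rewrite /= ti vi => /(_ _).
  have := (vcone1_le i u1).1; have := (vcone1_le i v1).1; have := rho_lt i; have := rho_lt x.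
  by move=> ? ? ? ? e; have := e ltac:(lia); lia.
(* Decided by the tie-break: exponents agree at heads and tails, so all differences lie in the
   middle block, and x is the first of them. *)
- have eqh y : pkey u (inl y) = pkey v (inl y).
    by apply: (eqk (inl y)); rewrite /=; have := rho_lt y; lia.
  have eqh' y : pkey v (inl y) = pkey u (inl y) by rewrite eqh.
  have eqt y : pkey u (inr (inl y)) = pkey v (inr (inl y)).
    by apply: (eqk (inr (inl y))); rewrite /=; lia.
  have mid y : u y != v y -> ~~ head_class v y /\ ~~ tail_class v y.
    move=> uy; split; apply: contra uy => hy.
      by have := eqh y; rewrite /= hy (agree_head eqh hy) => ->.
    have := eqt y; rewrite /= hy (agree_tail eqh hy) => e.
    by have := (vcone1_le y u1).1; have := (vcone1_le y v1).1 => ? ?; apply/eqP; lia.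
  rewrite /= in lt.
  have [j uj] := vcone1_diff v1 u1 lt; exists x, j; split=> //.
  have [] := mid x; first by rewrite gtn_eqF.
  have [] := mid j; first by rewrite ltn_eqF.
  case: (erankP v x) => //; case: (erankP v j) => // _ _ _ _; rewrite ltn_add2l.
  have [//|xj|/rho_inj xj] := ltngtP (rho x) (rho j); last by move: uj lt; rewrite xj; lia.
  have := eqk (inr (inr j)); rewrite /= => e; move: uj; rewrite e ?ltnn //.
  by rewrite ltn_add2l.
Qed.

(** The blocks of [erank] match those of [prank]. If i is a head, its key grows and no earlier one
    changes. Otherwise j is not a head either and heads and tails stay the same: a tail j is where
    the first key changes, and if j is not a tail, both lie in the middle block and the tie-break
    sees i first. *)
Lemma exchange_before (v : mon) i j : vcone d a 1 v -> uset v -> (erank v i < erank v j)%N ->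
  (v i < a i)%N -> (0 < v j)%N ->
  let u := mexch i j v in [/\ vcone d a 1 u, uset u & bef u v].
Proof.
move=> v1 vU ij vi vj u.
have nij : i != j by apply: contraTneq ij => ->; rewrite ltnn.
have ui : u i = (v i).+1 by exact: mexch_i.
have uj : u j = (v j).-1 by exact: mexch_j.
have ux x : x != i -> x != j -> u x = v x by exact: mexch_neq.
have u1 : vcone d a 1 u by exact: vcone1_mexch.
have jle := vcone1_le j v1.
case hi: (head_class v i).
  have /head_classP[Ei v0] := hi.
  have uhi : head_class u i.
    apply/head_classP; split=> // y Ey yi; rewrite ux ?v0 //.
      by apply: contraTneq yi => ->; rewrite ltnn.
    by apply: contraTneq vj => <-; rewrite v0.
  split=> //.
    move: vU; rewrite /uset; case: top => //= /existsP[q /andP[/tail_classP[Dq [y [Ey yq vy]]] vq]].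
    have iq : (rho i < rho q)%N.
      by apply: leq_ltn_trans yq; rewrite leqNgt; apply: contraTN vy => yi; rewrite v0.
    apply/existsP; exists q; apply/andP; split.
      by apply/tail_classP; split=> //; exists i; split=> //; rewrite ui.
    have qi : q != i by apply: contraTneq iq => ->; rewrite ltnn.
    by have [qj|qj] := eqVneq q j; [rewrite qj in vq *; rewrite uj (leq_ltn_trans (leq_pred _))|rewrite ux].
  apply/beforeP; exists (inl i) => [|[y|[y|y]] /= yi]; rewrite /= ?hi ?uhi ?ui //.
  - case uy: (head_class u y); case vy: (head_class v y) => //.
    + have /head_classP[Ey _] := uy; apply: ux.
        by apply: contraTneq yi => ->; rewrite ltnn.
      by apply: contraTneq vj => <-; rewrite v0.
    + have /head_classP[Ey _] := uy; rewrite ux ?v0 //.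
        by apply: contraTneq yi => ->; rewrite ltnn.
      by apply: contraTneq vj => <-; rewrite v0.
    + by have /head_classP[Ey _] := vy; rewrite v0.
  - by have := rho_lt i; have := rho_lt y; lia.
  - by have := rho_lt i; have := rho_lt y; lia.
have hj : head_class v j = false.
  move: ij; have := rho_lt i; have := rho_lt j.
  by case: (erankP v i) hi => [//|_|] _; case: (erankP v j) => [_|//|//]; lia.
have hne x : head_class v x -> x != i /\ x != j.
  by move=> hx; split; apply: contraTneq hx => ->; rewrite ?hi ?hj.
have eqh : forall x, pkey u (inl x) = pkey v (inl x).
  move=> x; rewrite /=; case vx: (head_class v x).
    have [xi xj] := hne x vx; suff -> : head_class u x by rewrite ux.
    have /head_classP[Ex v0] := vx; apply/head_classP; split=> // y Ey yx.
    have vy : head_class v y.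
      by apply/head_classP; split=> // z Ez zy; apply: v0 => //; exact: ltn_trans yx.
    by have [yi yj] := hne y vy; rewrite ux ?v0.
  case uhx: (head_class u x) => //; have /head_classP[Ex u0] := uhx.
  have [y [Ey yx vy]] : exists y, [/\ E y, (rho y < rho x)%N & (0 < v y)%N].
    move: vx; rewrite /head_class Ex /= => /negbT; rewrite negb_forall => /existsP[y].
    by rewrite negb_imply -lt0n => /andP[/andP[? ?] ?]; exists y.
  have [z [hz zy vz]] := head_min Ey vy; have [zi zj] := hne z hz.
  have /head_classP[Ez _] := hz.
  by move: vz; rewrite -(ux z zi zj) u0 //; exact: leq_ltn_trans yx.
have eqh' : forall x, pkey v (inl x) = pkey u (inl x) by move=> x; rewrite eqh.
have tuv x : tail_class u x = tail_class v x.
  by apply/idP/idP; apply: agree_tail.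
split=> //.
  move: vU; rewrite /uset; case: top => //= /existsP[q /andP[tq vq]].
  (* A witness q = i for membership may be raised to its bound; j is then a tail too and, having
     been lowered, takes its place. *)
  have [qi|qi] := eqVneq q i.
    apply/existsP; exists j; rewrite tuv uj; apply/andP; split; last by lia.
    move: tq ij; rewrite qi; have := rho_lt i; have := rho_lt j.
    by case: (erankP v i) => [//|_|//] ? ? _; case: (erankP v j) => [_|//|]; lia.
  apply/existsP; exists q; rewrite tuv tq /=.
  by have [qj|qj] := eqVneq q j; [rewrite qj in vq *; rewrite uj (leq_ltn_trans (leq_pred _))|rewrite ux].
have ri := rho_lt i; have rj := rho_lt j.
case tj: (tail_class v j).
  apply/beforeP; exists (inr (inl j)) => [|[y|[y|y]] yj].
  - by rewrite /= tuv tj uj; lia.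
  - exact: eqh.
  - rewrite /= tuv; case ty: (tail_class v y) => //; rewrite ux //.
      apply: contraTneq yj => yi; move: ij; rewrite -yi /=.
      have ry := rho_lt y; move: ty tj.
      by case: (erankP v y) => [//|_|//] _; case: (erankP v j) => [//|_|//] _; lia.
    by apply: contraTneq yj => ->; rewrite ltnn.
  - by move: yj => /=; have := rho_lt y; lia.
have ti : tail_class v i = false.
  by move: ij tj; case: (erankP v i) => [//|_|//]; case: (erankP v j) => [_|//|]; lia.
have rij : (rho i < rho j)%N.
  by move: ij ti tj hi hj; case: (erankP v i) => [_|_|] => [|//|]; case: (erankP v j) => [_|_|]; lia.
apply/beforeP; exists (inr (inr i)) => [|[y|[y|y]] yj].
- by rewrite /= ui.
- exact: eqh.
- rewrite /= tuv; case ty: (tail_class v y) => //; rewrite ux //.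
    by apply: contraTneq ty => ->; rewrite ti.
  by apply: contraTneq ty => ->; rewrite tj.
- move: yj; rewrite /= ltn_add2l => yi; apply: ux; apply: contraTneq yi => ->; rewrite -leqNgt //.
  exact: ltnW.
Qed.

Definition ulist : seq mon := sort (leb prank pkey) [seq v <- L | uset v].

Lemma mem_ulist v : (v \in ulist) = vcone d a 1 v && uset v.
Proof. by rewrite mem_sort mem_filter mem_veronese andbC. Qed.

Lemma mem_take_ulist k v : (k < size ulist)%N ->
  (v \in take k ulist) = (v \in ulist) && bef v (nth 0%MM ulist k).
Proof.
rewrite size_sort => ks; rewrite (mem_take_sort prank_inj pkey_inj 0%MM) //.
  by rewrite mem_sort.
rewrite filter_uniq // filter_uniq // filter_uniq // map_inj_uniq ?enum_uniq //.
by move=> w w' ww'; apply: val_inj.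
Qed.

End ExchangeOrder.

(** * Colon ideals of consecutive generators *)

Section ColonClosed.
Variables (n d : nat) (a : 'I_n -> nat).
Hypothesis d_gt0 : (0 < d)%N.

(** Divisibility inside C: the quotient has to lie in C, not merely to have nonnegative
    exponents. *)
Definition gens_div k (s : seq 'X_{1..n}) (m : 'X_{1..n}) : Prop :=
  exists u, [/\ u \in s, (u <= m)%MM & vcone d a k (m - u)%MM].

(* The colon ideal of consecutive members of a list is generated by a list of
   the same kind, for the order erank and the exchangeable coordinates of v. *)
Lemma ulist_colon (E D : pred 'I_n) rho top k : injective rho ->
  let s := ulist d a E D rho top in (k < size s)%N ->
  exists E' D' rho', injective rho' /\ forall l m, vcone d a l m ->
    (gens_div l (take k s) (m + nth 0%MM s k)%MM <->
     exists2 l', l = l'.+1 & gens_div l' (ulist d a E' D' rho' false) m).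
Proof.
move=> rho_inj s ks; set v := nth 0%MM s k.
have vs : v \in s by exact: mem_nth.
have /andP[v1 vU] : vcone d a 1 v && uset a E D rho top v by rewrite -mem_ulist.
pose E' x := (v x < a x)%N; pose D' x := (0 < v x)%N.
exists E', D', (erank E D rho v); split; first exact: (erank_inj d_gt0).
move=> l m ml; split.
  move=> [u [uk um mu]]; move: uk; rewrite mem_take_ulist // => /andP[us uv].
  have /andP[u1 _] : vcone d a 1 u && uset a E D rho top u by rewrite -mem_ulist.
  have [i [j [vi vj ij]]] := before_exchange d_gt0 rho_inj u1 v1 uv.
  have nij : i != j by apply: contraTneq ij => ->; rewrite ltnn.
  have mx x : (m x + v x = (m + v - u)%MM x + u x)%N.
    by rewrite -!mnmDE submK.
  (* As [u] divides [m + v] in C, a gain of [u] over [v] at i must come from [m], and a loss at j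
     leaves m_j below l a_j. Hence [m] has a factor w with w_i > 0 and w_j < a_j. *)
  have mi : (0 < m i)%N.
    by rewrite -(ltn_add2r (v i)) add0n mx (leq_trans vi) // leq_addl.
  have mj : (m j < l * a j)%N.
    have /vconeP[_ /(_ j)] := mu; apply: leq_trans.
    by rewrite -(ltn_add2r (v j)) mx ltn_add2l.
  case: l ml mj mu => [|l] ml mj mu; first by rewrite mul0n in mj.
  exists l => //; have [_ /(_ i j nij mi mj)[w [w1 wm ml1 wi wj]]] := vcone_split d_gt0 ml.
  exists w; split=> //; rewrite mem_ulist w1 /= /uset /=.
  apply/existsP; exists j; rewrite wj andbT.
  apply/tail_classP; split; first by rewrite /D'; exact: leq_ltn_trans vj.
  exists i; split=> //; rewrite /E'.
  by apply: leq_trans vi _; exact: (vcone1_le i u1).2.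
move=> [l' ll [w []]]; rewrite mem_ulist => /andP[w1 wU] wm mw.
move: wU; rewrite /uset /= => /existsP[j /andP[/tail_classP[Dj [i [Ei ij wi]]] wj]].
(* Conversely v w = u (w x_j / x_i), where u = v x_i / x_j precedes v. *)
have [u1 uU uv] := exchange_before d_gt0 v1 vU ij Ei Dj.
set u := mexch i j v in u1 uU uv.
have nij : i != j by apply: contraTneq ij => ->; rewrite ltnn.
have uE x : (u x + (j == x) = v x + (i == x))%N by exact: mexchE.
have wE x : (mexch j i w x + (i == x) = w x + (j == x))%N by exact: mexchE.
have wmx x : (w x <= m x)%N by exact: (mnm_lepP wm).
have le_u x : (u x <= m x + v x)%N.
  have := uE x; have := wE x; have := wmx x; have := leq0n (mexch j i w x); clear.
  by case: (i == x); case: (j == x) => /=; lia.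
exists u; split.
- by rewrite mem_take_ulist // uv mem_ulist u1 uU.
- by apply/mnm_lepP => x; rewrite mnmDE.
- have -> : (m + v - u = (m - w) + mexch j i w)%MM.
    apply/mnmP => x; rewrite (mnmBE x (m + v) u) (mnmDE x m v).
    rewrite (mnmDE x (m - w) (mexch j i w)) (mnmBE x m w).
    have := uE x; have := wE x; have := wmx x; have := le_u x; clear.
    by case: (i == x); case: (j == x) => /=; lia.
  rewrite ll -addn1; apply: vconeD => //; apply: vcone1_mexch => //.
  by rewrite eq_sym.
Qed.

End ColonClosed.

(** * Semigroup rings *)

(* F is K[C], the monomials of C spanning the image of Psi. *)
Definition toric_model (K : fieldType) n d (a : 'I_n -> nat) (F : comAlgType K)
    (F_ : nat -> set F) (Psi : {rmorphism F -> {mpoly K[n]}}) : Prop :=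
  [/\ injective Psi,
      forall c x, Psi (c *: x) = c *: Psi x,
      forall k x, F_ k x <-> {in msupp (Psi x), forall m, vcone d a k m} &
      forall f : {mpoly K[n]}, {in msupp f, forall m, exists k, vcone d a k m} <->
                               exists x, Psi x = f].

Section ToricModel.
Variables (K : fieldType) (n d : nat) (a : 'I_n -> nat).
Hypothesis d_gt0 : (0 < d)%N.
Variables (F : comAlgType K) (F_ : nat -> set F) (Psi : {rmorphism F -> {mpoly K[n]}}).
Hypothesis FPsi : toric_model d a F_ Psi.
Local Notation S := {mpoly K[n]}.
Local Notation mon := 'X_{1..n}.
Local Notation vcone := (vcone d a).

Lemma Psi_inj : injective Psi. Proof. by case: FPsi. Qed.
Lemma PsiZ c x : Psi (c *: x) = c *: Psi x. Proof. by case: FPsi. Qed.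
Lemma F_P k x : F_ k x <-> {in msupp (Psi x), forall m, vcone k m}. Proof. by case: FPsi. Qed.
Lemma Psi_supp x : {in msupp (Psi x), forall m, exists k, vcone k m}.
Proof. by case: FPsi => _ _ _ H; apply/H; exists x. Qed.
Lemma Psi_surj (f : S) : {in msupp f, forall m, exists k, vcone k m} -> exists x, Psi x = f.
Proof. by case: FPsi => _ _ _ H /H. Qed.

Lemma Psi_alg c : Psi c%:A = c%:MP.
Proof. by rewrite PsiZ rmorph1 alg_mpolyC. Qed.

(** The monomial x^m as an element of [F]; outside C the value is 0 by default. *)
Definition xm (m : mon) : F := xget 0 [set x | Psi x = 'X_[m]].

Lemma Psi_xm k m : vcone k m -> Psi (xm m) = 'X_[m].
Proof.
move=> km; rewrite /xm; case: xgetP => [x _ //|H].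
have [|x xE] := @Psi_surj 'X_[m]; last by case: (H x).
by move=> m'; rewrite msuppX inE => /eqP ->; exists k.
Qed.

Lemma xmD k l m m' : vcone k m -> vcone l m' -> xm (m + m')%MM = xm m * xm m'.
Proof.
move=> mk ml; apply: Psi_inj; rewrite rmorphM /=.
by rewrite (Psi_xm mk) (Psi_xm ml) (Psi_xm (vconeD mk ml)) mpolyXD.
Qed.

Lemma F_xm k m : vcone k m -> F_ k (xm m).
Proof. by move=> mk; apply/F_P => m'; rewrite (Psi_xm mk) msuppX inE => /eqP ->. Qed.

Lemma xm0 : xm 0%MM = 1.
Proof.
have v0 : vcone 0 0%MM by apply/vconeP; rewrite mdeg0; split=> // i; rewrite mnm0E.
by apply: Psi_inj; rewrite (Psi_xm v0) mpolyX0 rmorph1.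
Qed.

Lemma FE x : x = \sum_(m <- msupp (Psi x)) (Psi x)@_m *: xm m.
Proof.
apply: Psi_inj; rewrite rmorph_sum /= {1}[Psi x]mpolyE big_seq [RHS]big_seq.
by apply: eq_bigr => m /Psi_supp[k mk]; rewrite PsiZ (Psi_xm mk).
Qed.

Definition hcomp k (x : F) : F := xget 0 [set y | Psi y = pihomog mdeg (k * d) (Psi x)].

Lemma vcone_mdeg k m : vcone k m -> mdeg m = (k * d)%N.
Proof. by case/vconeP. Qed.

Lemma Psi_hcomp k x : Psi (hcomp k x) = pihomog mdeg (k * d) (Psi x).
Proof.
rewrite /hcomp; case: xgetP => [y _ //|H].
have [|y yE] := @Psi_surj (pihomog mdeg (k * d) (Psi x)); last by case: (H y).
move=> m; rewrite mcoeff_msupp mcoeff_pihomog; case: ifP => _; last by rewrite eqxx.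
by rewrite -mcoeff_msupp; exact: Psi_supp.
Qed.

Lemma F_hcomp k x : F_ k (hcomp k x).
Proof.
apply/F_P => m; rewrite Psi_hcomp mcoeff_msupp mcoeff_pihomog; case: ifP => [/eqP mk|_]; last by rewrite eqxx.
rewrite -mcoeff_msupp => /Psi_supp[l ml]; suff -> : k = l by [].
by apply/eqP; rewrite -(eqn_pmul2r d_gt0) -mk (vcone_mdeg ml).
Qed.

Lemma hcomp_id k x : F_ k x -> hcomp k x = x.
Proof.
move=> /F_P xk; apply: Psi_inj; rewrite Psi_hcomp; apply/mpolyP => m.
rewrite mcoeff_pihomog; case: ifP => // mk; rewrite memN_msupp_eq0 //.
by apply: contraFN mk => /xk /vcone_mdeg ->.
Qed.

Lemma hcompD k x y : hcomp k (x + y) = hcomp k x + hcomp k y.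
Proof. by apply: Psi_inj; rewrite rmorphD /= !Psi_hcomp rmorphD pihomogD. Qed.

Lemma hcomp0 k : hcomp k 0 = 0.
Proof. by apply: Psi_inj; rewrite Psi_hcomp !rmorph0 pihomog0. Qed.

Lemma hcompM k l x y : F_ l y -> hcomp (k + l) (x * y) = hcomp k x * y.
Proof.
move=> /F_P yl; apply: Psi_inj; rewrite rmorphM /= !Psi_hcomp rmorphM /=.
apply/mpolyP => m; rewrite mcoeff_pihomog mcoeffM mcoeffM.
case: ifP => [/eqP mk|mk]; last first.
  rewrite big1 // => -[m1 m2] /= /eqP m12; rewrite mcoeff_pihomog.
  case: ifP => [/eqP m1k|_]; last by rewrite mul0r.
  rewrite [X in _ * X]memN_msupp_eq0 ?mulr0 //; apply: contraFN mk => /yl /vcone_mdeg m2l.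
  by rewrite m12 mdegD m1k m2l mulnDl.
apply: eq_bigr => -[m1 m2] /= /eqP m12; rewrite mcoeff_pihomog; case: ifP => // m1k.
have /memN_msupp_eq0 -> : (m2 : mon) \notin msupp (Psi y); last by rewrite !mulr0.
apply: (contraFN _ m1k) => /yl /vcone_mdeg m2l; apply/eqP.
by have := etrans (esym (congr1 (@mdeg n) m12)) mk; rewrite mdegD m2l mulnDl => /addIn.
Qed.

Lemma F_lin k c x y : F_ k x -> F_ k y -> F_ k (c *: x + y).
Proof.
move=> /F_P xk /F_P yk; apply/F_P => m; rewrite rmorphD PsiZ => /msuppD_le.
by rewrite mem_cat => /orP[/msuppZ_le /xk|/yk].
Qed.

Lemma F_0 k : F_ k 0.
Proof. by apply/F_P; rewrite rmorph0 msupp0. Qed.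

Lemma F_Z k c x : F_ k x -> F_ k (c *: x).
Proof. by move=> xk; rewrite -[_ *: _]addr0; apply: F_lin => //; exact: F_0. Qed.

Lemma F_N k x : F_ k x -> F_ k (- x).
Proof. by rewrite -scaleN1r; exact: F_Z. Qed.

Lemma F_M k l x y : F_ k x -> F_ l y -> F_ (k + l)%N (x * y).
Proof.
move=> /F_P xk /F_P yl; apply/F_P => m; rewrite rmorphM => /msuppM_le /allpairsP[[m1 m2] /= [m1x m2y ->]].
by apply: vconeD; [exact: xk|exact: yl].
Qed.

Lemma hcomp_sum x N : (msize (Psi x) <= N)%N -> x = \sum_(k < N) hcomp k x.
Proof.
move=> xN; apply: Psi_inj; rewrite rmorph_sum; apply/mpolyP => m; rewrite raddf_sum /=.
under eq_bigr => k _ do rewrite Psi_hcomp mcoeff_pihomog.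
have [mx|mx] := boolP (m \in msupp (Psi x)); last first.
  rewrite memN_msupp_eq0 // big1 // => k _; by case: ifP.
have [l ml] := Psi_supp mx; have lN : (l < N)%N.
  apply: leq_trans xN; apply: leq_ltn_trans (msize_mdeg_lt mx).
  by rewrite (vcone_mdeg ml) leq_pmulr.
rewrite (bigD1 (Ordinal lN)) //= (vcone_mdeg ml) eqxx big1 ?addr0 // => k kl.
rewrite eqn_pmul2r //; case: eqP => // lk.
by case/eqP: kl; apply: val_inj.
Qed.

Lemma toric_standard_graded : standard_graded F_.
Proof.
split.
- move=> k; split=> [|c x y]; [exact: F_0|exact: F_lin].
- split=> [x|m y yF sum0 i].
    exists (msize (Psi x)), (fun k => hcomp k x); split=> [k|]; first exact: F_hcomp.
    exact: hcomp_sum.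
  have := congr1 (hcomp i) sum0; rewrite hcomp0 (big_morph (hcomp i) (hcompD i) (hcomp0 i)).
  rewrite (bigD1 i) //= hcomp_id // big1 ?addr0 // => j ji.
  apply: Psi_inj; rewrite Psi_hcomp rmorph0; apply/mpolyP => z.
  rewrite mcoeff_pihomog mcoeff0; case: ifP => // /eqP zi; apply: memN_msupp_eq0.
  apply/negP => /(iffLR (F_P _ _) (yF j)) /vcone_mdeg; rewrite zi => /eqP.
  by rewrite eqn_pmul2r // => /eqP ij; case/eqP: ji; apply: val_inj.
- split; last by move=> i j x y; exact: F_M.
  apply/seteqP; split=> x.
    move=> /F_P x0; exists ((Psi x)@_0%MM) => //; apply: Psi_inj; rewrite Psi_alg.
    apply/mpolyP => m; rewrite mcoeffC; have [->|m0] := eqVneq m 0%MM; first by rewrite mulr1.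
    rewrite mulr0 memN_msupp_eq0 //; apply: contra m0 => /x0 /vcone_mdeg.
    by rewrite mul0n => /eqP; rewrite mdeg_eq0.
  move=> [c _ <-]; apply: F_Z; rewrite -xm0; apply: F_xm.
  by apply/vconeP; rewrite mdeg0; split=> // i; rewrite mnm0E.
- move=> k z /F_P zk.
  pose s := msupp (Psi z).
  have wP m : exists w, m \in s -> [/\ vcone 1 w, (w <= m)%MM & vcone k (m - w)%MM].
    have [ms|ms] := boolP (m \in s); last by exists 0%MM.
    by have [[w wP] _] := vcone_split d_gt0 (zk m ms); exists w.
  have [w {}wP] := choice wP; pose mi (i : 'I_(size s)) := (nth 0%MM s i).
  have mis i : mi i \in s by exact: mem_nth.
  exists (size s), (fun i => (Psi z)@_(mi i) *: xm (w (mi i))), (fun i => xm (mi i - w (mi i))%MM).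
  split=> [i|]; first by have [? ? ?] := wP _ (mis i); split; [apply: F_Z|]; exact: F_xm.
  rewrite [LHS]FE (big_nth 0%MM) big_mkord; apply: eq_bigr => i _.
  have [w1 wm mw] := wP _ (mis i); rewrite -scalerAl; congr (_ *: _).
  by rewrite -(xmD w1 mw) addmC submK.
- pose L := veronese_gens a d; exists (size L), (fun i => xm (nth 0%MM L i)) => x /F_P x1.
  exists (fun i => (Psi x)@_((nth 0%MM L i))); apply: Psi_inj; rewrite rmorph_sum.
  have Lu : uniq L.
    rewrite filter_uniq // filter_uniq // map_inj_uniq ?enum_uniq //.
    by move=> w w' ww'; apply: val_inj.
  apply/mpolyP => m; rewrite raddf_sum /=.
  have PE (i : 'I_(size L)) : (Psi ((Psi x)@_(nth 0%MM L i) *: xm (nth 0%MM L i)))@_m = (Psi x)@_(nth 0%MM L i) * ((nth 0%MM L i) == m)%:R.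
    by rewrite PsiZ (@Psi_xm 1) ?mcoeffZ ?mcoeffX // -mem_veronese mem_nth.
  under eq_bigr => i _ do rewrite PE.
  have [mx|mx] := boolP (m \in msupp (Psi x)).
    have mL : m \in L by rewrite mem_veronese x1.
    have iL : (index m L < size L)%N by rewrite index_mem.
    rewrite (bigD1 (Ordinal iL)) //= nth_index // eqxx mulr1 big1 ?addr0 // => i ii.
    case: eqP => [im|]; last by rewrite mulr0.
    by case/eqP: ii; apply: val_inj; rewrite /= -im index_uniq.
  rewrite memN_msupp_eq0 // big1 // => i _; case: eqP => [->|]; last by rewrite mulr0.
  by rewrite memN_msupp_eq0 ?mul0r.
Qed.

Lemma toric_reduced : reduced_ring F.
Proof.
move=> x k /(congr1 Psi); rewrite rmorphXn rmorph0 => /eqP; rewrite expf_eq0 => /andP[_ /eqP x0].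
by apply: Psi_inj; rewrite rmorph0.
Qed.

End ToricModel.

(** * Koszulness of the semigroup ring *)

Section ToricKoszul.
Variables (K : fieldType) (n d : nat) (a : 'I_n -> nat).
Hypothesis d_gt0 : (0 < d)%N.
Variables (F : comAlgType K) (F_ : nat -> set F) (Psi : {rmorphism F -> {mpoly K[n]}}).
Hypothesis FPsi : toric_model d a F_ Psi.
Local Notation S := {mpoly K[n]}.
Local Notation mon := 'X_{1..n}.
Local Notation vcone := (vcone d a).
Local Notation xm := (xm Psi).

Lemma gens_div_vcone k l (s : seq mon) m : {in s, forall u, vcone 1 u} -> vcone l m ->
  gens_div d a k s m -> l = k.+1.
Proof.
move=> s1 ml [u [us um muk]]; apply: (vcone_inj d_gt0 ml).
by rewrite -(submK um) -addn1; apply: vconeD => //; exact: s1.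
Qed.

Lemma lspan_xm (s : seq mon) (x : F) : {in s, forall u, vcone 1 u} ->
  lspan ([seq xm u | u <- s] : seq F^o) x <->
  {in msupp (Psi x), forall m, exists k, gens_div d a k s m}.
Proof.
move=> s1; split.
  move=> [c ->] m; rewrite rmorph_sum => /msupp_sum_le /flattenP[_ /mapP[i _ ->]].
  have si : (i < size s)%N by rewrite -(size_map xm).
  rewrite (nth_map 0%MM) // rmorphM /= (Psi_xm FPsi (s1 _ (mem_nth 0%MM si))).
  move=> /msuppM_le /allpairsP[[m1 m2] /= [/(Psi_supp FPsi)[k m1k]]].
  rewrite msuppX inE => /eqP -> ->; exists k, (nth 0%MM s i).
  by rewrite mem_nth // lem_addl addmK.
move=> xs; rewrite [x](FE FPsi) big_seq; apply: lspan_sum => m /xs[k [u [us um muk]]].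
rewrite -(submK um) (xmD FPsi muk (s1 _ us)).
have -> : (Psi x)@_(m - u + u) *: (xm (m - u)%MM * xm u) =
   ((Psi x)@_(m - u + u) *: xm (m - u)%MM) *: (xm u : F^o) by rewrite scalerAl.
by apply/lspanZ/lspan_mem/map_f.
Qed.

(** The flag [top] serves to include the irrelevant ideal, from which the resolution starts; the
    colon ideals all have [top] false. *)
Definition kfam (U : seq F) : Prop := exists (E D : pred 'I_n) rho top,
  injective rho /\ U = [seq xm u | u <- ulist d a E D rho top].

Lemma ulist1 E D rho top : {in ulist d a E D rho top, forall u, vcone 1 u}.
Proof. by move=> u; rewrite mem_ulist => /andP[]. Qed.

Lemma kfam_lin U : kfam U -> {in U, forall u, F_ 1%N u}.
Proof.
move=> [E [D [rho [top [_ ->]]]]] _ /mapP[u us ->].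
by apply: (F_xm FPsi); exact: ulist1 us.
Qed.

(** Multiplication by a monomial shifts supports, so the colon ideal can be determined one monomial
    at a time. *)
Lemma kfam_colon U : kfam U -> colon_in kfam (U : seq F^o).
Proof.
move=> [E [D [rho [top [rho_inj ->]]]]] k; rewrite size_map => ks.
have [E' [D' [rho' [rho'_inj colP]]]] := ulist_colon d_gt0 rho_inj ks.
exists [seq xm u | u <- ulist d a E' D' rho' false]; first by exists E', D', rho', false.
move=> x; rewrite -map_take (nth_map 0%MM) //.
set s := ulist d a E D rho top in ks colP *; set v := nth 0%MM s k.
have v1 : vcone 1 v by apply: (@ulist1 E D rho top); exact: mem_nth.
have t1 : {in take k s, forall u, vcone 1 u} by move=> u /mem_take; exact: ulist1.
rewrite !lspan_xm //; last exact: ulist1.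
have suppE m : (m + v)%MM \in msupp (Psi (x * xm v)) = (m \in msupp (Psi x)).
  by rewrite !mcoeff_msupp rmorphM /= (Psi_xm FPsi v1) addmC mcoeffMX.
split=> H m.
  move=> mx; have [l ml] := Psi_supp FPsi mx.
  have mvl : vcone l.+1 (m + v)%MM by rewrite -addn1; exact: vconeD.
  have [|k' mk'] := H (m + v)%MM; first by rewrite suppE.
  have [lk'] := gens_div_vcone t1 mvl mk'; subst k'.
  by have [l' _ ml'] := iffLR (colP l m ml) mk'; exists l'.
rewrite [x *: _]/(x * _) rmorphM /= (Psi_xm FPsi v1) (perm_mem (msuppMX _ _)) => /mapP[m' m'x ->].
have [l ml] := Psi_supp FPsi m'x; have [l' m'l'] := H m' m'x.
have ll' := gens_div_vcone (@ulist1 E' D' rho' false) ml m'l'.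
by exists l; rewrite addmC; apply/(colP l m' ml); exists l'.
Qed.

Lemma toric_koszul : koszul F_.
Proof.
split; first exact: (toric_standard_graded d_gt0 FPsi).
pose U0 := [seq xm u | u <- ulist d a pred0 pred0 (@nat_of_ord n) true].
have mem0 u : (u \in ulist d a pred0 pred0 (@nat_of_ord n) true) = vcone 1 u.
  by rewrite mem_ulist /uset andbT.
apply: (koszul_resolution (p1 := hcomp d Psi 1) (p2 := hcomp d Psi 2) _ _ _ _ _ _ _
  kfam_lin kfam_colon (U0 := U0)).
- by move=> x; exact: (F_hcomp d_gt0 FPsi).
- exact: (F_0 FPsi).
- by move=> x; exact: (F_N FPsi).
- exact: (hcompD FPsi).
- exact: (hcomp0 FPsi).
- by move=> x y x1 y1; rewrite (hcomp_id FPsi) //; exact: (F_M FPsi x1 y1).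
- by move=> x y y1; exact: (hcompM FPsi 1 x y1).
- by exists pred0, pred0, (@nat_of_ord n), true; split=> //; exact: val_inj.
move=> x; rewrite (lspan_xm x (@ulist1 _ _ _ _)); split.
  move=> [r [c [g [gF ->]]]] m; rewrite rmorph_sum => /msupp_sum_le /flattenP[_ /mapP[i _ ->]].
  rewrite rmorphM => /msuppM_le /allpairsP[[m1 m2] /= [/(Psi_supp FPsi)[k m1k] m2g ->]].
  have [j _ /(F_P FPsi) gj] := gF i.
  have mkj := vconeD m1k (gj _ m2g); rewrite addnS in mkj.
  have [[w [w1 wm mw]] _] := vcone_split d_gt0 mkj.
  by exists (k + j)%N, w; rewrite mem0.
move=> xs; rewrite /graded_irrelevant [x](FE FPsi) big_seq; apply: ideal_gen_sum => m mx.
have [k [u [us um muk]]] := xs m mx.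
have u1 : vcone 1 u by rewrite -mem0.
rewrite -(submK um) (xmD FPsi muk u1) scalerAl; apply: ideal_genMl; apply: ideal_gen_sub; exists 0%N => //.
exact: (F_xm FPsi u1).
Qed.

End ToricKoszul.

(** * Normality *)

Section ClassicalDomain.
Variables (A : comNzRingType) (domA : GRing.integral_domain_axiom A).

(* A with units and inverses chosen classically *)
Definition cdom : Type := let _ := domA in A.
HB.instance Definition _ := GRing.ComNzRing.on cdom.

Definition cunit : {pred cdom} := [pred x : cdom | `[< exists y : cdom, y * x = 1 >]].
Definition cinv (x : cdom) : cdom :=
  if pselect (exists y : cdom, y * x = 1) is left e then projT1 (cid e) else x.

Fact cmulVx : {in cunit, left_inverse 1 cinv *%R}.
Proof.
move=> x /asboolP xu; rewrite /cinv; case: pselect => // e.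
exact: projT2 (cid e).
Qed.
Fact cunitPl (x y : cdom) : y * x = 1 -> cunit x.
Proof. by move=> yx; apply/asboolP; exists y. Qed.
Fact cinv_out : {in [predC cunit], cinv =1 id}.
Proof. by move=> x xu; rewrite /cinv; case: pselect => // e; case/asboolP: xu. Qed.
HB.instance Definition _ := GRing.ComNzRing_hasMulInverse.Build cdom cmulVx cunitPl cinv_out.
HB.instance Definition _ := GRing.ComUnitRing_isIntegral.Build cdom domA.

End ClassicalDomain.

Lemma fractionP (R : idomainType) (x : {fraction R}) :
  exists f g : R, g != 0 /\ x * tofrac g = tofrac f.
Proof.
have [r ->] : exists r : {ratio R}, x = (\pi_(FracField.type R) r)%qT.
  by exists (repr x)%qT; rewrite reprK.
exists (\n_r), (\d_r); split; first exact: denom_ratioP.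
rewrite -[_ * _]/(FracField.mul _ _) !piE; apply/eqmodP => /=.
by rewrite FracField.equivfE /FracField.mulf !numden_Ratio ?oner_neq0 ?mulr1 ?denom_ratioP // mulrC.
Qed.

(** With N the degree of an integral equation of x, the power g^N clears the denominators of x^M for
    M up to N; higher powers reduce to these by the equation. *)
Lemma integral_common_denominator (R : idomainType) (x : {fraction R}) g :
  g != 0 -> (exists f, x * tofrac g = tofrac f) -> integralOver (@tofrac R) x ->
  exists2 h, h != 0 & forall M, exists r, tofrac h * x ^+ M = tofrac r.
Proof.
move=> g0 [f xgf] [p pmon px].
pose N := (size p).-1.
exists (g ^+ N); first exact: expf_neq0.
have low M : (M <= N)%N -> exists r, tofrac (g ^+ N) * x ^+ M = tofrac r.
  move=> MN; exists (g ^+ (N - M) * f ^+ M).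
  by rewrite -{1}(subnK MN) exprD !rmorphM /= !rmorphXn /= -xgf exprMn; ring.
elim/ltn_ind => M IH; have [/low //|NM] := leqP M N.
have xN : x ^+ N = - \sum_(i < N) tofrac p`_i * x ^+ i.
  have sp : size p = N.+1 by rewrite /N prednK // lt0n size_poly_eq0 monic_neq0.
  have /eqP := px; rewrite horner_coef size_map_poly_id0; last first.
    by rewrite (monicP pmon) rmorph1 oner_neq0.
  rewrite sp big_ord_recr /= => /eqP; rewrite coef_map /=.
  have -> : p`_N = 1 by have := monicP pmon; rewrite lead_coefE.
  rewrite rmorph1 mul1r addrC; rewrite addr_eq0 => /eqP ->; congr (- _).
  by apply: eq_bigr => i _; rewrite coef_map.
have /choice[r rE] (i : 'I_N) : exists r, tofrac (g ^+ N) * x ^+ (M - N + i) = tofrac r.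
  by apply: IH; have := ltn_ord i; lia.
exists (- \sum_(i < N) p`_i * r i).
rewrite rmorphN rmorph_sum -{1}(subnK (ltnW NM)) exprD xN mulrN mulrN; congr (- _).
rewrite !mulr_sumr; apply: eq_bigr => i _.
by rewrite rmorphM /= -rE exprD; ring.
Qed.

Lemma integral_sub_tofrac (R : idomainType) (x : {fraction R}) r :
  integralOver (@tofrac R) x -> integralOver (@tofrac R) (x - tofrac r).
Proof.
pose iota : {rmorphism R -> {fraction R}} := @tofrac R.
by move=> xint; exact: (@integral_sub R _ iota x (iota r) xint (integral_id iota r)).
Qed.

Section ToricNormal.
Variables (K : fieldType) (n d : nat) (a : 'I_n -> nat).
Hypothesis d_gt0 : (0 < d)%N.
Variables (F : comAlgType K) (F_ : nat -> set F) (Psi : {rmorphism F -> {mpoly K[n]}}).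
Hypothesis FPsi : toric_model d a F_ Psi.
Local Notation S := {mpoly K[n]}.
Local Notation mon := 'X_{1..n}.
Local Notation vcone := (vcone d a).

Lemma toric_integral : GRing.integral_domain_axiom F.
Proof.
move=> x y /(congr1 Psi) /eqP; rewrite rmorphM rmorph0 mulf_eq0.
by rewrite -(rmorph0 Psi) !(inj_eq (Psi_inj FPsi)).
Qed.

Local Notation R := (cdom toric_integral).

Lemma Psi_neq0 (x : F) : (Psi x != 0) = (x != 0).
Proof. by rewrite -(rmorph0 Psi) (inj_eq (Psi_inj FPsi)). Qed.

(* Comparing leading exponents in h f^M = g^M r_M for all M. *)
Lemma almost_integral_lead (f g h : F) : f != 0 -> g != 0 -> h != 0 ->
  (forall M, exists r, h * f ^+ M = g ^+ M * r) ->
  exists k e, vcone k e /\ mlead (Psi f) = (mlead (Psi g) + e)%MM.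
Proof.
rewrite -!Psi_neq0 => f0 g0 h0 H.
set lf := mlead (Psi f); set lg := mlead (Psi g); set lh := mlead (Psi h).
have lead M : exists k c, vcone k c /\ (lh + lf *+ M = lg *+ M + c)%MM.
  have [r rE] := H M; have rE' := congr1 Psi rE; rewrite !rmorphM !rmorphXn /= in rE'.
  have r0 : Psi r != 0.
    by apply: contra_neq (mulf_neq0 h0 (expf_neq0 M f0)); rewrite rE' => ->; rewrite mulr0.
  have [k kr] := Psi_supp FPsi (mlead_supp r0).
  exists k, (mlead (Psi r)); split=> //.
  have := congr1 (@mlead n K) rE'.
  by rewrite !mleadM ?expf_neq0 // !mleadX.
have le_gf i : (lg i <= lf i)%N.
  (* If lf_i were below lg_i, the deficit in the M-th relation would be at least M, more than lh_i
     can make up. *)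
  have [k [c [_ /(congr1 (fun m : mon => m i))]]] := lead (lh i).+1.
  by rewrite !mnmDE !mulmnE; nia.
pose e := (lf - lg)%MM.
have lfE : lf = (lg + e)%MM by rewrite addmC submK //; apply/mnm_lepP.
have lead' M : exists k, vcone k (lh + e *+ M)%MM.
  have [k [c [kc cE]]] := lead M; exists k; suff -> : (lh + e *+ M)%MM = c by [].
  apply/mnmP => i; have := congr1 (fun m : mon => m i) cE.
  by rewrite lfE !mnmDE !mulmnE mnmDE; nia.
have [kh /vconeP[kh1 kh2]] := lead' 0%N; have [k1 /vconeP[k11 k12]] := lead' 1%N.
rewrite mulm0n addm0 in kh1 kh2; rewrite mulm1n mdegD kh1 in k11.
exists (k1 - kh)%N, e; split=> //; apply/vconeP.
have ed : mdeg e = ((k1 - kh) * d)%N by rewrite mulnBl -k11 addKn.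
split=> // i; rewrite leqNgt; apply/negP => ei.
(* An excess of at least 1 in e_i accumulates to M, which exceeds the slack kh a_i left by the
   exponent of h. *)
pose M := (kh * a i).+1.
have [kM /vconeP[kM1 kM2]] := lead' M; move: kM1; rewrite mdegD kh1 mdegMn ed mulnAC -mulnDl.
move/eqP; rewrite eqn_pmul2r // => /eqP kME; have := kM2 i.
by rewrite -kME mnmDE mulmnE /M; nia.
Qed.

Lemma lead_reduce (f g : F) k e : f != 0 -> g != 0 -> vcone k e ->
  mlead (Psi f) = (mlead (Psi g) + e)%MM ->
  exists y : F, f - y * g = 0 \/ (mlead (Psi (f - y * g)) < mlead (Psi f))%O.
Proof.
rewrite -!Psi_neq0 => f0 g0 ke fE.
have gl : (Psi g)@_(mlead (Psi g)) != 0 by rewrite mleadc_eq0.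
pose c := (Psi f)@_(mlead (Psi f)) / (Psi g)@_(mlead (Psi g)).
have c0 : c != 0 by rewrite mulf_neq0 ?invr_eq0 // mleadc_eq0.
exists (c *: xm Psi e); set f' := f - _.
have [->|f'0] := eqVneq f' 0; [by left|right].
have Pf' : Psi f' = Psi f - c *: 'X_[e] * Psi g.
  by rewrite rmorphB rmorphM /= (PsiZ FPsi) (Psi_xm FPsi ke).
have leq : mlead (c *: 'X_[e] * Psi g) = mlead (Psi f).
  rewrite mleadM // ?mleadZ_proper ?mleadXm ?fE 1?addmC //.
  - by rewrite mcoeffX eqxx mulr1.
  - by rewrite -msupp_eq0 msuppMCX.
rewrite lt_neqAle; apply/andP; split; last first.
  by rewrite Pf'; apply: le_trans (mleadB_le _ _) _; rewrite leq joinxx.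
apply/eqP => e'; have : (Psi f')@_(mlead (Psi f')) != 0 by rewrite mleadc_eq0 Psi_neq0.
rewrite e' Pf' mcoeffB -scalerAl mcoeffZ [X in _ * X](_ : _ = (Psi g)@_(mlead (Psi g))).
  by rewrite /c mulfVK // subrr eqxx.
by rewrite fE mulrC addmC mcoeffMX.
Qed.

Lemma toric_normal : normal_domain F.
Proof.
exists R, (idfun : {rmorphism F -> F}); split; first by exists id.
move=> x xint.
have [f [g [g0 xgf]]] := fractionP x.
suff H : forall (m : mon) (f : R) (x : {fraction R}), (mlead (Psi f) <= m)%O -> x * tofrac g = tofrac f ->
    integralOver (@tofrac R) x -> exists r : R, x = tofrac r by exact: H (lexx _) xgf xint.
(* Induction on the leading exponent of the numerator, with x varying: subtracting an element of R
   keeps x integral and the denominator g. *)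
elim/(well_founded_ind (@ltom_wf n)) => m IH {}f {}x fm {}xgf {}xint.
have fr0 (y : {fraction R}) : y * tofrac g = 0 -> y = 0.
  by move=> /eqP; rewrite mulf_eq0 tofrac_eq0 (negbTE g0) orbF => /eqP.
have [f0|f0] := eqVneq f 0.
  by exists 0; rewrite rmorph0; apply: fr0; rewrite xgf f0 rmorph0.
have [h h0 hP] := integral_common_denominator g0 (ex_intro _ f xgf) xint.
have lin M : exists r, h * f ^+ M = g ^+ M * r :> F.
  have [r rE] := hP M; exists r; apply/eqP; rewrite -(@tofrac_eq R) !rmorphM !rmorphXn /= -xgf.
  by rewrite exprMn mulrA rE mulrC.
have [k [e [ke fE]]] := almost_integral_lead f0 g0 h0 lin.
have [y0 yP] := lead_reduce f0 g0 ke fE; pose y : R := y0.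
pose f' : R := f - y * g.
have f'E : (x - tofrac y) * tofrac g = tofrac f'.
  by rewrite mulrBl xgf -tofracM -tofracB.
have xint' : integralOver (@tofrac R) (x - tofrac y).
  exact: integral_sub_tofrac xint.
suff [r rE] : exists r : R, x - tofrac y = tofrac r.
  by exists (r + y); rewrite tofracD -rE subrK.
have {yP}[f'0|f'lt] : f' = 0 \/ (mlead (Psi f') < mlead (Psi f))%O by exact: yP.
  by exists 0; rewrite rmorph0; apply: fr0; rewrite f'E f'0 rmorph0.
by apply: (IH (mlead (Psi f'))) f'E xint' => //; exact: lt_le_trans fm.
Qed.

End ToricNormal.

(** * Noetherianity *)

(** Repeatedly pass to an index where [h] is minimal among all later ones. *)
Lemma nondecreasing_subsequence (h : nat -> nat) : exists g : nat -> nat,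
  (forall k, g k < g k.+1)%N /\ (forall k, h (g k) <= h (g k.+1))%N.
Proof.
have /choice[mu muP] (N : nat) : exists m, (N <= m)%N /\ forall m', (N <= m')%N -> (h m <= h m')%N.
  have ex : exists v, `[< exists2 m, (N <= m)%N & h m = v >].
    by exists (h N); apply/asboolP; exists N.
  case: (ex_minnP ex) => v /asboolP[m Nm <-] vmin; exists m; split=> // m' Nm'.
  by apply: vmin; apply/asboolP; exists m'.
pose g := fix g k := if k is j.+1 then mu (g j).+1 else mu 0%N.
have gS k : (g k < g k.+1)%N by exact: (muP (g k).+1).1.
exists g; split=> // -[|k]; first exact: (muP 0%N).2.
by apply: (muP (g k).+1).2; apply: (leq_trans (gS k)); exact: ltnW (gS k.+1).
Qed.

Lemma lt_strict_mono (g : nat -> nat) : (forall k, g k < g k.+1)%N ->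
  {homo g : i j / (i < j)%N}.
Proof. by move=> gS; exact: (homo_ltn ltn_trans). Qed.

Lemma dickson_seq q (f : nat -> 'X_{1..q}) : exists i j, (i < j)%N /\ (f i <= f j)%MM.
Proof.
have H (r : seq 'I_q) : exists g : nat -> nat, (forall k, g k < g k.+1)%N /\
    forall x, x \in r -> forall k, (f (g k) x <= f (g k.+1) x)%N.
  elim: r => [|x r [g [gS gr]]]; first by exists id.
  have [g' [g'S g'x]] := nondecreasing_subsequence (fun k => f (g k) x).
  exists (g \o g'); split=> [k|y]; first exact: (lt_strict_mono gS (g'S k)).
  rewrite inE => /orP[/eqP -> //|yr k] /=.
  have mono : {homo (fun k => f (g k) y) : i j / (i <= j)%N}.
    exact: (homo_leq leqnn leq_trans (gr _ yr)).
  by apply: mono; exact: ltnW.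
have [g [gS gr]] := H (enum 'I_q).
exists (g 0%N), (g 1%N); split=> //; apply/mnm_lepP => x; apply: gr.
by rewrite mem_enum.
Qed.

(** Otherwise one can keep choosing elements of [U] that lie above none of those chosen before, and
    the resulting sequence contradicts [dickson_seq]. *)
Lemma dickson q (U : 'X_{1..q} -> Prop) : exists s : seq 'X_{1..q},
  (forall u, u \in s -> U u) /\ forall u, U u -> exists2 v, v \in s & (v <= u)%MM.
Proof.
apply: contrapT => H.
have /choice[nx nxP] (s : seq 'X_{1..q}) : exists u, (forall v, v \in s -> U v) ->
    U u /\ forall v, v \in s -> ~~ (v <= u)%MM.
  apply: contrapT => H1; apply: H; exists s; split=> [u us|u Uu].
    by apply: contrapT => nU; apply: H1; exists 0%MM => /(_ u us).
  apply: contrapT => H2; apply: H1; exists u => _; split=> // v vs; apply/negP => vu.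
  by apply: H2; exists v.
pose l := fix l k := if k is j.+1 then nx (l j) :: l j else [::].
have lU k : forall v, v \in l k -> U v.
  elim: k => [|k IH] v //=; rewrite inE => /orP[/eqP ->|/IH //].
  by have [] := nxP _ IH.
have [i [j [ij fij]]] := dickson_seq (fun k => nx (l k)).
have := (nxP _ (@lU j)).2 (nx (l i)); rewrite fij => /(_ _)/negP; apply=> //.
elim: j ij {fij} => // j IH; rewrite ltnS leq_eqVlt => /orP[/eqP <-|/IH ij] /=; rewrite inE ?eqxx //.
by rewrite ij orbT.
Qed.

Section ToricNoetherian.
Variables (K : fieldType) (n d : nat) (a : 'I_n -> nat).
Hypothesis d_gt0 : (0 < d)%N.
Variables (F : comAlgType K) (F_ : nat -> set F) (Psi : {rmorphism F -> {mpoly K[n]}}).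
Hypothesis FPsi : toric_model d a F_ Psi.
Local Notation mon := 'X_{1..n}.
Local Notation vcone := (vcone d a).
Let L := veronese_gens a d.

Definition gexp (al : 'X_{1..(size L)}) : mon := (\sum_(i < size L) nth 0%MM L i *+ al i)%MM.

Lemma gexpD al be : gexp (al + be)%MM = (gexp al + gexp be)%MM.
Proof.
rewrite /gexp -big_split; apply: eq_bigr => i _; rewrite mnmDE.
by apply/mnmP => x; rewrite mnmDE !mulmnE mulnDr.
Qed.

Lemma gexp1 i : gexp U_(i) = nth 0%MM L i.
Proof.
rewrite /gexp (bigD1 i) //= mnm1E eqxx mulm1n big1 ?addm0 // => j /negbTE ji.
by rewrite mnm1E eq_sym ji mulm0n.
Qed.

Lemma vcone_gexp al : vcone (mdeg al) (gexp al).
Proof.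
have H k : forall al : 'X_{1..(size L)}, mdeg al = k -> vcone k (gexp al).
  elim: k => [|k IH] be bek.
    move/eqP: bek; rewrite mdeg_eq0 => /eqP ->; rewrite /gexp big1 => [|i _].
      by apply/vconeP; rewrite mdeg0; split=> // i; rewrite mnm0E.
    by rewrite mnm0E mulm0n.
  have [i [be' beE]] : exists i be', be = (U_(i) + be')%MM.
    by apply: mdeg_pos_split; rewrite bek.
  rewrite beE gexpD gexp1 -add1n; apply: vconeD.
    by rewrite -mem_veronese mem_nth.
  by apply: IH; move: bek; rewrite beE mdegD mdeg1 => -[].
exact: H.
Qed.

Lemma gexp_surj k m : vcone k m -> exists al, gexp al = m.
Proof.
move=> /(gsum_vcone a d_gt0); elim: k m => [|k IH] m.
  move/gsum0P ->; exists 0%MM; rewrite /gexp big1 // => i _; by rewrite mnm0E mulm0n.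
move=> /gsumS[u [m' [uL /IH[al <-] ->]]].
have iL : (index u L < size L)%N by rewrite index_mem.
by exists (U_(Ordinal iL) + al)%MM; rewrite gexpD gexp1 nth_index.
Qed.

(** Divisibility in C is not the coordinatewise order on exponents, so Dickson's lemma is applied to
    the exponents of products of generators, which [gexp] maps onto C. Division by elements with the
    resulting leading exponents then reduces every element of the ideal to 0. *)
Lemma toric_noetherian : noetherian F.
Proof.
move=> P [/= P0 _ Plin].
pose U al := exists f : F, [/\ P f, f != 0 & mlead (Psi f) = gexp al].
have [s [sU sP]] := dickson U.
have /choice[b bP] al : exists f : F, al \in s -> [/\ P f, f != 0 & mlead (Psi f) = gexp al].
  by have [/sU[f fP]|_] := boolP (al \in s); [exists f|exists 0].
exists [seq b al | al <- s]; apply/seteqP; split=> f; last first.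
  move=> [m [c [g [gs ->]]]].
  have PD x y : P x -> P y -> P (x + y).
    by move=> Px Py; have := Plin 1 x y (mem_set Px) (mem_set Py); rewrite mul1r => /set_mem.
  have PM x y : P y -> P (x * y).
    by move=> Py; have := Plin x y 0 (mem_set Py) P0; rewrite addr0 => /set_mem.
  apply: big_ind => // [|i _]; first exact: (set_mem P0).
  apply: PM; have /mapP[al als ->] := gs i.
  by have [] := bP al als.
suff H : forall (m : mon) f, P f -> (mlead (Psi f) <= m)%O -> ideal_gen [set` [seq b al | al <- s]] f.
  by move=> Pf; exact: H Pf (lexx _).
elim/(well_founded_ind (@ltom_wf n)) => m IH {}f Pf fm.
have [->|f0] := eqVneq f 0; first exact: ideal_gen0.
have Pf0 : Psi f != 0 by rewrite (Psi_neq0 FPsi).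
have [k kf] := Psi_supp FPsi (mlead_supp Pf0); have [al alE] := gexp_surj kf.
have [be bes beal] : exists2 v, v \in s & (v <= al)%MM by apply: sP; exists f.
have [Pb b0 bE] := bP _ bes.
have fE : mlead (Psi f) = (mlead (Psi (b be)) + gexp (al - be))%MM.
  by rewrite bE -gexpD addmC submK // alE.
have [y yP] := lead_reduce FPsi f0 b0 (vcone_gexp _) fE.
rewrite -(subrK (y * b be) f); apply: ideal_genD; last first.
  by apply: ideal_genMl; apply: ideal_gen_sub; exact: map_f.
case: yP => [->|lt]; first exact: ideal_gen0.
apply: (IH _ _ _ _ (lexx _)); first exact: lt_le_trans fm.
have := Plin (- y) (b be) f (mem_set Pb) (mem_set Pf).
by rewrite mulNr addrC => /set_mem.
Qed.

End ToricNoetherian.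

(** * Algebraic dependence *)

Section AlgebraicDependence.
Variables (K : fieldType) (A : comAlgType K).

(** A nontrivial polynomial relation; the common bound [N] on the exponents turns it into a finite
    sum. *)
Definition alg_dep h (x : 'I_h -> A) : Prop :=
  exists N (Q : {ffun 'I_h -> 'I_N} -> K),
    (exists al, Q al != 0) /\ \sum_al Q al *: \prod_i x i ^+ al i = 0.

Definition ideal_like (P : set A) : Prop :=
  [/\ P 0, forall x y, P x -> P y -> P (x + y) & forall c x, P x -> P (c * x)].

Lemma ideal_likeB P x y : ideal_like P -> P x -> P y -> P (x - y).
Proof. by move=> [_ PD PM] Px Py; apply: PD => //; rewrite -mulN1r; exact: PM. Qed.

Lemma ideal_like_sum P (T : Type) (r : seq T) (Q : pred T) (f : T -> A) : ideal_like P ->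
  (forall i, Q i -> P (f i)) -> P (\sum_(i <- r | Q i) f i).
Proof. by move=> [P0 PD _] Pf; apply: big_ind. Qed.

(* The part of a relation that is lexicographically smallest survives
   dividing by x_s and reducing modulo x_s, one s after the other. *)
Lemma alg_dep_chain h (x : 'I_h -> A) (I : nat -> set A) :
  (forall s, ideal_like (I s)) -> (forall s, I s `<=` I s.+1) ->
  (forall (s : 'I_h) y, I s (x s * y) -> I s y) ->
  (forall s : 'I_h, I s.+1 (x s)) -> ~ I h 1 -> ~ alg_dep x.
Proof.
move=> Iid Isub Inzd Ix I1 [N [Q0 [Q0n0 Q00]]].
(* After s rounds the exponents of the first s variables are constant on the surviving terms, these
   variables have been divided out, and the relation holds modulo [I s]. *)
suff H s : (s <= h)%N -> exists Q : {ffun 'I_h -> 'I_N} -> K,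
    [/\ exists al, Q al != 0,
        exists be : 'I_h -> nat, forall al, Q al != 0 -> forall i : 'I_h, (i < s)%N -> al i = be i :> nat &
        I s (\sum_al Q al *: \prod_(i < h | (s <= i)%N) x i ^+ al i)].
  have [Q [[al Qal] [be Qbe] IQ]] := H h (leqnn h).
  apply: I1; have [_ _ IM] := Iid h.
  have -> : 1 = (Q al)^-1%:A * (\sum_al Q al *: \prod_(i < h | (h <= i)%N) x i ^+ al i).
    rewrite (bigD1 al) //= [X in _ + X]big1 ?addr0; last first.
      move=> al' al'al; have [->|Qal'] := eqVneq (Q al') 0; first by rewrite scale0r.
      case/eqP: al'al; apply/ffunP => i; apply: val_inj => /=.
      by rewrite (Qbe _ Qal' i (ltn_ord i)) (Qbe _ Qal i (ltn_ord i)).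
    rewrite big1 => [|i]; last by rewrite leqNgt ltn_ord.
    by rewrite mulr_algl scalerA mulVf // scale1r.
  exact: IM.
elim: s => [_|s IH sh].
  exists Q0; split=> //; first by exists (fun=> 0%N).
  have -> : \sum_al Q0 al *: \prod_(i < h | (0 <= i)%N) x i ^+ al i = 0 by exact: Q00.
  by case: (Iid 0%N).
have [Q [[al0 Qal0] [be Qbe] IQ]] := IH (ltnW sh); pose o := Ordinal sh.
(* With m the least exponent of x_s, the factor x_s^m can be cancelled modulo [I s]; the terms in
   which x_s remains then vanish modulo [I s.+1]. *)
have [al1 Qal1 al1min] := @arg_minnP _ al0 (fun al => Q al != 0) (fun al : {ffun 'I_h -> 'I_N} => val (al o)) Qal0.
set m := val (al1 o) in al1min.
pose Q' (al : {ffun 'I_h -> 'I_N}) := if val (al o) == m then Q al else 0.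
have Q'Q al : Q' al != 0 -> Q al != 0 /\ val (al o) = m.
  rewrite /Q'; have [alm|_] := eqVneq (val (al o)) m; first by move=> ?.
  by rewrite eqxx.
exists Q'; split.
- by exists al1; rewrite /Q' eqxx.
- exists (fun i => val (al1 i)) => al /Q'Q[Qal alm] i; rewrite ltnS leq_eqVlt => /orP[/eqP ie|il].
    by have -> : i = o by apply: val_inj.
  exact: etrans (Qbe _ Qal _ il) (esym (Qbe _ Qal1 _ il)).
pose T := \sum_al Q al *: (x o ^+ (al o - m) * \prod_(i < h | (s.+1 <= i)%N) x i ^+ al i).
have prodS (al : {ffun 'I_h -> 'I_N}) : \prod_(i < h | (s <= i)%N) x i ^+ al i =
    x o ^+ al o * \prod_(i < h | (s.+1 <= i)%N) x i ^+ al i.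
  rewrite (bigD1 o) //=; congr (_ * _); apply: eq_bigl => i.
  by rewrite [in RHS]ltn_neqAle andbC eq_sym.
have IT : I s T.
  have : I s (x o ^+ m * T).
    suff <- : \sum_al Q al *: \prod_(i < h | (s <= i)%N) x i ^+ al i = x o ^+ m * T by [].
    rewrite /T mulr_sumr; apply: eq_bigr => al _; rewrite prodS -scalerAr mulrA -exprD.
    have [->|Qal] := eqVneq (Q al) 0; first by rewrite !scale0r.
    by rewrite subnKC // al1min.
  elim: (m) => [|k IHk]; first by rewrite mul1r.
  by rewrite exprS -mulrA => /(Inzd o).
pose p (al : {ffun 'I_h -> 'I_N}) := val (al o) == m.
pose f (al : {ffun 'I_h -> 'I_N}) :=
  Q al *: (x o ^+ (al o - m) * \prod_(i < h | (s.+1 <= i)%N) x i ^+ al i).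
have TE : T = \sum_(al | p al) f al + \sum_(al | ~~ p al) f al by rewrite /T (bigID p).
have -> : \sum_al Q' al *: \prod_(i < h | (s < i)%N) x i ^+ al i = T - \sum_(al | ~~ p al) f al.
  rewrite TE addrK (bigID p) /= [X in _ + X]big1 ?addr0.
    apply: eq_bigr => al alm; rewrite /Q' /f; move: (alm); rewrite /p => ->; congr (_ *: _).
    by move/eqP: alm => /= ->; rewrite subnn mul1r.
  by move=> al /negbTE alm; rewrite /Q' -/(p al) alm scale0r.
apply: ideal_likeB => //; first exact: Isub.
apply: ideal_like_sum => // al alm; rewrite /f; have [_ _ IM] := Iid s.+1.
have [->|Qal] := eqVneq (Q al) 0; first by rewrite scale0r; case: (Iid s.+1).
have mal : (m < al o)%N by rewrite ltn_neqAle eq_sym alm al1min.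
rewrite -(@subnSK m (al o)) // exprS -mulrA scalerAr -scalerAr scalerAl mulrC.
by rewrite -scalerAr scalerAl; apply: IM; exact: (Ix o).
Qed.

End AlgebraicDependence.

Lemma linear_dependence (K : fieldType) (I : finType) p (M : I -> 'I_p -> K) : (p < #|I|)%N ->
  exists Q : I -> K, (exists i, Q i != 0) /\ forall j, \sum_i Q i * M i j = 0.
Proof.
move=> pI; pose B : 'M[K]_(#|I|, p) := \matrix_(i, j) M (enum_val i) j.
have /rowV0Pn[v /sub_kermxP vB v0] : kermx B != 0.
  rewrite -mxrank_eq0 mxrank_ker subn_eq0 -ltnNge; exact: leq_ltn_trans (rank_leq_col B) pI.
exists (fun i => v 0 (enum_rank i)); split.
  have /rV0Pn[j vj] := v0.
  by exists (enum_val j); rewrite enum_valK.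
move=> j; have := congr1 (fun w : 'rV[K]_p => w 0 j) vB; rewrite !mxE => e; rewrite -[RHS]e.
rewrite (reindex (@enum_val I I)) /=; last exact: onW_bij (enum_val_bij I).
by apply: eq_bigr => i _; rewrite mxE enum_valK.
Qed.

Section ToricDependence.
Variables (K : fieldType) (n d : nat) (a : 'I_n -> nat).
Hypothesis d_gt0 : (0 < d)%N.
Variables (F : comAlgType K) (F_ : nat -> set F) (Psi : {rmorphism F -> {mpoly K[n]}}).
Hypothesis FPsi : toric_model d a F_ Psi.
Local Notation mon := 'X_{1..n}.
Local Notation vcone := (vcone d a).

(** Polynomial growth, of degree r in k, of the number of points of C up to degree k. *)
Definition cone_bound r : Prop := exists D, forall k, exists s : seq mon,
  (size s <= (D * k).+1 ^ r)%N /\ forall j m, (j <= k)%N -> vcone j m -> m \in s.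

Definition bdeg k (x : F) : Prop :=
  {in msupp (Psi x), forall m, exists2 j, (j <= k)%N & vcone j m}.

Lemma bdeg_ex x : exists k, bdeg k x.
Proof.
exists (msize (Psi x)) => m mx; have [j mj] := Psi_supp FPsi mx; exists j => //.
apply: ltnW; apply: leq_ltn_trans (msize_mdeg_lt mx).
by rewrite (vcone_mdeg mj) leq_pmulr.
Qed.

Lemma bdeg_le k l x : (k <= l)%N -> bdeg k x -> bdeg l x.
Proof. by move=> kl xk m /xk[j jk mj]; exists j => //; exact: leq_trans kl. Qed.

Lemma bdegM k l x y : bdeg k x -> bdeg l y -> bdeg (k + l) (x * y).
Proof.
move=> xk yl m; rewrite rmorphM => /msuppM_le /allpairsP[[m1 m2] /= [/xk[i ik m1i] /yl[j jl m2j] ->]].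
by exists (i + j)%N; [exact: leq_add|exact: vconeD].
Qed.

Lemma bdeg1 : bdeg 0 1.
Proof.
move=> m; rewrite rmorph1 msupp1 inE => /eqP ->; exists 0%N => //.
by apply/vconeP; rewrite mdeg0; split=> // i; rewrite mnm0E.
Qed.

Lemma bdegX k x e : bdeg k x -> bdeg (e * k) (x ^+ e).
Proof.
move=> xk; elim: e => [|e IH]; first exact: bdeg1.
by rewrite exprS mulSn; exact: bdegM.
Qed.

(** Counting: there are N^(r+1) monomials in the x_i with exponents below N, and they lie in a space
    of dimension at most (N B)^r, where B depends only on the degrees of the x_i. Taking N = B^r + 1
    makes the first number larger. *)
Lemma toric_alg_dep r (x : 'I_r.+1 -> F) : cone_bound r -> alg_dep x.
Proof.
move=> [D bound].
have /choice[e eP] i := bdeg_ex (x i).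
pose E := (\max_i e i)%N.
have xE i : bdeg E (x i) by apply: bdeg_le (eP i); exact: leq_bigmax.
pose B := (D * (r.+1 * E)).+1; pose N := (B ^ r).+1.
have [s [ss sP]] := bound (r.+1 * (N * E))%N.
exists N.
have lt_s : (size s < #|{: {ffun 'I_r.+1 -> 'I_N}}|)%N.
  rewrite card_ffun !card_ord; apply: leq_ltn_trans ss _.
  apply: (@leq_ltn_trans ((N * B) ^ r)); last by rewrite expnMn expnSr ltn_pmul2l // expn_gt0.
  have le_NB : ((D * (r.+1 * (N * E))).+1 <= N * B)%N.
    have -> : (D * (r.+1 * (N * E)) = N * (D * (r.+1 * E)))%N by rewrite !mulnA; lia.
    by rewrite /B mulnS -add1n leq_add2r.
  by move: le_NB; move: (D * _)%N (N * B)%N => u w uw; case: (r) => // r'; rewrite leq_exp2r.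
pose M (al : {ffun 'I_r.+1 -> 'I_N}) (j : 'I_(size s)) : K := (Psi (\prod_i x i ^+ al i))@_(nth 0%MM s j).
have [Q [Qn0 QM]] := linear_dependence M lt_s.
exists Q; split=> //; apply: (Psi_inj FPsi); rewrite rmorph0; apply/mpolyP => m.
rewrite mcoeff0 rmorph_sum raddf_sum /=.
under eq_bigr => al _ do rewrite (PsiZ FPsi) mcoeffZ.
have [ms|ms] := boolP (m \in s).
  have jm : (index m s < size s)%N by rewrite index_mem.
  have := QM (Ordinal jm); rewrite /M /=; under eq_bigr => al _ do rewrite nth_index //.
  exact.
rewrite big1 // => al _; rewrite memN_msupp_eq0 ?mulr0 //.
apply: contra ms => mx; have [j jr mj] : exists2 j, (j <= r.+1 * (N * E))%N & vcone j m.
  suff : bdeg (r.+1 * (N * E)) (\prod_i x i ^+ al i) by exact.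
  have -> : (r.+1 * (N * E) = \sum_(i < r.+1) (N * E))%N by rewrite sum_nat_const card_ord.
  apply: (big_ind2 (fun k y => bdeg k y)) => [|k y l z yk zl|i _] /=; first exact: bdeg1.
    exact: bdegM.
  apply: (bdeg_le _ (@bdegX _ _ (al i) (xE i))); by rewrite leq_mul2r ltnW ?orbT.
exact: sP mj.
Qed.

End ToricDependence.

(** * Zariski's lemma *)

Section ResidueField.
Variables (A : comNzRingType) (P : set A) (Pmax : is_maximal_ideal P).

Definition max_pred : {pred A} := [pred x | x \in P].
HB.instance Definition _ := isIdealr.Build A max_pred Pmax.1.
Definition residue : Type := {ideal_quot max_pred}.
HB.instance Definition _ := GRing.ComNzRing.on residue.

Definition res (x : A) : residue := (\pi_{ideal_quot max_pred} x)%qT.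

Lemma res_eq0 x : res x = 0 <-> P x.
Proof.
have -> : (0 : residue) = res 0 by rewrite /res rmorph0.
rewrite /res; split=> [/eqP|Px].
  by rewrite -Quotient.idealrBE subr0 => /set_mem.
by apply/eqP; rewrite -Quotient.idealrBE subr0; apply/mem_set.
Qed.

Lemma res_surj (y : residue) : exists x, res x = y.
Proof. by exists (repr y)%qT; rewrite /res reprK. Qed.

Lemma residue_inv (y : residue) : y != 0 -> exists z, z * y = 1.
Proof.
have [x <-] := res_surj y => x0; have [[/= P0 P1 Plin] Pm] := Pmax.
have PB u v : P u -> P v -> P (u - v).
  move=> Pu Pv; have := Plin (- 1) v u (mem_set Pv) (mem_set Pu).
  by rewrite mulN1r addrC => /set_mem.
pose Q : set A := [set u | exists c p, P p /\ u = c * x + p].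
have PQ : P `<=` Q by move=> p Pp; exists 0, p; rewrite mul0r add0r.
have [Q1|Q1] := pselect (Q 1).
  have [c [p [Pp e]]] := Q1; exists (res c); rewrite -[_ * _](rmorphM (\pi_{ideal_quot max_pred}%qT)).
  apply/eqP; rewrite -subr_eq0 -[X in _ - X](rmorph1 (\pi_{ideal_quot max_pred}%qT)).
  rewrite -[_ - _](rmorphB (\pi_{ideal_quot max_pred}%qT)); apply/eqP/res_eq0.
  by rewrite e opprD addrA subrr add0r; have := PB _ _ (set_mem P0) Pp; rewrite sub0r.
suff QP : is_proper_ideal Q.
  have PeQ := Pm _ QP PQ; case/eqP: x0; apply/res_eq0; rewrite PeQ.
  by exists 1, 0; split; [exact: set_mem P0|rewrite mul1r addr0].
split => /=.
- by apply/mem_set; apply: PQ; exact: set_mem P0.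
- by apply/negP => /set_mem.
- move=> u v w /set_mem[c [p [Pp ->]]] /set_mem[c' [p' [Pp' ->]]]; apply/mem_set.
  exists (u * c + c'), (u * p + p'); split; last by ring.
  by have := Plin u p p' (mem_set Pp) (mem_set Pp') => /set_mem.
Qed.

Definition residue_invf (y : residue) : residue :=
  if pselect (y != 0) is left e then projT1 (cid (residue_inv e)) else 0.

Fact residue_mulV (y : residue) : y != 0 -> residue_invf y * y = 1.
Proof. by rewrite /residue_invf; case: pselect => // e _; exact: projT2 (cid (residue_inv e)). Qed.
Fact residue_inv0 : residue_invf 0 = 0.
Proof. by rewrite /residue_invf; case: pselect => // e; have := negP e (eqxx _). Qed.
HB.instance Definition _ := GRing.ComNzRing_isField.Build residue residue_mulV residue_inv0.

Lemma residue_field : exists (L : fieldType) (p : {rmorphism A -> L}),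
  (forall y, exists x, p x = y) /\ forall x, p x = 0 <-> P x.
Proof.
exists residue, (\pi_{ideal_quot max_pred}%qT : {rmorphism A -> residue}).
by split; [exact: res_surj|exact: res_eq0].
Qed.

End ResidueField.

Section Zariski.
Variable L : fieldType.

(** [L] is generated as a ring by [B] and [s], phrased as an induction principle. *)
Definition ring_gen (B : L -> Prop) (s : seq L) : Prop :=
  forall S : L -> Prop, (forall x, B x -> S x) -> (forall u, u \in s -> S u) ->
    (forall x y, S x -> S y -> S (x + y)) -> (forall x y, S x -> S y -> S (x * y)) ->
    forall y, S y.

Section Evaluation.
Variables (R : comNzRingType) (phi : {rmorphism R -> L}) (u : L).

Definition evp (p : {poly R}) : L := (map_poly phi p).[u].

Fact evp_additive : additive evp.
Proof. by move=> p q; rewrite /evp rmorphB hornerD hornerN. Qed.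
Fact evp_multiplicative : multiplicative evp.
Proof. by split=> [p q|]; rewrite /evp ?rmorphM ?hornerM ?rmorph1 ?hornerC. Qed.
HB.instance Definition _ := GRing.isZmodMorphism.Build _ _ evp evp_additive.
HB.instance Definition _ := GRing.isMonoidMorphism.Build _ _ evp
  (evp_multiplicative.2, evp_multiplicative.1).

Lemma evpC c : evp c%:P = phi c.
Proof. by rewrite /evp map_polyC hornerC. Qed.

Lemma evpX : evp 'X = u.
Proof. by rewrite /evp map_polyX hornerX. Qed.

End Evaluation.

(* phi(R)[1/f] is a field. *)
Definition quasi_field (R : comNzRingType) (phi : {rmorphism R -> L}) : Prop :=
  exists f, phi f != 0 /\ forall g, phi g != 0 -> exists h N, phi g * phi h = phi f ^+ N.

(* Otherwise 1 + u f would be a unit of phi(R)[u][1/f] with u transcendental. *)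
Lemma quasi_field_algebraic (R : comNzRingType) (phi : {rmorphism R -> L}) u :
  quasi_field (evp phi u) -> exists2 p, map_poly phi p != 0 & evp phi u p = 0.
Proof.
move=> [f [f0 fP]]; apply: contrapT => H.
have inj p : evp phi u p = 0 -> map_poly phi p = 0.
  by move=> p0; apply/eqP; apply: contrapT => /negP pn0; apply: H; exists p.
pose F := map_poly phi f; have F0 : F != 0.
  have : F.[u] != 0 by exact: f0.
  by apply: contraNneq => ->; rewrite horner0.
pose G := 1 + 'X * F.
have mG : map_poly phi (1 + 'X * f) = G by rewrite rmorphD rmorphM /= rmorph1 map_polyX.
have sXF : (1 < size ('X * F)%R)%N by rewrite mulrC size_mulX // ltnS lt0n size_poly_eq0.
have sG : (1 < size G)%N by rewrite /G addrC size_polyDl // size_poly1.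
have G0 : G != 0 by rewrite -size_poly_eq0; case: (size G) sG.
have [|h [N e]] := fP (1 + 'X * f).
  by apply: contraNneq G0 => /inj; rewrite mG => ->.
have GF : G * map_poly phi h = F ^+ N.
  apply/eqP; rewrite -subr_eq0 -mG -rmorphM -rmorphXn -rmorphB; apply/eqP/inj.
  by rewrite rmorphB rmorphM rmorphXn /= e subrr.
(* 1 = G - X F, so G is prime to all powers of F. Dividing one of them, it would have to be
   constant. *)
have cop : coprimep G (F ^+ N).
  apply: coprimep_expr; apply/Bezout_eq1_coprimepP; exists (1, - 'X) => /=.
  by rewrite /G; ring.
have : size G == 1%N; last by rewrite gtn_eqF.
rewrite -coprimepp; apply: (coprimep_dvdl _ cop).
by rewrite -GF dvdp_mulr.
Qed.

Lemma integralOver_sum (R : comNzRingType) (phi : {rmorphism R -> L}) m (F : 'I_m -> L) :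
  (forall i, integralOver phi (F i)) -> integralOver phi (\sum_i F i).
Proof.
move=> Fint; apply: (big_ind (fun y => integralOver phi y)) => //.
  exact: (integral0 phi).
by move=> x y xi yi; exact: integral_add.
Qed.

Lemma integralOver_exp (R : comNzRingType) (phi : {rmorphism R -> L}) x k :
  integralOver phi x -> integralOver phi (x ^+ k).
Proof.
move=> xi; elim: k => [|k IH]; first exact: (integral1 phi).
by rewrite exprS; exact: integral_mul.
Qed.

Section Descent.
Variables (R : comNzRingType) (phi : {rmorphism R -> L}) (u : L).

(** Since w is nonzero, factors X can be removed from q until its constant coefficient survives
    under [phi]; the relation then expresses that coefficient as a multiple of w. *)
Lemma evp_algebraic_multiple (w q : {poly R}) : evp phi u w != 0 ->
  map_poly phi q != 0 -> (map_poly phi q).[evp phi u w] = 0 ->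
  exists e z, phi e != 0 /\ phi e = evp phi u w * evp phi u z.
Proof.
move=> w0; elim/poly_ind: q => [|q b IH]; first by rewrite rmorph0 eqxx.
have [b0|b0] := eqVneq (phi b) 0.
  rewrite rmorphD rmorphM /= map_polyX map_polyC /= b0 addr0 => q0.
  rewrite hornerMX => /eqP; rewrite mulf_eq0 (negbTE w0) orbF => /eqP; apply: IH.
  by apply: contraNneq q0 => ->; rewrite mul0r.
move=> _; rewrite rmorphD rmorphM /= map_polyX map_polyC /= hornerD hornerMX hornerC => e.
exists b, (- q^:P.[w]); split=> //.
have evpP (p : {poly R}) : evp phi u p^:P.[w] = (map_poly phi p).[evp phi u w].
  rewrite -horner_map /= -map_poly_comp; congr (_.[_]).
  by apply: eq_map_poly => x /=; rewrite evpC.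
rewrite rmorphN /= evpP mulrN; apply/eqP; rewrite -addr_eq0 mulrC; apply/eqP.
by rewrite addrC.
Qed.

(** Multiplying the relation for u, of degree m and leading coefficient c, by c^(m-1) makes it monic
    in c u. *)
Lemma lead_mul_integral (p : {poly R}) : evp phi u p = 0 -> map_poly phi p != 0 ->
  exists c, phi c != 0 /\ integralOver phi (phi c * u).
Proof.
(* The degree is taken after applying [phi], which may kill the top coefficients of p. *)
move=> pu p0; pose m := (size (map_poly phi p)).-1; pose c := p`_m.
have c0 : phi c != 0 by rewrite -coef_map -[_`_m]/(lead_coef _) lead_coef_eq0.
have sm : size (map_poly phi p) = m.+1 by rewrite /m prednK // lt0n size_poly_eq0.
have m0 : (0 < m)%N.
  rewrite lt0n; apply: contraNneq c0 => m0; have := pu.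
  rewrite /evp horner_coef sm m0 big_ord1 coef_map expr0 mulr1 => <-.
  by rewrite /c m0.
exists c; split=> //.
pose q := 'X^m + \poly_(i < m) (c ^+ (m.-1 - i) * p`_i).
exists q.
  by rewrite monicE lead_coefDl ?lead_coefXn // size_polyXn ltnS size_poly.
apply/eqP; rewrite rmorphD /= map_polyXn hornerD hornerXn.
have -> : (map_poly phi (\poly_(i < m) (c ^+ (m.-1 - i) * p`_i))).[phi c * u] =
    \sum_(i < m) phi c ^+ m.-1 * (phi p`_i * u ^+ i).
  rewrite (@horner_coef_wide _ m); last first.
    by apply: leq_trans (size_poly _ _) _; exact: size_poly.
  apply: eq_bigr => i _; rewrite coef_map /= coef_poly ltn_ord rmorphM rmorphXn /= exprMn.
  have im : (i <= m.-1)%N by have := ltn_ord i; lia.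
  by rewrite -{2}(subnK im) exprD; ring.
rewrite -mulr_sumr exprMn -{1}(prednK m0) exprSr -!mulrA -mulrDr.
have := pu; rewrite /evp horner_coef sm big_ord_recr /= coef_map -/c => e.
rewrite [X in _ * X](_ : _ = 0) ?mulr0 //.
apply: etrans e; rewrite addrC; congr (_ + _); apply: eq_bigr => i _.
by rewrite coef_map.
Qed.

(** With u algebraic there is c such that c u is integral over phi(R), and f has a nonzero multiple
    e in phi(R). It then suffices to invert c e: the inverse of g, known in phi(R)[u][1/f], becomes
    integral over phi(R) after multiplication by powers of c and e, and its integral equation brings
    it down to phi(R)[1/(c e)]. *)
Lemma quasi_field_descend : quasi_field (evp phi u) -> quasi_field phi.
Proof.
move=> qf; have [p p0 pu] := quasi_field_algebraic qf; have [f [f0 fP]] := qf.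
have [c [c0 cu]] := lead_mul_integral pu p0.
have intM (q : {poly R}) : exists M, integralOver phi (phi c ^+ M * evp phi u q).
  exists (size q); rewrite /evp (@horner_coef_wide _ (size q)) ?size_poly // mulr_sumr.
  apply: integralOver_sum => i.
  have -> : phi c ^+ size q * ((map_poly phi q)`_i * u ^+ i) =
      phi (q`_i * c ^+ (size q - i)) * (phi c * u) ^+ i.
    rewrite coef_map rmorphM rmorphXn /= exprMn -{1}(subnK (ltnW (ltn_ord i))) exprD; ring.
  apply: integral_mul; [exact: (integral_id phi)|exact: integralOver_exp].
have [e [z [e0 ez]]] : exists e z, phi e != 0 /\ phi e = evp phi u f * evp phi u z.
  have [M [q qm qr]] := intM f.
  have cE q' : evp phi u (c%:P ^+ M * q') = phi c ^+ M * evp phi u q'.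
    by rewrite rmorphM rmorphXn /= evpC.
  have wE := cE f.
  have [|||e [z [e0 ez]]] := @evp_algebraic_multiple (c%:P ^+ M * f) q.
  - by rewrite wE mulf_neq0 // expf_neq0.
  - by rewrite monic_neq0 // monic_map.
  - by rewrite wE; exact/eqP.
  exists e, (c%:P ^+ M * z); split=> //; rewrite ez wE cE; ring.
exists (c * e); split; first by rewrite rmorphM mulf_neq0.
move=> g g0; have [|h [N]] := fP g%:P; first by rewrite /= evpC.
rewrite /= evpC => hE.
(* The value of [h * z ^+ N] is e^N / g, because e = f z. *)
have [M [q qm qr]] := intM (h * z ^+ N).
set w := phi c ^+ M * _ in qr.
have gw : phi g * w = phi (c ^+ M * e ^+ N).
  by rewrite /w !rmorphM !rmorphXn /= ez exprMn -hE; ring.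
clearbody w; have [t tE] : exists t, t = c ^+ M * e ^+ N by exists (c ^+ M * e ^+ N).
rewrite -tE in gw; pose k := (size q).-1.
have sq : size q = k.+1 by rewrite /k prednK // lt0n size_poly_eq0 monic_neq0.
(* In the monic equation of w, of degree k and multiplied by g^k, replace g w by t: all terms except
   t^k retain a factor g. *)
have tk : phi (t ^+ k) = phi g * phi (- \sum_(i < k) q`_i * t ^+ i * g ^+ (k - i.+1)).
  have /eqP := qr; rewrite (@horner_coef_wide _ k.+1); last by rewrite -sq size_poly.
  rewrite big_ord_recr /= coef_map /=.
  have -> : q`_k = 1 by have := monicP qm; rewrite lead_coefE.
  rewrite rmorph1 mul1r addrC => /eqP; rewrite addr_eq0 => /eqP wk.
  rewrite rmorphXn /= -gw exprMn wk mulrN rmorphN mulrN; congr (- _).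
  rewrite rmorph_sum !mulr_sumr; apply: eq_bigr => i _.
  rewrite !rmorphM !rmorphXn /= -gw coef_map exprMn /=.
  have -> : phi g ^+ k = phi g * phi g ^+ i * phi g ^+ (k - i.+1).
    by rewrite -exprS -exprD subnKC.
  by ring.
move: tk; set h' := - _ => tk.
exists (h' * (c ^+ (N * k) * e ^+ (M * k))), ((M + N) * k)%N.
clearbody h'; rewrite (rmorphM phi h') mulrA -tk -rmorphM -rmorphXn; congr (phi _).
rewrite tE !exprMn -!exprM mulnDl !exprD; ring.
Qed.

End Descent.

Lemma quasi_field_gen (s : seq L) : forall (R : comNzRingType) (phi : {rmorphism R -> L}),
  ring_gen (fun y => exists x, phi x = y) s -> quasi_field phi.
Proof.
elim: s => [|u s IH] R phi gen.
  exists 1; rewrite rmorph1 oner_neq0; split=> // g g0.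
  have [h hE] : exists h, phi h = (phi g)^-1.
    apply: (gen (fun y => exists x, phi x = y)) => // x y [x' <-] [y' <-].
      by exists (x' + y'); rewrite rmorphD.
    by exists (x' * y'); rewrite rmorphM.
  by exists h, 0%N; rewrite hE mulfV.
apply: (@quasi_field_descend _ _ u); apply: IH => S Sphi Ss SD SM; apply: gen => //.
  by move=> _ [x <-]; apply: Sphi; exists x%:P; rewrite /= evpC.
move=> v; rewrite inE => /orP[/eqP ->|/Ss //].
by apply: Sphi; exists 'X; rewrite /= evpX.
Qed.

Lemma zariski (K : fieldType) (phi : {rmorphism K -> L}) (s : seq L) u :
  ring_gen (fun y => exists x, phi x = y) s ->
  exists2 p : {poly K}, p \is monic & (map_poly phi p).[u] = 0.
Proof.
move=> gen; have [|p p0 pu] := @quasi_field_algebraic _ phi u.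
  apply: (@quasi_field_gen s) => S Sphi; apply: gen => _ [x <-].
  by apply: Sphi; exists x%:P; rewrite /= evpC.
have {}p0 : p != 0 by rewrite map_poly_eq0 in p0.
exists ((lead_coef p)^-1 *: p).
  by rewrite monicE lead_coefZ mulVf // lead_coef_eq0.
by rewrite map_polyZ hornerZ; move: pu; rewrite /evp => ->; rewrite mulr0.
Qed.

End Zariski.

(** * A criterion for Cohen-Macaulay algebras *)

Section Criterion.
Variables (K : fieldType) (A : comAlgType K).

Lemma proper_idealP (P : set A) : is_proper_ideal P <-> ideal_like P /\ ~ P 1.
Proof.
split=> [[/= P0 P1 PM]|[[P0 PD PM] P1]]; last first.
  split; rewrite ?inE //; first by apply/negP => /set_mem.
  move=> c x y /set_mem Px /set_mem Py; apply/mem_set.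
  by apply: PD => //; exact: PM.
split; last by move=> /mem_set; apply/negP.
split=> [|x y /mem_set Px /mem_set Py|c x /mem_set Px]; apply/set_mem => //.
  by have := PM 1 x y Px Py; rewrite mul1r.
by have := PM c x 0 Px P0; rewrite addr0.
Qed.

Lemma prime_idealP (P : set A) : is_prime_ideal P <->
  [/\ ideal_like P, ~ P 1 & forall x y, P (x * y) -> P x \/ P y].
Proof.
split=> [[/proper_idealP[Pid P1] /= Ppr]|[Pid P1 Ppr]]; split=> //; last 2 first.
- exact/proper_idealP.
- move=> x y /set_mem /Ppr[] Px; apply/orP; [left|right]; exact/mem_set.
by move=> x y /mem_set /Ppr /orP[] /set_mem; [left|right].
Qed.

Lemma ideal_gen_like (X : set A) : ideal_like (ideal_gen X).
Proof.
by split; [exact: ideal_gen0|exact: ideal_genD|move=> c x; exact: ideal_genMl].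
Qed.

Lemma ideal_gen_min (X P : set A) : ideal_like P -> X `<=` P -> ideal_gen X `<=` P.
Proof.
move=> Pid XP _ [m [c [g [Xg ->]]]]; apply: ideal_like_sum => // i _.
by have [_ _ PM] := Pid; apply: PM; apply: XP.
Qed.

Lemma maximal_prime (P : set A) : is_maximal_ideal P -> is_prime_ideal P.
Proof.
move=> Pmax; have [Pid P1] := (proper_idealP P).1 Pmax.1.
apply/prime_idealP; split=> // x y.
have [L [p [_ pP]]] := residue_field Pmax.
by rewrite -!pP rmorphM => /eqP; rewrite mulf_eq0 => /orP[] /eqP; [left|right].
Qed.

(** The residue field is generated by finitely many elements over K, so the residue of x is
    algebraic over K. *)
Lemma maximal_integral (P : set A) (gs : seq A) (x : A) : is_maximal_ideal P ->
  (forall S : A -> Prop, (forall c : K, S c%:A) -> (forall u, u \in gs -> S u) ->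
    (forall u v, S u -> S v -> S (u + v)) -> (forall u v, S u -> S v -> S (u * v)) ->
    forall u, S u) ->
  exists2 g : {poly K}, g \is monic & P (map_poly (in_alg A) g).[x].
Proof.
move=> Pmax gen; have [L [p [psurj pP]]] := residue_field Pmax.
pose phi : {rmorphism K -> L} := (p \o in_alg A)%FUN.
have [|g gm gu] := @zariski L K phi (map p gs) (p x).
  move=> S Sphi Sgs SD SM y; have [u <-] := psurj y.
  apply: (gen (fun u => S (p u))) => [c|v vgs|v w|v w].
  - by apply: Sphi; exists c.
  - by apply: Sgs; exact: map_f.
  - by rewrite rmorphD; exact: SD.
  - by rewrite rmorphM; exact: SM.
by exists g => //; apply/pP; rewrite -horner_map /= -map_poly_comp.
Qed.

Lemma prime_avoiding (I M : set A) : ideal_like I -> M 1 ->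
  (forall x y, M x -> M y -> M (x * y)) -> (forall x, I x -> ~ M x) ->
  exists Q, [/\ is_prime_ideal Q, I `<=` Q & forall x, Q x -> ~ M x].
Proof.
move=> Iid M1 MM IM.
pose C : set (set A) := [set Q | Q = set0 \/
  [/\ ideal_like Q, I `<=` Q & forall x, Q x -> ~ M x]].
have [|Q [CQ Qmax]] := @Zorn_bigcup A C.
  move=> F FC Ftot; have [[Q0 [FQ0 Q0n]]|Fn] := pselect (exists Q, F Q /\ Q <> set0); last first.
    left; apply/seteqP; split=> // x [Q FQ Qx].
    by apply: Fn; exists Q; split=> // Q0; rewrite Q0 in Qx.
  have FP Q x : F Q -> Q x -> [/\ ideal_like Q, I `<=` Q & forall x, Q x -> ~ M x].
    by move=> FQ Qx; case: (FC _ FQ) => // Qe; rewrite Qe in Qx.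
  have [Q0id IQ0 _] : [/\ ideal_like Q0, I `<=` Q0 & forall x, Q0 x -> ~ M x].
    by case: (FC _ FQ0).
  right; split=> [|x Ix|x [Q FQ Qx]]; last 2 first.
  - by exists Q0 => //; exact: IQ0.
  - by have [_ _] := FP _ _ FQ Qx; apply.
  split=> [|x y [Q FQ Qx] [Q' FQ' Qy]|c x [Q FQ Qx]].
  - by exists Q0 => //; case: Q0id.
  - have [QQ'|QQ'] := Ftot _ _ FQ FQ'.
      exists Q' => //; have [[_ QD _] _ _] := FP _ _ FQ' Qy.
      by apply: QD => //; exact: QQ'.
    exists Q => //; have [[_ QD _] _ _] := FP _ _ FQ Qx.
    by apply: QD => //; exact: QQ'.
  - by exists Q => //; have [[_ _ QM] _ _] := FP _ _ FQ Qx; exact: QM.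
have {CQ} [Qid IQ QM] : [/\ ideal_like Q, I `<=` Q & forall x, Q x -> ~ M x].
  case: CQ => // Q0; case: (Qmax I); last by right; split.
  rewrite Q0; split=> // /(_ 0); apply; by case: Iid.
have ext x : ~ Q x -> exists q c, Q q /\ M (q + c * x).
  move=> Qx; pose Q' : set A := [set u | exists q c, Q q /\ u = q + c * x].
  have [Q0 QD QMl] := Qid.
  apply: contrapT => H; apply: (Qmax Q'); last first.
    right; split=> [|u Iu|u [q [c [Qq ->]]] Mu]; last 2 first.
    - by exists u, 0; split; [exact: IQ|rewrite mul0r addr0].
    - by apply: H; exists q, c.
    split=> [|u v [q [c [Qq ->]]] [q' [c' [Qq' ->]]]|e u [q [c [Qq ->]]]].
    - by exists 0, 0; rewrite mul0r addr0.
    - by exists (q + q'), (c + c'); split; [exact: QD|ring].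
    - by exists (e * q), (e * c); split; [exact: QMl|ring].
  split=> [u Qu|/(_ x) H']; first by exists u, 0; split=> //; rewrite mul0r addr0.
  by apply: Qx; apply: H'; exists 0, 1; rewrite mul1r add0r.
exists Q; split=> //; apply/prime_idealP; split=> // [/QM|x y Qxy] //.
apply: contrapT => /not_orP[/ext[q [c [Qq Mx]]] /ext[q' [c' [Qq' My]]]].
apply: QM (MM _ _ Mx My); have [_ QD QMl] := Qid.
have -> : (q + c * x) * (q' + c' * y) = (q' + c' * y) * q + c * x * q' + c * c' * (x * y) by ring.
by apply: (QD); [apply: QD|]; apply: QMl.
Qed.

(** Descending from a prime Q that contains the first k + 1 elements, one needs a prime inside Q
    that contains the first k but not s_k. It is found by avoiding the products s_k^j u with u
    outside Q; these miss the ideal of the first k elements because s_k is a nonzerodivisor modulo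
    it. *)
Lemma prime_chain_regular (s : seq A) (P : set A) :
  (forall i, (i < size s)%N -> forall x,
     ideal_gen [set` take i s] (s`_i * x) -> ideal_gen [set` take i s] x) ->
  is_prime_ideal P -> [set` s] `<=` P -> prime_chain P (size s).
Proof.
move=> sreg Ppr sP.
suff H k : (k <= size s)%N -> forall Q, is_prime_ideal Q -> [set` take k s] `<=` Q ->
    prime_chain Q k.
  by apply: H => //; rewrite take_size.
elim: k => [_ Q Qpr _|k IH ks Q Qpr QS].
  by exists (fun=> Q); split.
have [Qid Q1 Qprod] := (prime_idealP Q).1 Qpr.
have sQ : [set` take k s] `<=` Q.
  by move=> x /= xs; apply: QS => /=; rewrite (take_nth 0) // mem_rcons inE xs orbT.
have xQ : Q s`_k by apply: QS => /=; rewrite (take_nth 0) // mem_rcons mem_head.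
have [||||Q' [Q'pr IQ' Q'M]] := @prime_avoiding (ideal_gen [set` take k s])
    [set z | exists j u, ~ Q u /\ z = s`_k ^+ j * u].
- exact: ideal_gen_like.
- by exists 0%N, 1; rewrite mulr1.
- move=> _ _ [i [u [Qu ->]]] [j [v [Qv ->]]]; exists (i + j)%N, (u * v).
  by rewrite exprD; split; [move=> /Qprod[]|ring].
- move=> z zI [j [u [Qu zE]]]; move: zI; rewrite {}zE => uI; apply: Qu.
  apply: (ideal_gen_min Qid sQ); elim: j uI => [|j IHj]; first by rewrite mul1r.
  by rewrite exprS -mulrA => /(sreg _ ks) /IHj.
have [p [pp pl pk]] := IH (ltnW ks) Q' Q'pr (fun x xs => IQ' _ (ideal_gen_sub xs)).
exists (fun i => if (i <= k)%N then p i else Q); split=> [i ik|i|]; last by rewrite ltnn.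
  by case: ifP => // ik'; exact: pp.
rewrite ltnS => ik; rewrite ik; case: ltnP => ki; first exact: pl.
have -> : i = k by apply/eqP; rewrite eqn_leq ik.
rewrite pk; split=> [x Q'x|/(_ _ xQ) /Q'M].
  by apply: contrapT => Qx; apply: (Q'M _ Q'x); exists 0%N, x; rewrite mul1r.
by apply; exists 1%N, 1; rewrite mulr1 expr1.
Qed.

Section Bounds.
Variables (r : nat) (dep : forall x : 'I_r.+1 -> A, alg_dep x).

Lemma regular_seq_bound (s : seq A) : regular_seq s -> (size s <= r)%N.
Proof.
move=> [sreg s1]; rewrite leqNgt; apply/negP => rs.
apply: (@alg_dep_chain _ _ r.+1 (fun i => s`_i) (fun k => ideal_gen [set` take k s])).
- by move=> k; exact: ideal_gen_like.
- move=> k; apply: ideal_gen_min; first exact: ideal_gen_like.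
  move=> x /= xs; apply: ideal_gen_sub => /=.
  have [ks|ks] := ltnP k (size s); first by rewrite (take_nth 0) // mem_rcons inE xs orbT.
  by rewrite take_oversize in xs => //; rewrite take_oversize // ltnW.
- by move=> i y; apply: sreg; apply: leq_trans rs.
- move=> i; apply: ideal_gen_sub => /=; have ir := leq_trans (ltn_ord i) rs.
  by rewrite (take_nth 0) // mem_rcons mem_head.
- move=> H; apply: s1; apply: ideal_gen_min H; first exact: ideal_gen_like.
  by move=> x /= /mem_take xs; exact: ideal_gen_sub.
- exact: dep.
Qed.

Lemma prime_chain_bound (P : set A) h : prime_chain P h -> (h <= r)%N.
Proof.
move=> [p [pp pl _]]; rewrite leqNgt; apply/negP => rh.
have /choice[x xP] : forall i : 'I_r.+1, exists x, p i.+1 x /\ ~ p i x.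
  move=> i; have [|_ H] := pl i; first exact: leq_trans rh.
  by apply: contrapT => H'; apply: H => x px; apply: contrapT => nx; apply: H'; exists x.
(* Capping the index turns the finite chain into an infinite ascending sequence of primes. *)
pose I k := p (minn k r.+1).
have IP k : is_prime_ideal (I k) by apply: pp; apply: leq_trans (geq_minr _ _) _.
have Ii (i : 'I_r.+1) : I i = p i by rewrite /I (minn_idPl _) // ltnW.
have Ii1 (i : 'I_r.+1) : I i.+1 = p i.+1 by rewrite /I (minn_idPl _).
apply: (@alg_dep_chain _ _ r.+1 x I) => //.
- by move=> k; have /prime_idealP[] := IP k.
- move=> k; have [kr|kr] := ltnP k r.+1.
    have := pl k (leq_trans kr rh); rewrite -(Ii (Ordinal kr)) -(Ii1 (Ordinal kr)).
    by case.
  by rewrite /I !(minn_idPr _) // ltnW.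
- move=> i y; have /prime_idealP[_ _ Ipr] := IP i.
  by move=> /Ipr[] //; rewrite Ii; have [_] := xP i.
- by move=> i; rewrite Ii1; have [] := xP i.
- by have /prime_idealP[] := IP r.+1.
Qed.

End Bounds.

Theorem cohen_macaulay_criterion (gs : seq A) r (theta : 'I_r -> A) :
  noetherian A ->
  (forall S : A -> Prop, (forall c : K, S c%:A) -> (forall u, u \in gs -> S u) ->
    (forall u v, S u -> S v -> S (u + v)) -> (forall u v, S u -> S v -> S (u * v)) ->
    forall u, S u) ->
  (forall x : 'I_r.+1 -> A, alg_dep x) ->
  (forall g : 'I_r -> {poly K}, (forall i, g i \is monic) -> (forall i, 1 < size (g i))%N ->
     let f i := (map_poly (in_alg A) (g i)).[theta i] in
     forall (i : 'I_r) x, ideal_gen [set f j | j in [set j : 'I_r | (j < i)%N]] (f i * x) ->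
       ideal_gen [set f j | j in [set j : 'I_r | (j < i)%N]] x) ->
  cohen_macaulay A.
Proof.
move=> noeth gen dep reg; split=> // P Pmax; exists r.
have [Pid P1] := (proper_idealP P).1 Pmax.1; have Ppr := maximal_prime Pmax.
have /choice[g gP] : forall i, exists g : {poly K}, g \is monic /\ P (map_poly (in_alg A) g).[theta i].
  by move=> i; have [g gm gP] := maximal_integral (theta i) Pmax gen; exists g.
have g1 i : (1 < size (g i))%N.
  rewrite ltnNge; apply/negP => sg; have [gm gPi] := gP i; apply: P1.
  have e : g i = 1.
    by have := monicP gm; rewrite (size1_polyC sg) lead_coefC => ->.
  by move: gPi; rewrite e rmorph1 hornerC.
pose f i := (map_poly (in_alg A) (g i)).[theta i].
pose s := [seq f i | i <- enum 'I_r].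
have ss : size s = r by rewrite size_map size_enum_ord.
have takeE i : [set` take i s] = [set f j | j in [set j : 'I_r | (j < i)%N]].
  apply/seteqP; split=> x /=.
    move=> /(nthP 0)[j]; rewrite size_take => jl <-.
    have ji : (j < i)%N by move: jl; case: ifP => // /negbT; rewrite -leqNgt => si /leq_trans; apply.
    have jr : (j < r)%N.
      by move: jl; rewrite ss; case: ifP => // ir /ltn_trans; apply.
    exists (Ordinal jr) => //; rewrite nth_take // (nth_map (Ordinal jr)) ?size_enum_ord //.
    by congr f; apply: val_inj; rewrite /= nth_enum_ord.
  move=> [j ji <-]; have jr := ltn_ord j; apply/(nthP 0); exists j.
    by rewrite size_take ss; case: ifP.
  rewrite nth_take // (nth_map j) ?size_enum_ord //.
  by congr f; apply: val_inj; rewrite /= nth_enum_ord.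
have sreg i : (i < size s)%N -> forall x,
     ideal_gen [set` take i s] (s`_i * x) -> ideal_gen [set` take i s] x.
  rewrite ss => ir x; rewrite takeE => H.
  apply: (reg g (fun j => (gP j).1) g1 (Ordinal ir)).
  move: H; rewrite (nth_map (Ordinal ir)) ?size_enum_ord //.
  have -> // : nth (Ordinal ir) (enum 'I_r) i = Ordinal ir.
  by apply: val_inj; rewrite /= nth_enum_ord.
have sP : [set` s] `<=` P.
  by move=> x /= /mapP[i _ ->]; have [] := gP i.
split; split.
- exists s; split=> //; split=> // H; apply: P1; exact: ideal_gen_min H.
- by move=> s' s'reg _; exact: regular_seq_bound s'reg.
- by rewrite -ss; exact: prime_chain_regular.
- by move=> h' /prime_chain_bound; apply.
Qed.

End Criterion.

(** * Flags of faces of a polyhedral cone *)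

Import Num.Theory.

Section Flags.
Variables (R : archiRealFieldType) (n : nat) (H : finType) (ell : H -> 'cV[rat]_n).
Implicit Types (y : 'rV[R]_n) (h : H).

(** Forms are rational and points are real: dimensions are computed over the rationals, while
    generic points need irrational coordinates. *)
Definition ev (q : 'cV[rat]_n) y : R := (y *m map_mx ratr q) 0 0.

Lemma evD q y y' : ev q (y + y') = ev q y + ev q y'.
Proof. by rewrite /ev mulmxDl mxE. Qed.
Lemma evZ q c y : ev q (c *: y) = c * ev q y.
Proof. by rewrite /ev -scalemxAl mxE. Qed.
Lemma ev0 q : ev q 0 = 0.
Proof. by rewrite /ev mul0mx mxE. Qed.
Lemma evN q y : ev q (- y) = - ev q y.
Proof. by rewrite -scaleN1r evZ mulN1r. Qed.
Lemma ev_sum q I (r : seq I) (P : pred I) (F : I -> 'rV[R]_n) :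
  ev q (\sum_(i <- r | P i) F i) = \sum_(i <- r | P i) ev q (F i).
Proof. by elim/big_ind2 : _ => [|x1 x2 y1 y2 <- <-|//]; rewrite ?ev0 ?evD. Qed.

Lemma ev_ratr q (v : 'rV[rat]_n) : ev q (map_mx ratr v) = ratr ((v *m q) 0 0).
Proof. by rewrite /ev -map_mxM mxE. Qed.

Lemma evBZ q q' (c : rat) y : ev (q - c *: q') y = ev q y - ratr c * ev q' y.
Proof. by rewrite /ev map_mxB map_mxZ mulmxBr -scalemxAr !mxE. Qed.

Local Notation HT := [set: H]%SET.

Definition incone y := forall h, 0 <= ev (ell h) y.
Definition tight y : {set H} := [set h | ev (ell h) y == 0].

Lemma inconeD y y' : incone y -> incone y' -> incone (y + y').
Proof. by move=> Cy Cy' h; rewrite evD addr_ge0. Qed.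

Lemma inconeZ c y : 0 <= c -> incone y -> incone (c *: y).
Proof. by move=> c0 Cy h; rewrite evZ mulr_ge0. Qed.

Lemma tightD y y' : incone y -> incone y' -> tight (y + y') = tight y :&: tight y'.
Proof.
by move=> Cy Cy'; apply/setP => h; rewrite !inE evD paddr_eq0.
Qed.

Lemma tightZ c y : 0 < c -> tight (c *: y) = tight y.
Proof. by move=> c0; apply/setP => h; rewrite !inE evZ mulf_eq0 gt_eqF. Qed.

Lemma tight0 : tight 0 = HT.
Proof. by apply/setP => h; rewrite !inE ev0 eqxx. Qed.

(** The rational subspace on which the forms in [T] vanish; columns of other forms are set to 0 to
    keep the size of the matrix fixed. *)
Definition span (T : {set H}) : 'M[rat]_n :=
  kermx (\matrix_(i < n, j < #|H|) if enum_val j \in T then ell (enum_val j) i 0 else 0).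

Definition rk T := \rank (span T).

Lemma spanP (T : {set H}) (v : 'rV[rat]_n) : reflect (forall h, h \in T -> (v *m ell h) 0 0 = 0) (v <= span T)%MS.
Proof.
apply: (iffP sub_kermxP) => [e h hT|vT].
  have /rowP/(_ (enum_rank h)) := e; rewrite [RHS]mxE; apply: etrans; rewrite !mxE.
  by apply: eq_bigr => i _; rewrite mxE enum_rankK hT.
apply/rowP => j; rewrite !mxE; have [jT|jT] := boolP (enum_val j \in T).
  by apply: etrans (vT _ jT); rewrite [RHS]mxE; apply: eq_bigr => i _; rewrite mxE jT.
by apply: big1 => i _; rewrite mxE (negbTE jT) mulr0.
Qed.

Lemma span_sub (T T' : {set H}) : T \subset T' -> (span T' <= span T)%MS.
Proof.
move=> TT'; apply/row_subP => i; apply/spanP => h hT.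
by move/row_subP: (submx_refl (span T')) => /(_ i)/spanP; apply; exact: (fintype.subsetP TT').
Qed.

Hypothesis pointed : forall y, tight y = [set: H]%SET -> y = 0.

Lemma rk_setT : rk HT = 0%N.
Proof.
apply/eqP; rewrite mxrank_eq0; apply/eqP/row_matrixP => i; rewrite row0.
apply: (@map_mx_inj _ _ (ratr : {rmorphism rat -> R})).
rewrite map_mx0; apply: pointed; apply/setP => h; rewrite !inE ev_ratr fmorph_eq0.
have /spanP : (row i (span HT) <= span HT)%MS by exact: row_sub.
by move=> ->.
Qed.

(** A face is represented by the set of forms vanishing on it, so larger faces have smaller sets;
    the condition [T <> HT] excludes the apex. *)
Definition Face T := T <> HT /\ exists2 y, incone y & tight y = T.

Variable u : {set H} -> 'rV[rat]_n.
Notation uR T := (map_mx (ratr : rat -> R) (u T)).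
Hypothesis uP : forall T, Face T -> incone (uR T) /\ tight (uR T) = T.

Lemma ev_u (T : {set H}) h : Face T -> h \notin T -> 0 < ev (ell h) (uR T).
Proof.
by move=> /uP[uC uT] hT; rewrite lt_neqAle uC andbT eq_sym; move: hT; rewrite -{1}uT inE.
Qed.

Lemma ev_u0 (T : {set H}) h : Face T -> h \in T -> ev (ell h) (uR T) = 0.
Proof. by move=> /uP[uC uT]; rewrite -{1}uT inE => /eqP. Qed.

Lemma u_span T : Face T -> (u T <= span T)%MS.
Proof.
move=> FT; apply/spanP => h hT; apply/eqP.
by rewrite -(fmorph_eq0 (ratr : {rmorphism rat -> R})) /= -ev_ratr ev_u0.
Qed.

(** Equal ranks make the two spans coincide, so the forms in [T'] vanish at the interior point [u T]
    and hence belong to [T]. *)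
Lemma face_rk_eq (T T' : {set H}) : Face T -> T \subset T' -> (rk T <= rk T')%N -> T = T'.
Proof.
move=> FT TT' rkT; apply/eqP; rewrite finset.eqEsubset TT' /=; apply/fintype.subsetP => h hT'.
have eqW : (span T <= span T')%MS.
  by rewrite -(geq_leqif (mxrank_leqif_sup (span_sub TT'))).
have [_ <-] := uP FT; rewrite inE ev_ratr fmorph_eq0; apply/eqP.
by move: hT'; apply/spanP; apply: submx_trans eqW; exact: u_span.
Qed.

(** The index is off by one: [T t] has dimension t + 1. The faces grow with t, their sets of tight
    forms shrink. *)
Definition flag s y (T : nat -> {set H}) (lam : nat -> R) : Prop :=
  [/\ y = \sum_(t < s) lam t *: uR (T t),
      forall t, (t < s)%N -> [/\ Face (T t), rk (T t) = t.+1 & 0 < lam t] &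
      forall t, (t.+1 < s)%N -> T t.+1 \subset T t].

Lemma flag_pred s y T lam : flag s.+1 y T lam -> flag s (y - lam s *: uR (T s)) T lam.
Proof.
move=> [-> TP Tsub]; split=> [|t ts|t ts].
- by rewrite big_ord_recr /= addrK.
- by apply: TP; exact: ltnW.
- by apply: Tsub; exact: ltnW.
Qed.

Lemma flag_tight s y T lam : flag s y T lam ->
  incone y /\ tight y = (if s is s'.+1 then T s' else HT).
Proof.
elim: s y => [|s IH] y fl.
  have [-> _ _] := fl; rewrite big_ord0 tight0; split=> // h; by rewrite ev0.
have [yC yT] := IH _ (flag_pred fl); have [_ TP Tsub] := fl.
have [FT _ lam0] := TP s (ltnSn s); have [uC uT] := uP FT.
have luC := inconeZ (ltW lam0) uC.
rewrite -(subrK (lam s *: uR (T s)) y); split; first exact: inconeD.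
rewrite tightD // tightZ // yT uT; apply/finset.setIidPr.
by case: s {IH yC yT FT lam0 uC uT luC fl TP} Tsub => [_|s Tsub]; [exact: finset.subsetT|exact: Tsub].
Qed.

(** Some form vanishes on the smaller faces of the flag but not on the largest one. At y it equals
    lam_s times its value at the point of that face, which bounds the multiples that can be
    subtracted. *)
Lemma flag_max s y T lam l : flag s.+1 y T lam ->
  incone (y - l *: uR (T s)) -> l <= lam s.
Proof.
move=> fl yC; have [_ TP Tsub] := fl; have [FT rkT _] := TP s (ltnSn s).
have [_ yT] := flag_tight (flag_pred fl).
set y' := y - _ in yT; set T' := (if s is _.+1 then _ else _) in yT.
have [h hT' hT] : exists2 h, h \in T' & h \notin T s.
  apply/subsetPn; apply/negP => T'T; have : rk T' = s.
    rewrite /T'; case: (s) TP => [_|s' TP]; first exact: rk_setT.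
    by have [] := TP s' (ltnW (ltnSn _)).
  suff -> : T' = T s by rewrite rkT => /eqP; rewrite gtn_eqF.
  apply/eqP; rewrite finset.eqEsubset T'T /T' /=.
  by case: (s) Tsub => [_|s' Tsub]; [exact: finset.subsetT|exact: Tsub].
have := yC h; have -> : y - l *: uR (T s) = y' + (lam s - l) *: uR (T s).
  by rewrite /y' scalerBl addrA subrK.
have -> : ev (ell h) (y' + (lam s - l) *: uR (T s)) = (lam s - l) * ev (ell h) (uR (T s)).
  by rewrite evD evZ; move: hT'; rewrite -yT inE => /eqP ->; rewrite add0r.
by rewrite pmulr_lge0 ?ev_u // subr_ge0.
Qed.

Definition level (ps : seq (R * {set H})) t := \sum_(p <- ps | rk p.2 == t.+1) p.1.

(* An arbitrary expansion of y is lexicographically at most its flag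
   expansion, compared from the largest faces downwards. *)
Lemma flag_lex_max s (ps : seq (R * {set H})) y T lam :
  (forall p, p \in ps -> [/\ 0 < p.1, Face p.2 & (rk p.2 <= s)%N]) ->
  flag s y T lam -> y = \sum_(p <- ps) p.1 *: uR p.2 ->
  (exists t, [/\ (t < s)%N, level ps t < lam t &
     forall t', (t < t' < s)%N -> level ps t' = lam t']) \/
  (forall t, (t < s)%N -> level ps t = lam t) /\
  (forall p, p \in ps -> (0 < rk p.2)%N -> p.2 = T (rk p.2).-1).
Proof.
elim: s ps y => [|s IH] ps y psP fl yE.
  by right; split=> // p /psP[_ _]; rewrite leqn0 => /eqP ->.
have [yC yT] := flag_tight fl; have [_ TP Tsub] := fl; have [FT rkT lam0] := TP s (ltnSn s).
have psC p : p \in ps -> incone (p.1 *: uR p.2).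
  by move=> /psP[p0 /uP[pC _] _]; apply: inconeZ => //; exact: ltW.
(* A form vanishing on a sum of points of the cone vanishes on each summand, so every face used lies
   in the face of y. *)
have TsubP p : p \in ps -> T s \subset p.2.
  move=> pps; rewrite -yT; apply/fintype.subsetP => h; rewrite inE yE ev_sum.
  rewrite big_seq psumr_eq0 => [|p' /psC]; last exact.
  have [p0 Fp _] := psP p pps; have [_ pT] := uP Fp.
  by move=> /allP/(_ p pps); rewrite pps evZ mulf_eq0 gt_eqF //= -{2}pT inE.
have topE p : p \in ps -> rk p.2 = s.+1 -> p.2 = T s.
  by move=> pps rkp; apply/esym/face_rk_eq => //; [exact: TsubP|rewrite rkT rkp].
pose ps' := [seq p <- ps | rk p.2 != s.+1].
have ps'P p : p \in ps' -> [/\ 0 < p.1, Face p.2 & (rk p.2 <= s)%N].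
  by rewrite mem_filter => /andP[rkp /psP[p0 Fp rkp']]; split=> //; rewrite -ltnS ltn_neqAle rkp.
have y'E : y - level ps s *: uR (T s) = \sum_(p <- ps') p.1 *: uR p.2.
  rewrite yE (bigID (fun p => rk p.2 == s.+1)) /= big_filter /level scaler_suml.
  rewrite [X in X + _ - _]big_seq_cond [X in _ - X]big_seq_cond.
  rewrite (eq_bigr (fun p => p.1 *: uR (T s))); last by move=> p /andP[pps /eqP/(topE _ pps) ->].
  by rewrite addrAC subrr add0r.
have lev' t : (t < s)%N -> level ps' t = level ps t.
  move=> ts; rewrite /level big_filter_cond; apply: eq_bigl => p.
  case: (rk p.2 =P t.+1) => [->|_]; last by rewrite andbF.
  by rewrite andbT eqSS neq_ltn ts.
(* Only one face can occur in dimension s + 1. Removing its terms leaves a sum of points of the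
   cone, so [flag_max] applies. *)
have le_lam : level ps s <= lam s.
  apply: (flag_max fl); rewrite y'E => h; rewrite ev_sum big_seq; apply: sumr_ge0 => p.
  by rewrite mem_filter => /andP[_ /psC].
move: le_lam; rewrite le_eqVlt => /orP[/eqP lamE|lt]; last first.
  by left; exists s; split=> // t' /andP[st' t's]; have := leq_trans st' t's; rewrite ltnn.
have fl' := flag_pred fl; rewrite -lamE in fl'.
have [[t [ts lt Heq]]|[lev Teq]] := IH ps' _ ps'P fl' y'E.
  left; exists t; split; [exact: ltnW|by rewrite -lev'|].
  move=> t' /andP[tt']; rewrite ltnS leq_eqVlt => /orP[/eqP -> //|t's].
  by rewrite -lev' // Heq // tt'.
right; split=> [t|p pps rkp].
  by rewrite ltnS leq_eqVlt => /orP[/eqP -> //|ts]; rewrite -lev' // lev.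
have [rks|rks] := eqVneq (rk p.2) s.+1; first by rewrite rks; exact: topE.
by apply: Teq => //; rewrite mem_filter rks.
Qed.

Definition lex_lt r (lam lam' : nat -> R) : Prop := exists t, [/\ (t < r)%N, lam t < lam' t &
  forall t', (t < t' < r)%N -> lam t' = lam' t'].

Lemma lex_lt_trans r lam1 lam2 lam3 : lex_lt r lam1 lam2 -> lex_lt r lam2 lam3 -> lex_lt r lam1 lam3.
Proof.
move=> [t [tr lt eqt]] [t' [tr' lt' eqt']]; have [tt'|tt'|tt'] := ltngtP t t'.
- exists t'; split=> // [|i /andP[ti ir]]; first by rewrite eqt ?tt'.
  by rewrite eqt ?eqt' ?ti ?ir // (ltn_trans tt').
- exists t; split=> // [|i /andP[ti ir]]; first by rewrite -eqt' ?tt'.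
  by rewrite eqt ?eqt' ?ti ?ir // (ltn_trans tt').
- exists t; split=> // [|i /andP[ti ir]]; first by rewrite (lt_trans lt) // tt'.
  by rewrite eqt ?eqt' -?tt' ?ti ?ir.
Qed.

Lemma lex_lt_irr r lam : ~ lex_lt r lam lam.
Proof. by move=> [t [_]]; rewrite ltxx. Qed.

Lemma flag_uniq s y T lam T' lam' : flag s y T lam -> flag s y T' lam' ->
  forall t, (t < s)%N -> T t = T' t /\ lam t = lam' t.
Proof.
elim: s y => // s IH y fl fl' t.
have Te : T s = T' s.
  by have [_ <-] := flag_tight fl; have [_ ->] := flag_tight fl'.
have le : lam s = lam' s.
  apply/le_anti/andP; split.
    by apply: (flag_max fl'); rewrite -Te; exact: (flag_tight (flag_pred fl)).1.
  by apply: (flag_max fl); rewrite Te; exact: (flag_tight (flag_pred fl')).1.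
rewrite ltnS leq_eqVlt => /orP[/eqP -> //|].
apply: IH (flag_pred fl) _ _; rewrite le Te; exact: flag_pred.
Qed.

(** Equivalently, the coordinates of [y] in a rational basis of the span of its face are, together
    with 1, linearly independent over the rationals. *)
Definition generic y : Prop := forall q : 'cV[rat]_n, (exists z : rat, ev q y = ratr z) ->
  forall v : 'rV[rat]_n, (v <= span (tight y))%MS -> (v *m q) 0 0 = 0.

(** Subtract the point of the current face until some form h becomes tight. Genericity makes the
    dimension drop by exactly one, passes to the remainder, and prevents the multiple subtracted
    from being rational. *)
Lemma flag_exists s y : incone y -> generic y -> rk (tight y) = s ->
  exists T lam, flag s y T lam /\ forall t, (t < s)%N -> forall z : rat, lam t <> ratr z.
Proof.
elim: s y => [|s IH] y yC gy rky.
  have Ty : tight y = HT.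
    apply: contrapT => Tn; have F : Face (tight y) by split=> //; exists y.
    apply: Tn; have [_ <-] := uP F.
    have -> : u (tight y) = 0.
      apply/eqP; rewrite -submx0; have := u_span F.
      by have /eqP := rky; rewrite mxrank_eq0 => /eqP ->.
    by rewrite map_mx0 tight0.
  by exists (fun=> HT), (fun=> 0); split=> //; split=> //; rewrite big_ord0; exact: pointed.
set T := tight y in rky; have F : Face T.
  by split; [move=> Te; rewrite Te rk_setT in rky|exists y].
have [uC uT] := uP F; pose q h := ev (ell h) y / ev (ell h) (uR T).
have [h0 h0T] : exists h, h \notin T.
  by have [/subsetPn[h _ hT]|] := boolP (~~ (HT \subset T)); [exists h|rewrite negbK finset.subTset => /eqP/F.1].
have [h hT hmin] := @arg_minP _ _ _ h0 (fun h => h \notin T) q h0T.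
pose lam := q h; pose y' := y - lam *: uR T.
have evh0 : 0 < ev (ell h) (uR T) by exact: ev_u.
have evy0 h' : h' \in T -> ev (ell h') y = 0 by rewrite inE => /eqP.
have y'C : incone y'.
  move=> h'; rewrite evD evN evZ; have [h'T|h'T] := boolP (h' \in T).
    by rewrite evy0 // ev_u0 // mulr0 subr0.
  by rewrite subr_ge0 -ler_pdivlMr ?ev_u //; exact: hmin.
have y'h : h \in tight y' by rewrite inE evD evN evZ /lam /q divfK ?subrr // gt_eqF.
have TT' : T \subset tight y'.
  by apply/fintype.subsetP => h' h'T; rewrite inE evD evN evZ evy0 // ev_u0 // mulr0 subr0.
have uh0 : (u T *m ell h) 0 0 != 0.
  by rewrite -(fmorph_eq0 (ratr : {rmorphism rat -> R})) /= -ev_ratr gt_eqF.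
(* The multiple of [ell h] makes the form vanish at [u T], so its value at y is the value of [q0] at
   y'; on the kernel of [ell h] nothing changes. *)
pose red q0 := q0 - ((u T *m q0) 0 0 / (u T *m ell h) 0 0) *: ell h.
have redE q0 : ev q0 y' = ev (red q0) y.
  rewrite /red evBZ evD evN evZ /lam /q !ev_ratr rmorphM fmorphV; congr (_ - _).
  by ring.
have redM q0 (v : 'rV_n) : (v *m ell h) 0 0 = 0 -> (v *m red q0) 0 0 = (v *m q0) 0 0.
  have subE (X Y : 'M[rat]_1) c : (X - c *: Y) 0 0 = X 0 0 - c * Y 0 0 by rewrite !mxE.
  by move=> vh; rewrite /red mulmxBr -scalemxAr subE vh mulr0 subr0.
have gy' : generic y'.
  move=> q0 [z qz] v vT'; rewrite -redM; last by move/spanP: vT'; exact.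
  apply: gy; first by exists z; rewrite -redE.
  by apply: submx_trans vT' _; exact: span_sub.
have rky' : rk (tight y') = s.
  have e : (span (tight y') :=: span T :&: kermx (ell h))%MS.
    apply/eqmxP/andP; split.
      rewrite sub_capmx span_sub //=; apply/row_subP => i; apply/sub_kermxP.
      apply/matrixP => i' j'; rewrite !ord1 [RHS]mxE.
      by move: y'h; apply/spanP; exact: row_sub.
    apply/row_subP => i; apply/spanP => h' h'T'.
    have := row_sub i (span T :&: kermx (ell h))%MS; rewrite sub_capmx => /andP[vT /sub_kermxP vh].
    (* Any other form tight at y' reduces to one with the rational value 0 at y, so by genericity it
       already vanishes on the kernel of [ell h] in the span of [T]. *)
    rewrite -redM; last by rewrite vh mxE.
    apply: gy vT; exists 0; rewrite -redE rmorph0.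
    by move: h'T'; rewrite inE => /eqP.
  have := mxrank_mul_ker (span T) (ell h); rewrite -e -/(rk T) -/(rk (tight y')) rky.
  have -> : \rank (span T *m ell h) = 1%N; last by rewrite add1n => -[].
  apply/eqP; rewrite eqn_leq rank_leq_col lt0n mxrank_eq0; apply: contra uh0 => /eqP WH.
  by have /submxP[D ->] := u_span F; rewrite -mulmxA WH mulmx0 mxE.
have [T' [lam' [fl' nr']]] := IH y' y'C gy' rky'.
have [y'E fl1 fl2] := fl'.
exists (fun t => if t == s then T else T' t), (fun t => if t == s then lam else lam' t); split.
  split=> [|t|t].
  - rewrite big_ord_recr /= eqxx -[LHS](subrK (lam *: uR T)) -/y' y'E; congr (_ + _).
    by apply: eq_bigr => i _; rewrite (ltn_eqF (ltn_ord i)).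
  - rewrite ltnS leq_eqVlt => /orP[/eqP ->|ts]; last by rewrite (ltn_eqF ts); exact: fl1.
    rewrite eqxx; split=> //; rewrite /lam /q divr_gt0 // lt_neqAle yC andbT eq_sym.
    by move: hT; rewrite inE.
  - rewrite ltnS => ts; rewrite (ltn_eqF ts); move: ts; rewrite leq_eqVlt => /orP[/eqP tsE|ts].
      rewrite tsE eqxx; have [_] := flag_tight fl'; case: (s) tsE => // _ [<-] <-; exact: TT'.
    by rewrite (ltn_eqF ts); exact: fl2.
move=> t; rewrite ltnS leq_eqVlt => /orP[/eqP -> z|ts]; last by rewrite (ltn_eqF ts); exact: nr'.
(* A rational multiple would give [ell h] a rational value at y, hence by genericity the value 0 at
   [u T]. *)
rewrite eqxx /lam => lz; case/eqP: uh0; apply: gy (u_span F).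
exists (z * (u T *m ell h) 0 0).
by rewrite rmorphM /= -lz -ev_ratr /q divfK // gt_eqF.
Qed.

End Flags.

(** * Generic points *)

(** The polynomial X^(q+1) - 2 is irreducible by Eisenstein's criterion, so 1 and the first q powers
    of a real root are independent over the rationals; division by a large integer makes these
    powers small. *)
Lemma rational_independence q (eps : realalg) : 0 < eps ->
  exists eta : 'I_q -> realalg, (forall j, 0 < eta j <= eps) /\
    forall (x : 'I_q -> rat) (z : rat),
      \sum_j ratr (x j) * eta j = ratr z -> forall j, x j = 0.
Proof.
move=> eps0; pose p : {poly int} := 'X^(q.+1) - 2%:P.
have sp : size p = q.+2 by rewrite size_XnsubC.
have pirr : irreducible_poly (map_poly intr p : {poly rat}).
  apply/irreducible_rat_int; apply: (@eisenstein_crit 2) => //.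
  - by rewrite sp.
  - by rewrite (monicP _) // monicXnsubC.
  - by rewrite /p coefB coefXn coefC.
  - move=> i; rewrite sp /= => iq; rewrite /p coefB coefXn coefC (ltn_eqF iq) sub0r.
    by case: i {iq} => [|i].
have pE : map_poly ratr (map_poly intr p : {poly rat}) = 'X^(q.+1) - 2%:P :> {poly realalg}.
  rewrite -map_poly_comp rmorphB /= map_polyXn map_polyC /= rmorph_int.
  by [].
have [al al02 alr] : exists2 al : realalg, 0 <= al <= 2 & root ('X^(q.+1) - 2%:P) al.
  apply: poly_ivt; first by rewrite ler0n.
  rewrite !hornerE expr0n /= sub0r oppr_le0 ler0n subr_ge0 /=.
  by rewrite exprS ler_peMr ?ler0n // exprn_ege1 // ler1n.
have al0 : 0 < al.
  rewrite lt_neqAle (andP al02).1 andbT eq_sym; apply: contraTneq alr => ->.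
  by rewrite rootE !hornerE expr0n /= sub0r oppr_eq0 pnatr_eq0.
pose M := (Num.truncn (\sum_(j < q) al ^+ j.+1 / eps)).+1.
have M0 : 0 < M%:R :> realalg by rewrite ltr0n.
exists (fun j => al ^+ j.+1 / M%:R); split=> [j|x z xz j].
  rewrite divr_gt0 ?exprn_gt0 //= ler_pdivrMr // mulrC -ler_pdivrMr //.
  apply: (le_trans _ (ltW (truncnS_gt _))).
  rewrite (bigD1 j) //= lerDl sumr_ge0 // => i _.
  by rewrite divr_ge0 ?exprn_ge0 // ltW.
pose P : {poly rat} := \poly_(i < q.+1) (if i is i'.+1 then oapp x 0 (insub i') else - (M%:R * z)).
have PE : (map_poly ratr P).[al] = 0.
  rewrite (@horner_coef_wide _ q.+1); last by rewrite (leq_trans (size_poly _ _)) ?size_poly.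
  rewrite big_ord_recl coef_map coef_poly /= expr0 mulr1 rmorphN rmorphM rmorph_nat /= -xz.
  rewrite mulr_sumr addrC; apply/eqP; rewrite subr_eq0; apply/eqP; apply: eq_bigr => i _.
  rewrite coef_map coef_poly /= /bump /= add1n ltnS ltn_ord.
  rewrite valK /=.
  by rewrite [RHS]mulrCA [M%:R * _]mulrC divfK ?gt_eqF.
have P0 : P = 0.
  apply: contrapT => /eqP Pn0.
  have cop : coprimep (map_poly intr p : {poly rat}) P.
    rewrite irreducible_poly_coprime //; apply/negP => /(dvdp_leq Pn0).
    by rewrite size_map_inj_poly ?sp // ?rmorph0 // => [/leq_trans/(_ (size_poly _ _))|]; rewrite ?ltnn //; exact: intr_inj.
  have := cop; rewrite -(coprimep_map (ratr : {rmorphism rat -> realalg})) /= pE.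
  by move=> /coprimep_root/(_ alr); rewrite PE eqxx.
have := congr1 (fun P : {poly rat} => P`_j.+1) P0.
by rewrite coef_poly coef0 ltnS ltn_ord valK.
Qed.

Section GenericPoint.
Variables (R : archiRealFieldType) (n : nat) (H : finType) (ell : H -> 'cV[rat]_n).
Variable u0 : 'rV[rat]_n.
Hypothesis Rindep : forall q (eps : R), 0 < eps -> exists eta : 'I_q -> R,
  (forall j, 0 < eta j <= eps) /\
  forall (x : 'I_q -> rat) (z : rat),
    \sum_j ratr (x j) * eta j = ratr z -> forall j, x j = 0.
Local Notation uR := (map_mx (ratr : rat -> R)).
Local Notation T0 := (tight ell (uR u0)).
Hypothesis u0C : incone ell (uR u0).

Lemma pos_lower_bound (f : H -> R) : (forall h, 0 < f h) ->
  exists2 eps, 0 < eps & forall h, eps <= f h.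
Proof.
move=> f0; have S0 : 0 < 1 + \sum_h (f h)^-1.
  by rewrite addrC ltr_wpDl // sumr_ge0 // => h _; rewrite invr_ge0 ltW.
exists (1 + \sum_h (f h)^-1)^-1; first by rewrite invr_gt0.
move=> h; rewrite -[f h]invrK lef_pV2 ?posrE ?invr_gt0 //.
rewrite (bigD1 h) //= addrCA lerDl addr_ge0 // sumr_ge0 // => i _.
by rewrite invr_ge0 ltW.
Qed.

(** Perturb the interior point [u0] inside the span of its face by small rationally independent
    multiples of spanning vectors, then scale down by a rational number, which preserves
    independence. *)
Lemma generic_point : exists delta : 'rV[R]_n,
  [/\ incone ell delta, tight ell delta = T0, forall h, ev (ell h) delta < 1 &
    forall (w : 'rV[rat]_n) (q : 'cV[rat]_n), (exists z : rat, ev q (uR w + delta) = ratr z) ->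
      forall v : 'rV[rat]_n, (v <= span ell T0)%MS -> (v *m q) 0 0 = 0].
Proof.
pose b j := row j (span ell T0); pose S h := 1 + \sum_j `|ev (ell h) (uR (b j))|.
have S1 h : 1 <= S h by rewrite lerDl sumr_ge0.
(* The bound keeps the perturbation of a nonzero form strictly below its value at [u0], so it stays
   positive and less than doubles; forms in [T0] impose nothing and get the dummy value 1. *)
pose f h := if h \in T0 then 1 else ev (ell h) (uR u0) / (S h *+ 2).
have S20 h : 0 < S h *+ 2 by rewrite pmulrn_lgt0 // (lt_le_trans ltr01).
have ev0' h : h \notin T0 -> 0 < ev (ell h) (uR u0).
  by rewrite inE => hn; rewrite lt_neqAle u0C andbT eq_sym.
have [h|eps eps0 epsP] := @pos_lower_bound f.
  by rewrite /f; case: ifP => // /negbT hT; rewrite divr_gt0 // ev0'.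
have [eta [eta0 etaP]] := @Rindep n eps eps0.
pose z := uR u0 + \sum_j eta j *: uR (b j).
have evz q : ev q z = ev q (uR u0) + \sum_j eta j * ev q (uR (b j)).
  by rewrite evD ev_sum; congr (_ + _); apply: eq_bigr => j _; rewrite evZ.
have evT h : h \in T0 -> ev (ell h) z = 0.
  move=> hT; rewrite evz; move: (hT); rewrite inE => /eqP ->; rewrite add0r big1 // => j _.
  have /spanP/(_ h hT) e : (b j <= span ell T0)%MS by exact: row_sub.
  by rewrite ev_ratr e rmorph0 mulr0.
have evnT h : h \notin T0 -> 0 < ev (ell h) z < ev (ell h) (uR u0) *+ 2.
  move=> hT; rewrite evz mulr2n; have g0 := ev0' _ hT; set g := ev _ _ in g0 *.
  have : `|\sum_j eta j * ev (ell h) (uR (b j))| < g.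
    have le : `|\sum_j eta j * ev (ell h) (uR (b j))| <= eps * S h.
      apply: (le_trans (ler_norm_sum _ _ _)); rewrite mulrDr mulr1 mulr_sumr.
      apply: (@le_trans _ _ (\sum_j eps * `|ev (ell h) (uR (b j))|)); last by rewrite lerDr ltW.
      apply: ler_sum => j _; have /andP[e0 e1] := eta0 j.
      by rewrite normrM (ger0_norm (ltW e0)) ler_wpM2r.
    apply: (le_lt_trans le); have := epsP h; rewrite /f (negbTE hT) -/g => e.
    apply: (@le_lt_trans _ _ (g / (S h *+ 2) * S h)).
      by rewrite ler_wpM2r // (le_trans ler01 (S1 h)).
    rewrite mulrAC ltr_pdivrMr // mulrnAr mulr2n ltrDl mulr_gt0 //.
    exact: lt_le_trans (S1 h).
  by rewrite ltr_norml => /andP[l1 l2]; apply/andP; split; lra.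
(* Each form at z is at most twice its value at [u0], so this factor brings all of them below 1. *)
pose c0 : rat := (1 + \sum_h ((u0 *m ell h) 0 0) *+ 2)^-1.
have c0E : ratr c0 = (1 + \sum_h ev (ell h) (uR u0) *+ 2)^-1 :> R.
  rewrite fmorphV rmorphD rmorph1 rmorph_sum; congr (_ + _)^-1.
  by apply: eq_bigr => h _; rewrite rmorphMn ev_ratr.
have c00 : 0 < ratr c0 :> R.
  rewrite c0E invr_gt0 addrC ltr_wpDl // sumr_ge0 // => h _; exact: mulrn_wge0.
exists (ratr c0 *: z); split.
- move=> h; rewrite evZ; have [hT|/evnT/andP[e _]] := boolP (h \in T0); first by rewrite evT // mulr0.
  by rewrite ltW // mulr_gt0.
- rewrite (tightZ ell z c00); apply/setP => h; have [hT|/evnT/andP[e _]] := boolP (h \in T0).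
    by rewrite inE evT // eqxx.
  by rewrite inE gt_eqF.
- move=> h; rewrite evZ; have [hT|/evnT/andP[_ e]] := boolP (h \in T0).
    by rewrite evT // mulr0 ltr01.
  have B0 : 0 < 1 + \sum_h ev (ell h) (uR u0) *+ 2 by rewrite -invr_gt0 -c0E.
  rewrite c0E mulrC (ltr_pdivrMr _ _ B0) mul1r; apply: lt_le_trans e _.
  rewrite (bigD1 h) //= addrCA lerDl addr_ge0 // sumr_ge0 // => i _; exact: mulrn_wge0.
move=> w q [x]; rewrite evD evZ evz !ev_ratr => e v /submxP[D ->].
suff bq j : (b j *m q) 0 0 = 0.
  suff e0 : span ell T0 *m q = 0 by rewrite -mulmxA e0 mulmx0 mxE.
  by apply/matrixP => i j; rewrite !ord1 [RHS]mxE -(bq i) /b -row_mul [RHS]mxE.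
move: j; apply: (etaP (fun j => (b j *m q) 0 0) ((x - (w *m q) 0 0) / c0 - (u0 *m q) 0 0)).
rewrite rmorphB fmorph_div rmorphB /= -e [ratr ((w *m q) 0 0) + _]addrC addrK.
rewrite mulrAC mulfV ?gt_eqF // mul1r addrAC subrr add0r.
by apply: eq_bigr => j _; rewrite ev_ratr mulrC.
Qed.

End GenericPoint.

(** * Faces of the Veronese cone *)

Section VeroneseFaces.
Variables (R : archiRealFieldType) (n d : nat) (a : 'I_n -> nat).
Hypothesis d_gt0 : (0 < d)%N.
Local Notation mon := 'X_{1..n}.
Local Notation vcone := (vcone d a).

Definition mvec (F : numFieldType) (m : mon) : 'rV[F]_n := \row_i (m i)%:R.

Lemma mvecD F m m' : mvec F (m + m')%MM = mvec F m + mvec F m'.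
Proof. by apply/rowP => i; rewrite !mxE mnmDE natrD. Qed.

Lemma mvec_muln F m k : mvec F (m *+ k)%MM = k%:R *: mvec F m.
Proof. by apply/rowP => i; rewrite !mxE mulmnE natrM mulrC. Qed.

Lemma mvec_ratr m : map_mx ratr (mvec rat m) = mvec R m.
Proof. by apply/rowP => i; rewrite !mxE rmorph_nat. Qed.

Lemma mvec_sum F m : \sum_j mvec F m 0 j = (mdeg m)%:R.
Proof. by rewrite mdegE natr_sum; apply: eq_bigr => j _; rewrite mxE. Qed.

(* b_i >= 0 and a_i |b| >= d b_i *)
Definition vell (h : 'I_n + 'I_n) : 'cV[rat]_n := \col_j
  match h with
  | inl i => (j == i)%:R
  | inr i => (a i)%:R - (d * (j == i))%:R
  end.

Lemma ev_inl i (y : 'rV[R]_n) : ev (vell (inl i)) y = y 0 i.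
Proof.
rewrite /ev mxE (bigD1 i) //= big1 => [|j /negbTE ji]; rewrite !mxE ?eqxx ?ji rmorph_nat.
  by rewrite mulr1 addr0.
by rewrite mulr0.
Qed.

Lemma ev_inr i (y : 'rV[R]_n) :
  ev (vell (inr i)) y = (a i)%:R * (\sum_j y 0 j) - d%:R * y 0 i.
Proof.
rewrite /ev mxE.
under eq_bigr do rewrite !mxE rmorphB !rmorph_nat mulrBr.
rewrite big_split /= sumrN mulr_sumr; congr (_ - _).
  by apply: eq_bigr => j _; rewrite mulrC.
rewrite (bigD1 i) //= big1 => [|j /negbTE ->]; last by rewrite muln0 mulr0.
by rewrite eqxx muln1 addr0 mulrC.
Qed.

Local Notation tight := (tight vell).
Local Notation incone := (@incone R n _ vell).

Lemma vell_pointed (y : 'rV[R]_n) : tight y = [set: 'I_n + 'I_n]%SET -> y = 0.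
Proof.
move=> Ty; apply/rowP => i; rewrite mxE; apply/eqP.
have : inl i \in tight y by rewrite Ty inE.
by rewrite inE ev_inl.
Qed.

Lemma vcone_incone k m : vcone k m -> incone (mvec R m).
Proof.
move=> /vconeP[mk ma] [i|i]; first by rewrite ev_inl mxE.
rewrite ev_inr mvec_sum mk mxE -!natrM subr_ge0 ler_nat.
by have := ma i; nia.
Qed.

(** The forms are integral on exponent vectors, so a value above -1 is nonnegative. *)
Lemma vcone_sub k l m w : vcone k m -> vcone l w ->
  (forall h, -1 < ev (vell h) (mvec R m - mvec R w)) ->
  [/\ (l <= k)%N, (w <= m)%MM & vcone (k - l) (m - w)%MM].
Proof.
move=> /vconeP[mk ma] /vconeP[wl wa] ge.
have wm : (w <= m)%MM.
  apply/mnm_lepP => i; have := ge (inl i); rewrite ev_inl !mxE => ge1.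
  have : (w i)%:R < (m i).+1%:R :> R by rewrite -natr1; lra.
  by rewrite ltr_nat ltnS.
have lk : (l <= k)%N.
  by rewrite -(leq_pmul2r d_gt0) -mk -wl -(submK wm) mdegD leq_addl.
have mdB : mdeg (m - w)%MM = ((k - l) * d)%N.
  by have := congr1 mdeg (submK wm); rewrite mdegD mk wl mulnBl => <-; rewrite addnK.
split=> //; apply/vconeP; split=> // i.
have := ge (inr i); rewrite ev_inr.
have -> : mvec R m - mvec R w = mvec R (m - w)%MM.
  by rewrite -{1}(submK wm) mvecD addrK.
rewrite mvec_sum mdB !mxE -!natrM => ge1.
have : (d * (m - w)%MM i)%:R < (a i * ((k - l) * d)).+1%:R :> R by rewrite -natr1; lra.
by rewrite ltr_nat ltnS mulnA [(_ * d)%N]mulnC leq_pmul2l // mulnC.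
Qed.

(** The integral point has the same saturated, vanishing and free coordinates as y. With A and sD
    the sums of the a_i over free and over saturated i, saturated coordinates become A a_i and free
    ones (d - sD) a_i, which gives degree A d; the point y itself shows that 0 < d - sD < A when
    there are free coordinates. *)
Lemma vcone_face (y : 'rV[R]_n) : incone y -> y != 0 ->
  exists k m, [/\ (0 < k)%N, vcone k m & tight (mvec R m) = tight y].
Proof.
move=> yC y0; pose s := \sum_j y 0 j.
have yi i : 0 <= y 0 i by have := yC (inl i); rewrite ev_inl.
have ya i : d%:R * y 0 i <= (a i)%:R * s by have := yC (inr i); rewrite ev_inr subr_ge0.
have s0 : 0 < s.
  rewrite lt_neqAle sumr_ge0 ?andbT // eq_sym; apply: contraNneq y0 => se.
  apply/eqP/rowP => i; rewrite mxE; apply/eqP; move: se => /eqP.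
  by rewrite psumr_eq0 // => /allP/(_ i); rewrite mem_index_enum; apply.
have d0 : 0 < d%:R :> R by rewrite ltr0n.
pose D i := d%:R * y 0 i == (a i)%:R * s.
pose fr i := (y 0 i != 0) && ~~ D i.
have frP i : fr i -> (0 < y 0 i) /\ d%:R * y 0 i < (a i)%:R * s.
  by move=> /andP[i0 iD]; rewrite !lt_neqAle yi ya iD eq_sym i0.
pose A := (\sum_(i | fr i) a i)%N; pose sD := (\sum_(i | D i) a i)%N.
have sE : (d%:R - sD%:R) * s = d%:R * \sum_(i | fr i) y 0 i.
  have sDE : sD%:R * s = \sum_(i | D i) (a i)%:R * s by rewrite natr_sum mulr_suml.
  rewrite mulrBl sDE {1}/s mulr_sumr (bigID D) /=.
  rewrite (eq_bigr (fun i => (a i)%:R * s)) => [|i /eqP //].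
  rewrite addrAC subrr add0r mulr_sumr [LHS](bigID (fun i => y 0 i == 0)) /=.
  rewrite big1 => [|i /andP[_ /eqP ->]]; last by rewrite mulr0.
  by rewrite add0r; apply: eq_bigl => i; rewrite /fr andbC.
(* Without free coordinates A may be replaced by 1, as then sD = d. *)
pose A' := if A == 0%N then 1%N else A.
have A'0 : (0 < A')%N by rewrite /A'; case: eqP => // /eqP; rewrite -lt0n.
have sy0 : 0 <= \sum_(i | fr i) y 0 i by apply: sumr_ge0.
have [sDd dA frA] : [/\ sD <= d, (d - sD) * A = A' * (d - sD) &
    forall i, fr i -> 0 < d - sD < A']%N.
  case: (pickP fr) => [i0 fi0|f0].
    have y0' : 0 < \sum_(i | fr i) y 0 i.
      have [yi0 _] := frP _ fi0.
      by rewrite (bigD1 i0) //= ltr_wpDr // sumr_ge0.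
    have sDd : (sD < d)%N.
      have : 0 < (d%:R - sD%:R) * s by rewrite sE mulr_gt0.
      by rewrite pmulr_lgt0 // subr_gt0 ltr_nat.
    have dA : (d - sD < A)%N.
      have : (d%:R - sD%:R) * s < A%:R * s.
        rewrite sE /A natr_sum mulr_suml mulr_sumr (bigD1 i0) //= [ltRHS](bigD1 i0) //=.
        rewrite ltr_leD ?(frP _ fi0).2 //; apply: ler_sum => i /andP[fi _].
        exact: ltW (frP _ fi).2.
      by rewrite ltr_pM2r // -natrB ?ltr_nat // ltnW.
    have AA : A' = A by rewrite /A'; case: eqP dA => // ->.
    rewrite AA; split; [exact: ltnW|exact: mulnC|].
    by move=> i _; rewrite subn_gt0 sDd dA.
  have A0 : A = 0%N by rewrite /A big_pred0.
  have dE : d = sD.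
    have /eqP := sE; rewrite big_pred0 // mulr0 mulf_eq0 (gt_eqF s0) orbF subr_eq0 eqr_nat.
    by move/eqP.
  by rewrite -dE subnn muln0; split=> // i; rewrite f0.
pose m : mon := [multinom (if D i then A' * a i else if (y 0 i == 0)%R then 0 else (d - sD) * a i)%N | i < n].
have mE i : m i = (if D i then A' * a i else if (y 0 i == 0)%R then 0 else (d - sD) * a i)%N by rewrite mnmE.
have mv : vcone A' m.
  apply/vconeP; split=> [|i]; last first.
    rewrite mE; case: ifP => // Di; case: ifP => // yi0.
    have fi : fr i by rewrite /fr yi0 Di.
    by rewrite leq_mul2r ltnW ?orbT //; have /andP[] := frA _ fi.
  rewrite mdegE; under eq_bigr do rewrite mE.
  rewrite (bigID D) /= (eq_bigr (fun i => A' * a i)%N) => [|i ->] //.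
  rewrite -big_distrr /= -/sD (bigID (fun i => y 0 i == 0)) /= big1 => [|i /andP[/negbTE -> ->]] //.
  rewrite (eq_bigl fr) => [|i]; last by rewrite /fr andbC.
  rewrite (eq_bigr (fun i => (d - sD) * a i)%N) => [|i /andP[/negbTE -> /negbTE ->]] //.
  by rewrite -big_distrr /= -/A dA add0n -mulnDr subnKC.
have ai0 i : ~~ D i -> (0 < a i)%N.
  rewrite lt0n; apply: contraNneq => a0; rewrite /D a0 mul0r.
  have := ya i; rewrite a0 mul0r pmulr_rle0 // => yi0.
  by rewrite mulf_eq0 [y 0 i == 0]eq_le yi0 yi orbT.
exists A', m; split=> //; apply/setP => -[i|i]; rewrite !inE.
  rewrite !ev_inl mxE mE pnatr_eq0; have [Di|Di] := boolP (D i).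
    rewrite muln_eq0 (gtn_eqF A'0) /=; move: Di => /eqP Di.
    apply/eqP/eqP => [a0|yi0].
      by move/eqP: Di; rewrite a0 mul0r mulf_eq0 (gt_eqF d0) => /eqP.
    by move/eqP: Di; rewrite yi0 mulr0 eq_sym mulf_eq0 (gt_eqF s0) orbF pnatr_eq0 => /eqP.
  case: ifPn => // yi0; rewrite ?eqxx // muln_eq0; apply/negbTE; rewrite negb_or -!lt0n ai0 // andbT.
  have fi : fr i by rewrite /fr yi0 Di.
  by have /andP[] := frA _ fi.
rewrite !ev_inr mvec_sum !mxE (proj1 (vconeP _ _ _ _ mv)) mE !subr_eq0 -!natrM eqr_nat.
rewrite [RHS]eq_sym -/(D i); have [Di|Di] := boolP (D i).
  by rewrite mulnA [(_ * d)%N]mulnC [(a i * _)%N]mulnC eqxx.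
apply/negbTE; rewrite neq_ltn; apply/orP; right.
rewrite mulnA [X in (_ < X)%N]mulnC ltn_pmul2l // [X in (_ < X)%N]mulnC.
case: ifPn => yi0; first by rewrite muln_gt0 A'0 ai0.
have fi : fr i by rewrite /fr yi0 Di.
by rewrite ltn_pmul2r ?ai0 //; have /andP[] := frA _ fi.
Qed.

End VeroneseFaces.

(* Every c in C is [e c] plus [J c s] copies of the point [fl c s] of the
   s-dimensional face in its flag; replacing some of these points by other
   ones of the same dimension increases c. *)
Definition flag_system n d (a : 'I_n -> nat) (r M : nat) (U : 'I_r -> seq 'X_{1..n})
    (fl : 'X_{1..n} -> 'I_r -> 'X_{1..n}) (J : 'X_{1..n} -> 'I_r -> nat)
    (e : 'X_{1..n} -> 'X_{1..n}) (prec : 'X_{1..n} -> 'X_{1..n} -> Prop) : Prop :=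
  [/\ (0 < M)%N /\ (forall s, uniq (U s) /\ {in U s, forall v, vcone d a M v}),
      (forall x y z, prec x y -> prec y z -> prec x z) /\ (forall x, ~ prec x x),
      (forall k c, vcone d a k c -> [/\ forall s, fl c s \in U s,
         c = (e c + \sum_s fl c s *+ J c s)%MM & exists l, vcone d a l (e c)]),
      (forall k c (j : 'I_r -> nat), vcone d a k c -> let c' := (e c + \sum_s fl c s *+ j s)%MM in
         [/\ fl c' =1 fl c, J c' =1 j & e c' = e c]) &
      (forall k c (l : seq 'I_r) vs, vcone d a k c -> (forall s, count_mem s l = J c s) ->
         all2 (fun s v => v \in U s) l vs -> vs != map (fl c) l ->
         prec c (e c + \sum_(v <- vs) v)%MM)].

Section FlagSystem.
Variables (R : archiRealFieldType) (n d : nat) (a : 'I_n -> nat).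
Hypothesis d_gt0 : (0 < d)%N.
Hypothesis Rindep : forall q (eps : R), 0 < eps -> exists eta : 'I_q -> R,
  (forall j, 0 < eta j <= eps) /\
  forall (x : 'I_q -> rat) (z : rat),
    \sum_j ratr (x j) * eta j = ratr z -> forall j, x j = 0.
Local Notation mon := 'X_{1..n}.
Local Notation vcone := (vcone d a).
Local Notation H := ('I_n + 'I_n)%type.
Local Notation ell := (vell d a).
Local Notation tight := (tight ell).
Local Notation incone := (@incone R n _ ell).
Local Notation Face := (@Face R n _ ell).
Local Notation rk := (rk ell).

Lemma vcone_muln k m q : vcone k m -> vcone (q * k) (m *+ q)%MM.
Proof.
move=> /vconeP[mk ma]; apply/vconeP; split=> [|i]; first by rewrite mdegMn mk mulnC mulnA.
by rewrite mulmnE [(m i * q)%N]mulnC -mulnA leq_mul2l ma orbT.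
Qed.

Lemma vcone_sum I (s : seq I) (f : I -> mon) (g : I -> nat) :
  (forall i, vcone (g i) (f i)) -> vcone (\sum_(i <- s) g i)%N (\sum_(i <- s) f i)%MM.
Proof.
move=> fg; elim/big_ind2 : _ => [|k m l w mk wl|i _]; [|exact: vconeD|exact: fg].
by apply/vconeP; rewrite mdeg0; split=> // i; rewrite mnm0E.
Qed.

Lemma mvec_bigsum F I (s : seq I) (f : I -> mon) :
  mvec F (\sum_(i <- s) f i)%MM = \sum_(i <- s) mvec F (f i).
Proof.
elim/big_ind2 : _ => // [|m x m' y <- <-]; last exact: mvecD.
by apply/rowP => i; rewrite !mxE mnm0E.
Qed.

Lemma face_points : exists M (u : {set H} -> mon), (0 < M)%N /\
  forall T, Face T -> vcone M (u T) /\ tight (mvec R (u T)) = T.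
Proof.
have /choice[f fP] (T : {set H}) : exists km : nat * mon, (0 < km.1)%N /\
    (Face T -> vcone km.1 km.2 /\ tight (mvec R km.2) = T).
  have [[Tn [y yC yT]]|F] := pselect (Face T); last by exists (1%N, 0%MM).
  have [|k [m [k0 mk mT]]] := vcone_face d_gt0 yC.
    by apply/eqP => y0; apply: Tn; rewrite -yT y0 tight0.
  by exists (k, m); rewrite mT yT.
pose M := (\prod_(T : {set H}) (f T).1)%N.
have M0 : (0 < M)%N by rewrite prodn_gt0 // => T; have [] := fP T.
have dM T : ((f T).1 %| M)%N by rewrite /M (bigD1 T) //= dvdn_mulr.
exists M, (fun T => ((f T).2 *+ (M %/ (f T).1))%MM); split=> // T FT.
have [k0 /(_ FT)[mk mT]] := fP T; split.
  by rewrite -{1}(divnK (dM T)); exact: vcone_muln.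
by rewrite mvec_muln tightZ // ltr0n divn_gt0 // dvdn_leq.
Qed.

(** A point in the relative interior of the cone of C: the forms vanishing on it are those vanishing
    on all of C. *)
Definition gen_sum : mon := (\sum_(v <- veronese_gens a d) v)%MM.
Definition cone_span : {set H} := tight (mvec R gen_sum).

Lemma gen_sum_vcone : vcone (size (veronese_gens a d)) gen_sum.
Proof.
rewrite -sum1_size /gen_sum big_seq [X in vcone _ X]big_seq.
elim/big_ind2 : _ => // [|k m l w mk wl|v]; last by rewrite mem_veronese.
  by apply/vconeP; rewrite mdeg0; split=> // i; rewrite mnm0E.
exact: vconeD.
Qed.

Lemma cone_span_sub k m : vcone k m -> cone_span \subset tight (mvec R m).
Proof.
elim: k m => [|k IH] m mk.
  rewrite (vcone0 mk); have -> : mvec R (0%MM : mon) = 0 by apply/rowP => i; rewrite !mxE mnm0E.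
  by rewrite tight0 finset.subsetT.
have [[w [w1 wm wk]] _] := vcone_split d_gt0 mk.
rewrite -(submK wm) mvecD tightD; try by apply: vcone_incone; eassumption.
rewrite finset.subsetI IH //=.
have wL : w \in veronese_gens a d by rewrite mem_veronese.
rewrite /cone_span /gen_sum (big_rem w) //= mvecD tightD ?finset.subsetIl //.
  exact: (vcone_incone R d_gt0 w1).
rewrite mvec_bigsum => h; rewrite ev_sum big_seq sumr_ge0 // => v /mem_rem.
rewrite mem_veronese => vL; exact: (vcone_incone R d_gt0 vL h).
Qed.

Lemma mvec_span k m : vcone k m -> (mvec rat m <= span ell cone_span)%MS.
Proof.
move=> mk; apply/spanP => h /(fintype.subsetP (cone_span_sub mk)).
by rewrite inE -mvec_ratr ev_ratr fmorph_eq0 => /eqP.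
Qed.

Lemma flag_system_exists : exists M U fl J e prec,
  @flag_system n d a (rk cone_span) M U fl J e prec.
Proof.
have [M [u [M0 uP0]]] := face_points.
have uP T : Face T -> incone (map_mx ratr (mvec rat (u T))) /\ tight (map_mx (ratr : rat -> R) (mvec rat (u T))) = T.
  by move=> /uP0[uM uT]; rewrite mvec_ratr; split=> //; exact: (vcone_incone R d_gt0 uM).
have [|delta [dC dT d1 dgen]] := @generic_point R n _ ell (mvec rat gen_sum) Rindep.
  by rewrite mvec_ratr; exact: (vcone_incone R d_gt0 gen_sum_vcone).
rewrite mvec_ratr -/cone_span in dT dgen.
set r := rk cone_span; pose flag := @flag R n _ ell (fun T => mvec rat (u T)).
have pointed := @vell_pointed R n d a.
have /choice[Tl TlP] (c : mon) : exists Tl : (nat -> {set H}) * (nat -> R), forall k, vcone k c ->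
    flag r (mvec R c + delta) Tl.1 Tl.2 /\ forall t, (t < r)%N -> forall z : rat, Tl.2 t <> ratr z.
  have [[k ck]|cn] := pselect (exists k, vcone k c); last first.
    by exists (fun _ : nat => cone_span, fun _ : nat => 0 : R) => k ck; case: cn; exists k.
  have cT : tight (mvec R c + delta) = cone_span.
    rewrite tightD //; last exact: (vcone_incone R d_gt0 ck).
    by rewrite dT; apply/finset.setIidPr; exact: cone_span_sub ck.
  have [|||T [lam Tlam]] := @flag_exists R n _ ell pointed _ uP r (mvec R c + delta).
  - by apply: inconeD => //; exact: (vcone_incone R d_gt0 ck).
  - by move=> q qz v; rewrite cT; apply: (dgen (mvec rat c)); rewrite mvec_ratr; exact: qz.
  - by rewrite cT.
  by exists (T, lam).
pose U (s : 'I_r) := [seq u T | T <- enum {set H} & `[< Face T >] && (rk T == s.+1)].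
have UP s v : v \in U s -> exists T, [/\ Face T, rk T = s.+1 & v = u T].
  move=> /mapP[T]; rewrite mem_filter => /andP[/andP[/asboolP FT /eqP rT] _ ->].
  by exists T.
have uinj T : Face T -> tight (mvec R (u T)) = T by move=> /uP0[].
pose fl c (s : 'I_r) := u ((Tl c).1 s); pose lam c := (Tl c).2.
pose J c (s : 'I_r) := Num.truncn (lam c s).
pose e c := (c - \sum_s fl c s *+ J c s)%MM.
have lamP k c : vcone k c -> forall t, (t < r)%N -> [/\ Face ((Tl c).1 t), rk ((Tl c).1 t) = t.+1 & 0 < lam c t].
  by move=> /TlP[[_ + _] _]; apply.
(* The lower inequality is strict because no flag coefficient is rational. *)
have fracP k c (s : 'I_r) : vcone k c -> 0 < lam c s - (J c s)%:R < 1.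
  move=> ck; have [_ _ l0] := lamP _ _ ck _ (ltn_ord s).
  have /andP[l1 l2] := truncn_itv (ltW l0); rewrite subr_gt0 ltrBlDl natr1 l2 andbT.
  rewrite lt_neqAle l1 andbT; apply/eqP => lE.
  have [_ /(_ _ (ltn_ord s) (J c s)%:R)] := TlP _ _ ck; apply.
  by rewrite rmorph_nat lE.
have flM k c s : vcone k c -> vcone M (fl c s).
  by move=> ck; have [/uP0[] ] := lamP _ _ ck _ (ltn_ord s).
have wM k c (j : 'I_r -> nat) : vcone k c -> vcone (\sum_s j s * M)%N (\sum_s fl c s *+ j s)%MM.
  by move=> ck; apply: vcone_sum => s; apply: vcone_muln; exact: flM ck.
have wE c (j : 'I_r -> nat) : mvec R (\sum_s fl c s *+ j s)%MM = \sum_s (j s)%:R *: mvec R (fl c s).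
  by rewrite mvec_bigsum; apply: eq_bigr => s _; rewrite mvec_muln.
have yE k c : vcone k c -> mvec R c + delta = \sum_(s < r) lam c s *: mvec R (fl c s).
  by move=> /TlP[[-> _ _] _]; apply: eq_bigr => s _; rewrite mvec_ratr.
(* Removing the integral parts from c leaves a nonnegative combination minus [delta], on which every
   form exceeds -1. *)
have eP k c : vcone k c -> c = (e c + \sum_s fl c s *+ J c s)%MM /\ exists l, vcone l (e c).
  move=> ck; have [h|lk wc ec] := @vcone_sub R n d a d_gt0 _ _ _ _ ck (wM _ _ (J c) ck).
    have -> : mvec R c = (mvec R c + delta) - delta by rewrite addrK.
    rewrite (yE _ _ ck) wE addrAC -sumrB evD evN ev_sum.
    have := d1 h; suff : 0 <= \sum_(s < r) ev (ell h) (lam c s *: mvec R (fl c s) - (J c s)%:R *: mvec R (fl c s)) by lra.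
    apply: sumr_ge0 => s _; rewrite -scalerBl evZ mulr_ge0 //.
      by have /andP[/ltW] := fracP _ _ s ck.
    exact: (vcone_incone R d_gt0 (flM _ _ s ck) h).
  by split; [rewrite submK|exists (k - \sum_s J c s * M)%N].
have eE k c : vcone k c -> mvec R (e c) + delta = \sum_(s < r) (lam c s - (J c s)%:R) *: mvec R (fl c s).
  move=> ck; have := yE _ _ ck; rewrite {1}(eP _ _ ck).1 mvecD addrAC wE => /(canRL (addrK _)) ->.
  by rewrite -sumrB; apply: eq_bigr => s _; rewrite scalerBl.
exists M, U, fl, J, e, (fun c c' => lex_lt r (lam c) (lam c')); split.
- split=> // s; split; last by move=> v /UP[T [/uP0[uM _] _ ->]].
  rewrite map_inj_in_uniq; first by apply: filter_uniq; exact: enum_uniq.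
  move=> T T'; rewrite !mem_filter.
  move=> /andP[/andP[/asboolP FT _] _] /andP[/andP[/asboolP FT' _] _] uTT'.
  by rewrite -(uinj _ FT) uTT' uinj.
- by split=> [x y z|x]; [exact: lex_lt_trans|exact: lex_lt_irr].
- move=> k c ck; have [ce el] := eP _ _ ck; split=> // s.
  have [FT rT _] := lamP _ _ ck _ (ltn_ord s).
  by apply: map_f; rewrite mem_filter mem_enum rT eqxx !andbT; apply/asboolP.
- move=> k c j ck c'; have [ce [l el]] := eP _ _ ck; have c'C : vcone _ c' := vconeD el (wM _ _ j ck).
  pose lam' t := if insub t is Some s then lam c (val s) - (J c s)%:R + (j s)%:R else 0.
  have lam'E (s : 'I_r) : lam' s = lam c s - (J c s)%:R + (j s)%:R by rewrite /lam' valK.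
  (* The fractional parts are positive, so any numbers of copies give positive coefficients along
     the same flag; by uniqueness this is the flag chosen for c'. *)
  have fl' : flag r (mvec R c' + delta) (Tl c).1 lam'.
    have [[_ TP Tsub] _] := TlP _ _ ck; split=> // [|t tr].
      rewrite /c' mvecD wE addrAC (eE _ _ ck) -big_split /=; apply: eq_bigr => s _.
      by rewrite mvec_ratr lam'E -scalerDl.
    have [FT rT _] := TP t tr; split=> //; rewrite (lam'E (Ordinal tr)) ltr_pwDl //.
    by have /andP[] := fracP _ _ (Ordinal tr) ck.
  have [flc' _] := TlP _ _ c'C; have uq := flag_uniq pointed uP flc' fl'.
  have flE : fl c' =1 fl c by move=> s; rewrite /fl (uq _ (ltn_ord s)).1.
  have JE : J c' =1 j.
    move=> s; have [_ le] := uq _ (ltn_ord s); rewrite /J [lam c' s]le lam'E.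
    have /andP[f0 f1] := fracP _ _ s ck.
    apply: truncn_def; rewrite -natr1 lerDr ltW //= addrC ltrD2l //.
  split=> //; rewrite /e; have -> : (\sum_s fl c' s *+ J c' s = \sum_s fl c s *+ j s)%MM.
    by apply: eq_bigr => s _; rewrite flE JE.
  by rewrite /c' addmK.
- move=> k c l vs ck lJ lvs vsl; set c' := (_ + _)%MM.
  have [ce [q0 eC]] := eP _ _ ck.
  have Uv s v : v \in U s -> [/\ Face (tight (mvec R v)), rk (tight (mvec R v)) = s.+1,
      u (tight (mvec R v)) = v & vcone M v].
    by move=> /UP[T [FT rT ->]]; rewrite uinj //; split=> //; have [] := uP0 _ FT.
  have {lvs} [vsU cnt vsl'] : [/\ forall v, v \in vs -> exists s, v \in U s,
      forall t : 'I_r, \sum_(v <- vs | rk (tight (mvec R v)) == t.+1) (1 : R) = (count_mem t l)%:R &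
      (forall s v, v \in vs -> v \in U s -> v = fl c s) -> vs = map (fl c) l].
    elim: l vs {lJ vsl c'} lvs => [|s l IH] [|v vs] //=.
      by move=> _; split=> // t; rewrite big_nil.
    move=> /andP[vU /IH[vsU cnt vsl]]; have [_ rv _ _] := Uv _ _ vU; split.
    - by move=> w; rewrite inE => /orP[/eqP ->|/vsU //]; exists s.
    - by move=> t; rewrite big_cons rv eqSS cnt natrD -[s == t]/(val s == val t); case: eqP; rewrite ?add0r.
    - move=> H; rewrite vsl => [|s' w wvs]; last by apply: H; rewrite inE wvs orbT.
      by rewrite (H s v) // mem_head.
  have [q c'C] : exists q, vcone q c'.
    have [q qC] : exists q, vcone q (\sum_(v <- vs) v)%MM.
      elim: vs {vsl c' cnt vsl'} vsU => [|v vs IH] vsU.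
        by exists 0%N; rewrite big_nil; apply/vconeP; rewrite mdeg0; split=> // i; rewrite mnm0E.
      have [s vU] := vsU v (mem_head _ _); have [_ _ _ vM] := Uv _ _ vU.
      have [w wvs|q qC] := IH; first by apply: vsU; rewrite inE wvs orbT.
      by exists (M + q)%N; rewrite big_cons; exact: vconeD.
    by exists (q0 + q)%N; exact: vconeD.
  (* An expansion of c' + delta: the fractional parts along the flag of c, and coefficient 1 for
     each member of [vs]. As [vs] has [J c s] points of dimension s + 1, its level sums are the
     coefficients of c. *)
  pose ps := [seq (lam c s - (J c s)%:R, (Tl c).1 s) | s : 'I_r <- index_enum 'I_r] ++
    [seq (1, tight (mvec R v)) | v <- vs].
  have psP p : p \in ps -> [/\ 0 < p.1, Face p.2 & (rk p.2 <= r)%N].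
    rewrite mem_cat => /orP[] /mapP[x xin ->] /=.
      have [FT rT _] := lamP _ _ ck _ (ltn_ord x); rewrite rT ltn_ord; split=> //.
      by have /andP[] := fracP _ _ x ck.
    by have [s /Uv[FT rT _ _]] := vsU _ xin; rewrite ltr01 rT ltn_ord.
  have lev (t : 'I_r) : level ell ps t = lam c t.
    rewrite /level big_cat !big_map /= cnt lJ (eq_bigl (xpred1 t)) ?big_pred1_eq ?subrK //.
    by move=> s; have [_ -> _] := lamP _ _ ck _ (ltn_ord s); rewrite eqSS.
  have [flc' _] := TlP _ _ c'C.
  (* Either c' has lexicographically larger coefficients, or all faces used lie on one flag; then
     [vs] consists of the points of the flag of c. *)
  have [|[t [tr lt eqt]]|[eql Teq]] := flag_lex_max pointed uP psP flc'.
  - rewrite /c' mvecD addrAC (eE _ _ ck) mvec_bigsum big_cat !big_map /=; congr (_ + _).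
      by apply: eq_bigr => s _; rewrite mvec_ratr.
    rewrite big_seq [RHS]big_seq; apply: eq_bigr => v /vsU[s /Uv[_ _ uv _]].
    by rewrite uv scale1r mvec_ratr.
  - exists t; split=> //; first by rewrite -(lev (Ordinal tr)).
    by move=> t' tt'; have /andP[_ t'r] := tt'; rewrite -(lev (Ordinal t'r)) eqt.
  case/eqP: vsl; apply: vsl' => s v vvs /Uv[FT rT uv _].
  have [_ rTs _] := lamP _ _ ck _ (ltn_ord s).
  rewrite -uv /fl; congr (u _).
  have /Teq : (1, tight (mvec R v)) \in ps by rewrite mem_cat; apply/orP; right; exact: map_f.
  rewrite /= rT => -> //.
  have /Teq : (lam c s - (J c s)%:R, (Tl c).1 s) \in ps.
    by rewrite mem_cat; apply/orP; left; apply: (map_f (fun s : 'I_r => _)); rewrite mem_index_enum.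
  by rewrite /= rTs => ->.
Qed.

(* A point of C is determined by r of its coordinates. *)
Lemma cone_bound_rk : cone_bound d a (rk cone_span).
Proof.
(* [f] selects columns of [A] that span its column space, so a vector in the row space vanishing at
   these coordinates is 0. *)
pose A := span ell cone_span; pose f := maxrankfun A^T.
have f_inj k m k' m' : vcone k m -> vcone k' m' -> (forall i, m (f i) = m' (f i)) -> m = m'.
  move=> mk mk' mm'; have /submxP[x xE] : (mvec rat m - mvec rat m' <= A)%MS.
    by rewrite addmx_sub ?eqmx_opp ?(mvec_span mk) ?(mvec_span mk').
  have /submxP[D DE] : (A^T <= rowsub f A^T)%MS by rewrite eq_maxrowsub.
  have v0 : mvec rat m - mvec rat m' = 0.
    apply: trmx_inj; rewrite xE trmx_mul DE -mulmxA.
    suff -> : rowsub f A^T *m x^T = 0 by rewrite mulmx0 trmx0.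
    apply/colP => i; rewrite mxE [RHS]mxE.
    have /rowP/(_ (f i)) := xE; rewrite !mxE mm' subrr => /esym; apply: etrans.
    by apply: eq_bigr => j _; rewrite !mxE mulrC.
  apply/mnmP => i; have /rowP/(_ i)/eqP := v0.
  by rewrite !mxE subr_eq0 eqr_nat => /eqP.
exists (\sum_i a i)%N => k.
pose B := ((\sum_i a i) * k)%N.
pose g (h : {ffun 'I_(\rank A^T) -> 'I_B.+1}) : mon :=
  xget 0%MM [set m | (exists k, vcone k m) /\ forall i, m (f i) = h i].
exists [seq g h | h <- enum {ffun 'I_(\rank A^T) -> 'I_B.+1}]; split.
  by rewrite size_map -cardE card_ffun !card_ord mxrank_tr.
move=> j m jk mj; have mB i : (m (f i) < B.+1)%N.
  rewrite ltnS; have /vconeP[_ /(_ (f i)) le] := mj; apply: leq_trans le _.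
  by rewrite mulnC leq_mul // (bigD1 (f i)) //= leq_addr.
pose h := [ffun i => Ordinal (mB i)].
apply/mapP; exists h; first by rewrite mem_enum.
rewrite /g; case: xgetP => [m' _ [[k' mk'] m'h]|/(_ m)].
  by apply: f_inj mj mk' _ => i; rewrite m'h ffunE.
by case; split; [exists j|move=> i; rewrite ffunE].
Qed.

End FlagSystem.

(** * Triangular bases *)

Lemma wf_finite_below (T : eqType) (R : T -> T -> Prop) :
  (forall x y z, R x y -> R y z -> R x z) -> (forall x, ~ R x x) ->
  (forall y, exists s : seq T, forall x, R x y -> x \in s) -> well_founded R.
Proof.
move=> Rtr Rirr Rfin y; have [s] := Rfin y.
have [N] := ubnP (size s); elim: N s y => [|N IH] s y; first by rewrite ltn0.
move=> sN sP.
apply: Acc_intro => x xy; apply: (IH (filter (predC (pred1 x)) s)) => [|z zx].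
  have c0 : (0 < count_mem x s)%N by rewrite -has_count has_pred1 sP.
  have := count_predC (pred1 x) s; rewrite size_filter.
  by move: (count _ _) (count _ _) c0 sN => p q c0 sN sE; rewrite -sE in sN; lia.
rewrite mem_filter sP ?andbT; last exact: Rtr xy.
by apply/eqP => zE; apply: (Rirr x); rewrite zE in zx.
Qed.

Lemma maximal_in_seq (T : eqType) (R : T -> T -> Prop) (s : seq T) :
  (forall x y z, R x y -> R y z -> R x z) -> (forall x, ~ R x x) -> s != [::] ->
  exists2 x, x \in s & forall y, y \in s -> ~ R x y.
Proof.
move=> Rtr Rirr; elim: s => // x [|x' s] IH _.
  by exists x; rewrite ?mem_head // => y; rewrite inE => /eqP ->; exact: Rirr.
have [//|z zs zmax] := IH; have [Rzx|Rzx] := pselect (R z x).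
  exists x; first exact: mem_head.
  by move=> y; rewrite inE => /orP[/eqP ->|/zmax nzy Rxy]; [exact: Rirr|apply: nzy; exact: Rtr Rxy].
exists z; first by rewrite inE zs orbT.
by move=> y; rewrite inE => /orP[/eqP -> //|]; exact: zmax.
Qed.

Section FlagBasis.
Variables (K : fieldType) (n d : nat) (a : 'I_n -> nat).
Hypothesis d_gt0 : (0 < d)%N.
Variables (F : comAlgType K) (F_ : nat -> set F) (Psi : {rmorphism F -> {mpoly K[n]}}).
Hypothesis FPsi : toric_model d a F_ Psi.
Local Notation S := {mpoly K[n]}.
Local Notation mon := 'X_{1..n}.
Local Notation vcone := (vcone d a).
Local Notation xm := (xm Psi).

Variables (r M : nat) (U : 'I_r -> seq mon) (fl : mon -> 'I_r -> mon).
Variables (J : mon -> 'I_r -> nat) (e : mon -> mon) (prec : mon -> mon -> Prop).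
Hypothesis flagU : flag_system d a M U fl J e prec.

Local Notation C := (fun m : mon => exists k, vcone k m).
Definition theta s : F := \sum_(v <- U s) xm v.

Let M0 : (0 < M)%N. Proof. by case: flagU => -[]. Qed.
Let U_uniq s : uniq (U s). Proof. by case: flagU => -[_ /(_ s)[]]. Qed.
Let UM s v : v \in U s -> vcone M v. Proof. by case: flagU => -[_ /(_ s)[_ H]] _ _ _ _; exact: H. Qed.
Let flU k c s : vcone k c -> fl c s \in U s. Proof. by case: flagU => _ _ H _ _ /H[]. Qed.
Let cE k c : vcone k c -> c = (e c + \sum_s fl c s *+ J c s)%MM.
Proof. by case: flagU => _ _ H _ _ /H[]. Qed.
Let eC k c : vcone k c -> C (e c). Proof. by case: flagU => _ _ H _ _ /H[]. Qed.

Lemma theta_prod k c (l : seq 'I_r) : vcone k c -> exists rest : S,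
  Psi (\prod_(s <- l) theta s) = 'X_[\sum_(s <- l) fl c s] + rest /\
  {in msupp rest, forall m, exists vs, [/\ all2 (fun s v => v \in U s) l vs,
    vs != map (fl c) l & m = (\sum_(v <- vs) v)%MM]}.
Proof.
move=> ck; elim: l => [|s l [rest [IH restP]]].
  exists 0; rewrite !big_nil rmorph1 mpolyX0 addr0; split=> // m.
  by rewrite msupp0.
pose th' : S := \sum_(v <- U s | v != fl c s) 'X_[v].
have thE : Psi (theta s) = 'X_[fl c s] + th'.
  rewrite rmorph_sum /= (bigD1_seq (fl c s)) ?(flU s ck) //= (Psi_xm FPsi (UM (flU s ck))).
  congr (_ + _); rewrite big_seq_cond [RHS]big_seq_cond; apply: eq_bigr => v /andP[vU _].
  by rewrite (Psi_xm FPsi (UM vU)).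
have th'P m : m \in msupp th' -> m \in U s /\ m != fl c s.
  rewrite mcoeff_msupp raddf_sum /= => H; suff : (m \in U s) && (m != fl c s) by move/andP.
  apply: contraNT H => H; apply/eqP; rewrite big_seq_cond; apply: big1 => v /andP[vU vn].
  rewrite mcoeffX; case: eqP => // vm; move: H; rewrite -vm vU vn //.
exists ('X_[fl c s] * rest + th' * Psi (\prod_(s <- l) theta s)); split.
  by rewrite !big_cons rmorphM /= thE IH mpolyXD; ring.
have flall : all2 (fun s v => v \in U s) l (map (fl c) l).
  by elim: (l) => //= s' l' ->; rewrite (flU s' ck).
move=> m /msuppD_le; rewrite mem_cat => /orP[] /msuppM_le/allpairsP[[m1 m2] /= [m1P m2P ->]].
  move: m1P; rewrite msuppX inE => /eqP ->; have [vs [vsl vsn ->]] := restP _ m2P.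
  exists (fl c s :: vs); split; [by rewrite /= (flU s ck)| |by rewrite big_cons].
  by apply: contraNneq vsn => -[->].
have [m1U m1n] := th'P _ m1P.
have [vs [vsl ->]] : exists vs, all2 (fun s v => v \in U s) l vs /\ m2 = (\sum_(v <- vs) v)%MM.
  move: m2P; rewrite IH => /msuppD_le; rewrite mem_cat msuppX inE => /orP[/eqP ->|/restP[vs [vsl _ ->]]].
    by exists (map (fl c) l); rewrite big_map.
  by exists vs.
exists (m1 :: vs); split; [by rewrite /= m1U| |by rewrite big_cons].
by apply: contraNneq m1n => -[->].
Qed.

Definition nlist (j : 'I_r -> nat) : seq 'I_r := flatten [seq nseq (j s) s | s <- index_enum 'I_r].

Lemma count_nlist j s : count_mem s (nlist j) = j s.
Proof.
rewrite /nlist count_flatten -map_comp sumnE big_map (bigD1 s) //= big1 => [|t ts].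
  by rewrite count_nseq /= eqxx mul1n addn0.
by rewrite count_nseq /= (negbTE ts).
Qed.

Lemma prod_nlist (x : 'I_r -> F) j : \prod_(s <- nlist j) x s = \prod_s x s ^+ j s.
Proof.
rewrite /nlist big_flatten big_map /=; apply: eq_bigr => s _.
by rewrite big_nseq iter_mulr_1.
Qed.

Lemma sum_nlist (x : 'I_r -> mon) j : (\sum_(s <- nlist j) x s = \sum_s x s *+ j s)%MM.
Proof.
rewrite /nlist big_flatten big_map /=; apply: eq_bigr => s _.
rewrite big_nseq; elim: (j s) => [|k IH] /=; first by rewrite mulm0n.
by rewrite IH mulmS.
Qed.

Lemma all2_mdeg l vs : all2 (fun s v => v \in U s) l vs ->
  mdeg (\sum_(v <- vs) v)%MM = (size l * (M * d))%N.
Proof.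
elim: l vs => [|s l IH] [|v vs] //=; first by rewrite big_nil mdeg0.
by move=> /andP[/UM/vconeP[vd _] /IH le]; rewrite big_cons mdegD vd le mulSn.
Qed.

(** Within one degree [prec] is reversed: an exponent with larger flag coefficients counts as lower.
    Each degree has finitely many exponents, so the order is well founded. *)
Definition below (m c : mon) : Prop :=
  (mdeg m < mdeg c)%N \/ mdeg m = mdeg c /\ prec c m.

Lemma below_trans x y z : below x y -> below y z -> below x z.
Proof.
have [_ [ptr _] _ _ _] := flagU.
move=> [xy|[xy pxy]] [yz|[yz pyz]].
- by left; exact: ltn_trans yz.
- by left; rewrite -yz.
- by left; rewrite xy.
- by right; split; [rewrite xy|exact: ptr pxy].
Qed.

Lemma below_irr x : ~ below x x.
Proof. by have [_ [_ pirr] _ _ _] := flagU; case=> [|[_ /pirr]]; rewrite ?ltnn. Qed.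

Lemma below_wf : well_founded below.
Proof.
apply: wf_finite_below; [exact: below_trans|exact: below_irr|].
move=> c; exists [seq bmnm m | m <- enum {: 'X_{1..n < (mdeg c).+1}}] => m H.
have mc : (mdeg m < (mdeg c).+1)%N by case: H => [/ltnW|[->]].
by apply/mapP; exists (BMultinom mc); rewrite ?mem_enum.
Qed.

Definition move c (j : 'I_r -> nat) : mon := (e c + \sum_s fl c s *+ j s)%MM.

Lemma moveP k c j : vcone k c ->
  [/\ C (move c j), fl (move c j) =1 fl c, J (move c j) =1 j & e (move c j) = e c].
Proof.
move=> ck; have [_ _ _ H _] := flagU; have [H1 H2 H3] := H _ _ j ck; split=> //.
have [l el] := eC ck; exists (l + \sum_s j s * M)%N; apply: vconeD => //.
elim/big_ind2 : _ => [|p m q w mk wl|s _]; [|exact: vconeD|].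
  by apply/vconeP; rewrite mdeg0; split=> // i; rewrite mnm0E.
exact: vcone_muln (UM (flU s ck)).
Qed.

Lemma move_id k c : vcone k c -> move c (J c) = c.
Proof. by move=> /cE. Qed.

Lemma eq_move c j j' : j =1 j' -> move c j = move c j'.
Proof. by move=> jj'; congr mnm_add; apply: eq_bigr => s _; rewrite jj'. Qed.

Lemma mdeg_move k c j : vcone k c -> mdeg (move c j) = (mdeg (e c) + (\sum_s j s) * (M * d))%N.
Proof.
move=> ck; rewrite /move mdegD; congr addn; rewrite big_distrl /=.
rewrite mdeg_sum; apply: eq_bigr => s _; rewrite mdegMn.
by have /vconeP[-> _] := UM (flU s ck); rewrite mulnC.
Qed.

Lemma theta_monomial k c j : vcone k c -> exists rest : S,
  Psi ((\prod_s theta s ^+ j s) * xm (e c)) = 'X_[move c j] + rest /\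
  {in msupp rest, forall m, below m (move c j)}.
Proof.
move=> ck; have [rest [th restP]] := theta_prod (nlist j) ck.
have [l el] := eC ck; have [[k' mk'] mfl mJ me] := moveP j ck.
exists (rest * 'X_[e c]); split.
  rewrite rmorphM /= -prod_nlist th (Psi_xm FPsi el) mulrDl -mpolyXD.
  by rewrite sum_nlist addmC.
move=> m /msuppM_le/allpairsP[[m1 m2] /= [m1P]]; rewrite msuppX inE => /eqP -> ->.
have [vs [vsl vsn ->]] := restP _ m1P; rewrite addmC.
have [_ _ _ _ H] := flagU; right; split.
  rewrite mdegD (all2_mdeg vsl) (mdeg_move _ ck); congr (_ + _ * _)%N.
  rewrite /nlist size_flatten /shape -map_comp sumnE big_map; apply: eq_bigr => s _.
  by rewrite /= size_nseq.
rewrite -me; apply: (H _ _ (nlist j) _ mk') => // [s|].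
  by rewrite count_nlist mJ.
by rewrite (eq_map mfl).
Qed.

Variable g : 'I_r -> {poly K}.
Hypotheses (gm : forall s, g s \is monic) (g1 : forall s, (1 < size (g s))%N).
Definition gth s : F := (map_poly (in_alg F) (g s)).[theta s].
Local Notation dg s := (size (g s)).-1.

Let dg0 s : (0 < dg s)%N. Proof. by rewrite -ltnS prednK // ltnW. Qed.

(** Dividing [J c s] by the degree of g_s with remainder gives a monic polynomial of degree [J c s]
    in theta_s, on which multiplication by g_s(theta_s) is a mere shift of the index. *)
Definition zb (c : mon) : F :=
  (\prod_s (gth s ^+ (J c s %/ dg s) * theta s ^+ (J c s %% dg s))) * xm (e c).

(** Expand the product of the monic polynomials [h s] in the theta_s. The top term is handled by
    [theta_monomial]; every other term has a smaller exponent at some theta_s, hence smaller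
    degree. *)
Lemma zb_triangular k c : vcone k c ->
  (Psi (zb c))@_c = 1 /\ forall m, (Psi (zb c))@_m != 0 -> m <> c -> below m c.
Proof.
move=> ck; pose h s := g s ^+ (J c s %/ dg s) * 'X^(J c s %% dg s).
have hm s : h s \is monic by rewrite rpredM ?rpredX ?monicX ?gm.
have sh s : size (h s) = (J c s).+1.
  rewrite size_monicM ?monic_neq0 ?monicXn ?rpredX ?gm // size_polyXn addnS /=.
  have gX0 : (0 < size (g s ^+ (J c s %/ dg s)))%N by rewrite size_poly_gt0 monic_neq0 ?rpredX ?gm.
  by rewrite -(prednK gX0) size_exp addSn {3}(divn_eq (J c s) (dg s)) mulnC.
have hE s : gth s ^+ (J c s %/ dg s) * theta s ^+ (J c s %% dg s) = (map_poly (in_alg F) (h s)).[theta s].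
  by rewrite /h rmorphM /= hornerM rmorphXn /= horner_exp map_polyXn hornerXn.
pose N := (\sum_s J c s).+1.
have JN s : (J c s < N)%N by rewrite ltnS (bigD1 s) //= leq_addr.
have zE : zb c = \sum_(al : {ffun 'I_r -> 'I_N})
    (\prod_s (h s)`_(al s)) *: ((\prod_s theta s ^+ al s) * xm (e c)).
  rewrite /zb; under eq_bigr => s _.
    rewrite hE (@horner_coef_wide _ N); last by rewrite (leq_trans (size_poly _ _)) ?sh.
    over.
  rewrite bigA_distr_bigA /= mulr_suml; apply: eq_bigr => al _.
  rewrite big_split /= -mulrA -mulr_algl; congr (_ * _).
  by rewrite -[RHS]/(in_alg F _) rmorph_prod; apply: eq_bigr => s _; rewrite coef_map.
pose alJ : {ffun 'I_r -> 'I_N} := [ffun s => Ordinal (JN s)].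
have hJ s : (h s)`_(J c s) = 1 by have := monicP (hm s); rewrite lead_coefE sh.
have cm : move c (fun s => alJ s) = c.
  by rewrite -[RHS](move_id ck); apply: eq_move => s; rewrite ffunE.
have [rest [thJ restP]] := theta_monomial (fun s => alJ s) ck; rewrite cm in thJ restP.
have lowP al m : al != alJ -> (\prod_s (h s)`_(al s)) *
    (Psi ((\prod_s theta s ^+ al s) * xm (e c)))@_m != 0 -> (mdeg m < mdeg c)%N.
  move=> alJn; rewrite mulf_eq0 negb_or => /andP[h0].
  have [rest' [-> rest'P]] := theta_monomial (fun s => al s) ck.
  have alJ' s : (al s <= J c s)%N.
    rewrite leqNgt; apply: contraNN h0 => lt; apply/prodf_eq0; exists s => //.
    by rewrite nth_default ?eqxx // sh.
  have le : (mdeg (move c (fun s => al s)) < mdeg c)%N.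
    rewrite -[X in (_ < mdeg X)%N](move_id ck) !(mdeg_move _ ck) ltn_add2l ltn_pmul2r ?muln_gt0 ?M0 //.
    have [s sn] : exists s, al s != alJ s.
      by apply: contrapT => H; case/eqP: alJn; apply/ffunP => s; apply/eqP/negPn/negP => sn; apply: H; exists s.
    rewrite (bigD1 s) //= [X in (_ < X)%N](bigD1 s) //= -addSn leq_add //; last by apply: leq_sum.
    by rewrite ltn_neqAle alJ' andbT; move: sn; rewrite ffunE -val_eqE.
  rewrite -mcoeff_msupp => /msuppD_le; rewrite mem_cat msuppX inE => /orP[/eqP -> //|/rest'P].
  by case=> [lt|[-> _]]; [exact: ltn_trans le|].
have coefE m : (Psi (zb c))@_m = \sum_(al : {ffun 'I_r -> 'I_N})
    (\prod_s (h s)`_(al s)) * (Psi ((\prod_s theta s ^+ al s) * xm (e c)))@_m.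
  by rewrite zE rmorph_sum raddf_sum /=; apply: eq_bigr => al _; rewrite (PsiZ FPsi) mcoeffZ.
have hal : \prod_s (h s)`_(alJ s) = 1 by apply: big1 => s _; rewrite ffunE.
split=> [|m]; rewrite coefE.
  rewrite (bigD1 alJ) //= hal mul1r thJ mcoeffD mcoeffX eqxx big1 ?addr0.
    rewrite memN_msupp_eq0 ?addr0 //; apply/negP => /restP; exact: below_irr.
  by move=> al aln; apply/eqP/negPn/negP => /(lowP _ _ aln); rewrite ltnn.
move=> m0 mc; have [al] : exists al : {ffun 'I_r -> 'I_N}, (\prod_s (h s)`_(al s)) * (Psi ((\prod_s theta s ^+ al s) * xm (e c)))@_m != 0.
  by apply: contrapT => H; case/eqP: m0; apply: big1 => al _; apply/eqP/negPn/negP => al0; apply: H; exists al.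
have [->|aln al0] := eqVneq al alJ; last by left; exact: lowP _ _ aln al0.
rewrite hal mul1r thJ -mcoeff_msupp => /msuppD_le; rewrite mem_cat msuppX inE => /orP[/eqP //|].
exact: restP.
Qed.

Lemma msupp_lincomb (s : seq mon) (Q : pred mon) (c : mon -> K) (P : mon -> S) m :
  m \in msupp (\sum_(i <- s | Q i) c i *: P i) -> exists i, [/\ i \in s, Q i & m \in msupp (P i)].
Proof.
rewrite mcoeff_msupp raddf_sum /= => H; apply: contrapT => H'; case/eqP: H.
rewrite big_seq_cond; apply: big1 => i /andP[si Qi].
suff Pm : (P i)@_m = 0 by rewrite mcoeffZ Pm mulr0.
by apply: memN_msupp_eq0; apply/negP => H''; apply: H'; exists i.
Qed.

(** Polynomials supported in C serve as the vector space with basis C; the map is linear and sends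
    the basis to the [zb]. *)
Definition zmap (p : S) : F := \sum_(m <- msupp p) p@_m *: zb m.

Lemma zmapE (s : seq mon) p : uniq s -> {subset msupp p <= s} -> zmap p = \sum_(m <- s) p@_m *: zb m.
Proof.
move=> us ps; rewrite [RHS](bigID (mem (msupp p))) /= [X in _ + X]big1 ?addr0.
  rewrite -big_filter; apply: perm_big; apply: uniq_perm; rewrite ?filter_uniq ?msupp_uniq //.
  by move=> m; rewrite mem_filter; case: (boolP (m \in msupp p)) => // /ps ->.
by move=> m /memN_msupp_eq0 ->; rewrite scale0r.
Qed.

Lemma zmap_linear c p q : zmap (c *: p + q) = c *: zmap p + zmap q.
Proof.
pose s := undup (msupp (c *: p + q) ++ msupp p ++ msupp q).
have sP (f : S) : {subset msupp f <= msupp (c *: p + q) ++ msupp p ++ msupp q} -> {subset msupp f <= s}.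
  by move=> H m /H; rewrite mem_undup.
rewrite !(@zmapE s) ?undup_uniq //; last 3 first.
- by apply: sP => m; rewrite !mem_cat => ->; rewrite !orbT.
- by apply: sP => m; rewrite !mem_cat => ->; rewrite !orbT.
- by apply: sP => m; rewrite !mem_cat => ->.
rewrite scaler_sumr -big_split /=; apply: eq_bigr => m _.
by rewrite mcoeffD mcoeffZ scalerDl scalerA.
Qed.

Lemma zmap0 : zmap 0 = 0.
Proof. by rewrite /zmap msupp0 big_nil. Qed.

Lemma zmapD p q : zmap (p + q) = zmap p + zmap q.
Proof. by rewrite -[p]scale1r zmap_linear !scale1r. Qed.

Lemma zmapZ c p : zmap (c *: p) = c *: zmap p.
Proof. by rewrite -[c *: p]addr0 zmap_linear zmap0 addr0. Qed.

Lemma zmap_sum I (s : seq I) (f : I -> S) : zmap (\sum_(i <- s) f i) = \sum_(i <- s) zmap (f i).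
Proof. by elim/big_ind2 : _ => [|x1 x2 y1 y2 <- <-|//]; rewrite ?zmap0 ?zmapD. Qed.

Lemma zmapX m : zmap 'X_[m] = zb m.
Proof. by rewrite /zmap msuppX big_seq1 mcoeffX eqxx scale1r. Qed.

(** Unitriangularity is inverted by recursion along [below]: the other monomials of [zb m] are lower
    and already in the image. *)
Lemma zmap_surj y : exists p, {in msupp p, forall m, C m} /\ zmap p = y.
Proof.
have xmP m : C m -> exists p, {in msupp p, forall m, C m} /\ zmap p = xm m.
  elim/(well_founded_ind below_wf): m => m IH [k mk].
  have [z1 zlow] := zb_triangular mk.
  have /choice[P PP] m' : exists p, m' != m -> m' \in msupp (Psi (zb m)) ->
      {in msupp p, forall m, C m} /\ zmap p = xm m'.
    have [m'm|m'm] := eqVneq m' m; first by exists 0.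
    have [m's|m's] := boolP (m' \in msupp (Psi (zb m))); last by exists 0.
    have [||p pP] := IH m'; last by exists p.
      by apply: zlow; [rewrite -mcoeff_msupp|exact/eqP].
    exact: Psi_supp FPsi _ _ m's.
  exists ('X_[m] - \sum_(m' <- msupp (Psi (zb m)) | m' != m) (Psi (zb m))@_m' *: P m'); split.
    move=> m' /msuppB_le; rewrite mem_cat msuppX inE => /orP[/eqP ->|]; first by exists k.
    move=> /msupp_lincomb[m'' [m''s m''m m'P]].
    by have [H' _] := PP _ m''m m''s; exact: H'.
  have zE : zb m = xm m + \sum_(m' <- msupp (Psi (zb m)) | m' != m) (Psi (zb m))@_m' *: xm m'.
    rewrite {1}(FE FPsi (zb m)) (bigD1_seq m) ?msupp_uniq //= ?z1 ?scale1r //.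
    by rewrite mcoeff_msupp z1 oner_eq0.
  have sE : zmap (\sum_(m' <- msupp (Psi (zb m)) | m' != m) (Psi (zb m))@_m' *: P m') =
      \sum_(m' <- msupp (Psi (zb m)) | m' != m) (Psi (zb m))@_m' *: xm m'.
    rewrite -big_filter -[RHS]big_filter zmap_sum big_seq [RHS]big_seq; apply: eq_bigr => m'.
    by rewrite mem_filter => /andP[m'm m's]; rewrite zmapZ (PP _ m'm m's).2.
  rewrite -[X in _ + X]scaleN1r addrC zmap_linear zmapX sE scaleN1r [in X in _ + X]zE.
  by rewrite addrC addrK.
have /choice[P PP] m : exists p, C m -> {in msupp p, forall m, C m} /\ zmap p = xm m.
  by have [/xmP[p pP]|nC] := pselect (C m); [exists p|exists 0].
exists (\sum_(m <- msupp (Psi y)) (Psi y)@_m *: P m); split.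
  by move=> m' /msupp_lincomb[m [/(Psi_supp FPsi)/PP[H _] _ m'P]]; exact: H.
rewrite zmap_sum [RHS](FE FPsi) big_seq [RHS]big_seq; apply: eq_bigr => m my.
by rewrite zmapZ (PP m (Psi_supp FPsi my)).2.
Qed.

Lemma zmap_inj (p : S) : {in msupp p, forall m, C m} -> zmap p = 0 -> p = 0.
Proof.
move=> pC p0; apply: contrapT => /eqP pn0.
(* At a maximal exponent of p no other basis element contributes, so its coefficient cannot
   cancel. *)
have [|m mp mmax] := @maximal_in_seq _ below (msupp p) below_trans below_irr.
  by rewrite msupp_eq0.
have [k mk] := pC m mp; have [z1 _] := zb_triangular mk.
have := congr1 (fun y => (Psi y)@_m) p0.
rewrite /zmap rmorph0 mcoeff0 rmorph_sum raddf_sum /= (bigD1_seq m) //= (PsiZ FPsi) mcoeffZ z1 mulr1.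
rewrite big_seq_cond big1 ?addr0 => [/eqP|m' /andP[m'p m'm]].
  by apply/negP; rewrite -mcoeff_msupp.
have [k' mk'] := pC m' m'p; have [_ zlow] := zb_triangular mk'.
rewrite (PsiZ FPsi) mcoeffZ; apply/eqP; rewrite mulf_eq0; apply/orP; right.
by apply: contrapT => /negP /zlow H; apply: (mmax _ m'p); apply: H => /esym /eqP; apply/negP.
Qed.

Definition bump s c : mon := move c (fun t => (J c t + (t == s) * dg s)%N).

Lemma gth_zb s k c : vcone k c -> gth s * zb c = zb (bump s c).
Proof.
move=> ck; have [_ _ JE eE] := moveP (fun t => (J c t + (t == s) * dg s)%N) ck.
rewrite /zb /bump eE mulrA; congr (_ * _); rewrite (bigD1 s) //= [RHS](bigD1 s) //=.
rewrite !JE eqxx mul1n divnDr // divnn dg0 modnDr addn1 exprS -!mulrA; do 3 congr (_ * _).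
by apply: eq_bigr => t /negbTE ts; rewrite JE ts addn0.
Qed.

Lemma bump_inj s k k' c c' : vcone k c -> vcone k' c' -> bump s c = bump s c' -> c = c'.
Proof.
move=> ck ck' bE.
have [_ flE JE eE] := moveP (fun t => (J c t + (t == s) * dg s)%N) ck.
have [_ flE' JE' eE'] := moveP (fun t => (J c' t + (t == s) * dg s)%N) ck'.
rewrite -(move_id ck) -(move_id ck') /move -eE -eE' -/(bump s c) -/(bump s c') bE; congr mnm_add.
apply: eq_bigr => t _; rewrite -flE -flE' -/(bump s c) -/(bump s c') bE; congr (_ *+ _)%MM.
by have /eqP := JE t; rewrite -/(bump s c) bE JE' eqn_add2r => /eqP.
Qed.

(** The [zb m] with this property are the basis elements that are multiples of some g_j(theta_j)
    with j < i; they span the ideal generated by these. *)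
Definition divisible (i : 'I_r) (m : mon) : Prop := C m /\ exists2 j : 'I_r, (j < i)%N & (dg j <= J m j)%N.

Lemma zmap_gth s (p : S) : {in msupp p, forall m, C m} ->
  gth s * zmap p = zmap (\sum_(m <- msupp p) p@_m *: 'X_[bump s m]).
Proof.
move=> pC; rewrite /zmap mulr_sumr -/(zmap _) zmap_sum big_seq [RHS]big_seq.
apply: eq_bigr => m /pC[k mk]; rewrite zmapZ zmapX -(gth_zb s mk).
by rewrite -scalerAr.
Qed.

Lemma msupp_bump s (p : S) m : m \in msupp (\sum_(m <- msupp p) p@_m *: 'X_[bump s m]) ->
  exists2 m', m' \in msupp p & m = bump s m'.
Proof.
move=> /msupp_lincomb[m' [m'p _]]; rewrite msuppX inE => /eqP ->; by exists m'.
Qed.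

Lemma ideal_gthP (i : 'I_r) y :
  ideal_gen [set gth j | j in [set j : 'I_r | (j < i)%N]] y <->
  exists p : S, {in msupp p, forall m, divisible i m} /\ zmap p = y.
Proof.
split=> [[k [c [f [fP ->]]]]|[p [pD <-]]].
  elim/big_ind : _ => [|x x' [p [pD <-]] [p' [p'D <-]]|q _].
  - by exists 0; rewrite zmap0; split=> // m; rewrite msupp0.
  - exists (p + p'); rewrite zmapD; split=> // m /msuppD_le; rewrite mem_cat => /orP[]; [exact: pD|exact: p'D].
  - have [j ji <-] := fP q; have [p [pC pE]] := zmap_surj (c q).
    rewrite mulrC -pE zmap_gth //; eexists; split; last reflexivity.
    move=> m /msupp_bump[m' /pC[k' m'C] ->].
    have [bC _ JE _] := moveP (fun t => (J m' t + (t == j) * dg j)%N) m'C.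
    by split=> //; exists j => //; rewrite JE eqxx mul1n leq_addl.
rewrite /zmap big_seq; apply: ideal_gen_sum => m /pD[[k mk] [j ji Jj]].
rewrite -mulr_algl; apply: ideal_genMl.
(* The shift by [bump j] is undone; truncated subtraction is exact because [dg j <= J m j]. *)
pose m' := move m (fun t => (J m t - (t == j) * dg j)%N).
have [[k' mk'] flE JE eE] := moveP (fun t => (J m t - (t == j) * dg j)%N) mk.
have -> : m = bump j m'.
  rewrite -[LHS](move_id mk) /bump /move eE; congr mnm_add; apply: eq_bigr => t _.
  rewrite flE JE subnK //; case: eqP => [->|_]; by rewrite ?mul1n ?mul0n.
rewrite -(gth_zb j mk') mulrC; apply: ideal_genMl; apply: ideal_gen_sub.
by exists j.
Qed.

(** Multiplication by g_i(theta_i) maps basis elements injectively to basis elements and changes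
    only the i-th entry of [J], so it neither creates nor destroys divisibility at an index j <
    i. *)
Lemma gth_regular (i : 'I_r) x :
  ideal_gen [set gth j | j in [set j : 'I_r | (j < i)%N]] (gth i * x) ->
  ideal_gen [set gth j | j in [set j : 'I_r | (j < i)%N]] x.
Proof.
move=> /ideal_gthP[q [qD qE]]; apply/ideal_gthP.
have [p [pC pE]] := zmap_surj x; exists p; split=> // m mp; have [k mk] := pC m mp.
rewrite -pE zmap_gth // in qE; set sh := \sum_(_ <- _) _ in qE.
have shC : {in msupp sh, forall m, C m}.
  by move=> m1 /msupp_bump[m2 /pC[k2 m2C] ->]; have [] := moveP (fun t => (J m2 t + (t == i) * dg i)%N) m2C.
have e0 : q - sh = 0.
  apply: zmap_inj; last by rewrite -[- sh]scaleN1r addrC zmap_linear qE scaleN1r addNr.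
  move=> m1 /msuppB_le; rewrite mem_cat => /orP[/qD[]//|]; exact: shC.
have bq : bump i m \in msupp q.
  have /eqP := e0; rewrite subr_eq0 => /eqP ->; rewrite mcoeff_msupp /sh raddf_sum /=.
  rewrite (bigD1_seq m) ?msupp_uniq //= mcoeffZ mcoeffX eqxx mulr1 big_seq_cond big1 ?addr0 -?mcoeff_msupp //.
  move=> m' /andP[/pC[k' mk'] m'm]; rewrite mcoeffZ mcoeffX; case: eqP => [/(bump_inj mk' mk) e1|]; rewrite ?mulr0 //.
  by rewrite e1 eqxx in m'm.
have [_ [j ji]] := qD _ bq; have [_ _ -> _] := moveP (fun t => (J m t + (t == i) * dg i)%N) mk.
rewrite -[j == i]/(val j == val i) (ltn_eqF ji) addn0 => Jj.
by split; [exists k|exists j].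
Qed.

End FlagBasis.

(** * The theorem *)

Section CohenMacaulay.
Variables (K : fieldType) (n d : nat) (a : 'I_n -> nat).
Hypothesis d_gt0 : (0 < d)%N.
Variables (F : comAlgType K) (F_ : nat -> set F) (Psi : {rmorphism F -> {mpoly K[n]}}).
Hypothesis FPsi : toric_model d a F_ Psi.

Lemma toric_generated (Q : F -> Prop) : (forall c : K, Q c%:A) ->
  (forall u, u \in [seq xm Psi v | v <- veronese_gens a d] -> Q u) ->
  (forall u v, Q u -> Q v -> Q (u + v)) -> (forall u v, Q u -> Q v -> Q (u * v)) ->
  forall u, Q u.
Proof.
move=> Qc Qg QD QM x.
have Qx k m : vcone d a k m -> Q (xm Psi m).
  elim: k m => [|k IH] m mk.
    by rewrite (vcone0 mk) (xm0 FPsi) -[1]scale1r; exact: Qc.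
  have [[w [w1 wm wk]] _] := vcone_split d_gt0 mk.
  rewrite -(submK wm) (xmD FPsi wk w1); apply: QM; first exact: IH.
  by apply: Qg; apply: map_f; rewrite mem_veronese.
rewrite (FE FPsi x) big_seq; apply: (big_ind Q).
- by have := Qc 0; rewrite scale0r.
- exact: QD.
- by move=> m /(Psi_supp FPsi)[k mk]; rewrite -mulr_algl; apply: QM; [exact: Qc|exact: Qx mk].
Qed.

Lemma toric_cohen_macaulay : cohen_macaulay F.
Proof.
have [M [U [fl [J [e [prec flagU]]]]]] := flag_system_exists a d_gt0 rational_independence.
apply: (cohen_macaulay_criterion (theta := theta Psi U) (toric_noetherian d_gt0 FPsi) toric_generated).
  by move=> x; apply: (toric_alg_dep d_gt0 FPsi); exact: cone_bound_rk.
move=> g gm g1 f i x; exact: (gth_regular d_gt0 FPsi flagU gm g1).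
Qed.

End CohenMacaulay.

Theorem corollary1p10 (K : fieldType) (n d : nat) (d_gt0 : (0 < d)%N)
    (a : 'I_n -> nat)
    (a_noninc : forall i j : 'I_n, (i <= j)%N -> (a j <= a i)%N) :
  let G := veronese_gens a d in
  let I := monomial_ideal K G in
  let F := fiber_cone I in
  let J := defining_ideal K G in
  let T := gen_matrix K G d in
  let t := tvar K G in
  [/\ J = ideal_gen (binomial_2minors T) /\
      J = ideal_gen [set f | exists u v u' v',
            [/\ u \in G /\ v \in G, u' \in G /\ v' \in G,
                is_submatrix2 (mx22 (t u) (t u') (t v') (t v)) T &
                f = t u * t v - t u' * t v']],
      reduced_ring F /\ koszul (fiber_comp I) &
      cohen_macaulay F /\ normal_domain F].
Proof.
move=> G I F J T t.
have [Psi [Pinj PZ _ Pcomp Psurj]] := fiber_cone_embedding K d_gt0 (@veronese_mdeg n d a).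
have FPsi : toric_model d a (fiber_comp I) Psi.
  split=> // [k x|f].
    by rewrite Pcomp; split=> H m /H /(gsum_vcone a d_gt0).
  rewrite -Psurj; split=> H m /H[k mk]; exists k; exact/(gsum_vcone a d_gt0).
split; first exact: (veronese_defining_ideal K a d_gt0).
- by split; [exact: (toric_reduced FPsi)|exact: (toric_koszul d_gt0 FPsi)].
- by split; [exact: (toric_cohen_macaulay d_gt0 FPsi)|exact: (toric_normal d_gt0 FPsi)].
Qed.
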